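(* Let $(M,\omega)$ be a compact lcK manifold, $\dim_{\mathbb C}M\ge2$, admitting a global lcK immersion into an infinite dimensional classical Hopf manifold $(H^\infty_\lambda,\omega_H)$, i.e. a holomorphic map $F\colon M\to H^\infty_\lambda$ with $F^*\omega_H=\omega$. Then $(M,\omega)$ admits a proper potential.
   Context: **lcK structures.** An lcK (locally conformally Kähler) structure on a complex manifold $M$ is a Hermitian metric with associated $(1,1)$-form $\omega$ and a closed $1$-form $\theta$ (the Lee form) such that $d\omega=\theta\wedge\omega$. A Kähler covering of $(M,\omega)$ is a covering $\tilde M\to M$ on which the pull-back of the Lee form is exact, $\tilde\theta=dh$, endowed with the Kähler form $\tilde\omega=e^{-h}\omega$. The deck group $\Gamma$ acts on $\tilde\omega$ by homotheties: $\gamma^*\tilde\omega=\chi(\gamma)\tilde\omega$, $\chi\colon\Gamma\to\mathbb R^{>0}$. $(M,\omega)$ admits a potential if some Kähler covering has a global function $\psi>0$ with $\tilde\omega=dd^c\psi$ and $\gamma^*\psi=\chi(\gamma)\psi$ for all $\gamma\in\Gamma$; the potential is proper if $\psi$ is a proper function, which (for lcK structures with potential on compact manifolds) is the same as the lcK rank, i.e. the rank of $\operatorname{im}\chi$, being $1$. **Infinite dimensional classical Hopf manifold.** $H^\infty_\lambda=(\ell^2(\mathbb C)\setminus\{0\})/\mathbb Z$, where $\mathbb Z$ is generated by $\lambda\cdot\mathrm{id}$, $\lambda\in\mathbb C\setminus\{0\}$, $|\lambda|\ne1$, with lcK form $\omega_H=\|z\|^{-2}\omega_0$, where $\omega_0=dd^c\|z\|^2$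 is the form of the flat metric. *)

(* Defs.v *)
From HB Require Import structures.
From mathcomp Require Import all_boot all_order all_algebra complex ring.
From mathcomp Require Import all_classical all_reals all_analysis.

Set Implicit Arguments.
Unset Strict Implicit.
Unset Printing Implicit Defensive.

Import Order.TTheory GRing.Theory Num.Theory.
Import numFieldNormedType.Exports.
Local Open Scope classical_set_scope.
Local Open Scope ring_scope.
Local Open Scope complex_scope.
Local Open Scope quotient_scope.

(* Complex manifolds are modelled on normed spaces [E] over [R[i]]
   ('rV[R[i]]_n or ell2 R).  The library has no restriction of scalars from
   [R[i]] to [R], so real derivatives of real-valued functions on [E] are
   taken along the real lines [t |-> x + t%:C *: v]. *)
Section calculus.
Context {R : realType} {E : normedModType R[i]}.
Implicit Types (f : E -> R) (U : set E) (x u v w : E).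

Definition rderivable f x v := derivable (fun t : R => f (x + t%:C *: v)) 0 1.

Definition rderive f x v : R := derive1 (fun t : R => f (x + t%:C *: v)) 0.

Fixpoint Ck (k : nat) U f : Prop :=
  (forall x, U x -> {for x, continuous f}) /\
  if k is k'.+1 then
    forall v, (forall x, U x -> rderivable f x v) /\
              Ck k' U (fun x => rderive f x v)
  else True.

(* This is the usual notion of smoothness on an open set [U] when [E] is
   finite-dimensional, the only case in which it is used. *)
Definition smooth_on U f := forall k, Ck k U f.

Definition d1 (a : E -> E -> R) x u v : R :=
  rderive (a ^~ v) x u - rderive (a ^~ u) x v.

Definition d2 (a : E -> E -> E -> R) x u v w : R :=
  rderive (fun y => a y v w) x u - rderive (fun y => a y u w) x v
  + rderive (fun y => a y u v) x w.

Definition wedge12 (a : E -> R) (b : E -> E -> R) u v w : R :=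
  a u * b v w - a v * b u w + a w * b u v.

(* The sign of d^c = - d o J is the one for which dd^c f (u, J u) >= 0 when f
   is plurisubharmonic, i.e. dd^c = 2 i del delbar. *)
Definition dc f x u : R := - rderive f x ('i%C *: u).

Definition ddc f : E -> E -> E -> R := d1 (dc f).

End calculus.

(* [coord] and [param] are meaningful only on [cdom] and on its image. *)
Record chart {R : realType} (M : topologicalType) (E : normedModType R[i]) :=
  Chart {
    cdom : set M;
    coord : M -> E;
    param : E -> M;
    cdom_open : open cdom;
    cimg_open : open (coord @` cdom);
    coordK : forall y, cdom y -> param (coord y) = y;
    coord_continuous : forall y, cdom y -> {for y, continuous coord};
    param_continuous :
      forall x, (coord @` cdom) x -> {for x, continuous param} }.

Definition cimg {R : realType} {M : topologicalType} {E : normedModType R[i]}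
  (c : chart M E) : set E := coord c @` cdom c.

Section maps.
Context {R : realType} {M N : topologicalType} {E G : normedModType R[i]}.
Implicit Types (A : set (chart M E)) (B : set (chart N G)) (F : M -> N).

Definition local_map F (c : chart M E) (d : chart N G) : E -> G :=
  coord d \o F \o param c.

Definition local_dom F (c : chart M E) (d : chart N G) : set E :=
  coord c @` (cdom c `&` F @^-1` cdom d).

(* [differentiable] is Frechet differentiability over [R[i]]. *)
Definition holomorphic A B F :=
  continuous F /\
  forall c d, A c -> B d ->
    forall x, local_dom F c d x -> differentiable (local_map F c d) x.

End maps.

Section manifolds.
Context {R : realType} {E : normedModType R[i]}.

Definition complex_atlas {M : topologicalType} (A : set (chart M E)) :=
  (forall y, exists2 c, A c & cdom c y) /\ holomorphic A A id.

Definition complex_manifold (M : topologicalType) (A : set (chart M E)) :=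
  [/\ hausdorff_space M, @second_countable M, [set: M] !=set0,
      connected [set: M] & complex_atlas A].

(* A differential form on a manifold with atlas [A] is given by its local
   expressions: at the chart [c] and the point [x] of [cimg c] it is a form on
   the tangent space [E].  Compatibility of the local expressions is the
   invariance under pull-back by the identity required in [is_form1] and
   [is_form2]. *)
Definition form1 (M : topologicalType) := chart M E -> E -> E -> R.
Definition form2 (M : topologicalType) := chart M E -> E -> E -> E -> R.

End manifolds.
Arguments form1 {R} E M.
Arguments form2 {R} E M.

Section pullback.
Context {R : realType} {M N : topologicalType} {E G : normedModType R[i]}.
Variables (A : set (chart M E)) (B : set (chart N G)) (F : M -> N).

(* a = F^* b *)
Definition is_pullback1 (b : form1 G N) (a : form1 E M) :=
  forall c d, A c -> B d -> forall x, local_dom F c d x -> forall u,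
    let f := local_map F c d in a c x u = b d (f x) ('d f x u).

Definition is_pullback2 (b : form2 G N) (a : form2 E M) :=
  forall c d, A c -> B d -> forall x, local_dom F c d x -> forall u v,
    let f := local_map F c d in a c x u v = b d (f x) ('d f x u) ('d f x v).

End pullback.

Section forms.
Context {R : realType} {E : normedModType R[i]} {M : topologicalType}.
Implicit Types (A : set (chart M E)) (f : M -> R).

Definition is_form1 A (a : form1 E M) :=
  [/\ forall c x, A c -> cimg c x -> forall (r : R) u v,
        a c x (r%:C *: u + v) = r * a c x u + a c x v,
      forall c u, A c -> smooth_on (cimg c) (fun x => a c x u) &
      is_pullback1 A A id a a].

Definition is_form2 A (a : form2 E M) :=
  [/\ forall c x, A c -> cimg c x -> forall (r : R) u v w,
        a c x (r%:C *: u + v) w = r * a c x u w + a c x v w,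
      forall c x, A c -> cimg c x -> forall u v, a c x u v = - a c x v u,
      forall c u v, A c -> smooth_on (cimg c) (fun x => a c x u v) &
      is_pullback2 A A id a a].

(* The (1,1)-form associated to the Hermitian metric g(u,v) = a(u, J v). *)
Definition hermitian_form A (a : form2 E M) :=
  [/\ is_form2 A a,
      forall c x, A c -> cimg c x -> forall u v,
        a c x ('i%C *: u) ('i%C *: v) = a c x u v &
      forall c x, A c -> cimg c x -> forall u, u != 0 ->
        0 < a c x u ('i%C *: u)].

Definition closed1 A (a : form1 E M) :=
  forall c x, A c -> cimg c x -> forall u v, d1 (a c) x u v = 0.

Definition lck_structure A (omega : form2 E M) (theta : form1 E M) :=
  [/\ hermitian_form A omega, is_form1 A theta, closed1 A theta &
      forall c x, A c -> cimg c x -> forall u v w,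
        d2 (omega c) x u v w = wedge12 (theta c x) (omega c x) u v w].

Definition smooth_fun A f :=
  forall c, A c -> smooth_on (cimg c) (f \o param c).

Definition dfun f : form1 E M := fun c x u => rderive (f \o param c) x u.

Definition ddcfun f : form2 E M := fun c x u v => ddc (f \o param c) x u v.

Definition scale2 f (a : form2 E M) : form2 E M :=
  fun c x u v => f (param c x) * a c x u v.

Definition eq_form2 A (a b : form2 E M) :=
  forall c x, A c -> cimg c x -> forall u v, a c x u v = b c x u v.

End forms.

Section coverings.
Context {N M : topologicalType}.
Variable p : N -> M.

Definition evenly_covered (V : set M) :=
  exists S : set (set N),
    [/\ S !=set0, trivIset S id, p @^-1` V = \bigcup_(U in S) U &
        forall U, S U ->
          [/\ open U, p @` U = V, {in U &, injective p} &
              forall W, W `<=` U -> open W -> open (p @` W)]].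

Definition covering_map :=
  continuous p /\ forall y, exists V, [/\ open V, V y & evenly_covered V].

Definition deck (g : N -> N) :=
  [/\ continuous g, p \o g = p &
      exists g', [/\ continuous g', cancel g g' & cancel g' g]].

(* M is the quotient of the connected space N by the deck group. *)
Definition galois_covering :=
  [/\ connected [set: N], covering_map &
      forall x y, p x = p y -> exists2 g, deck g & g x = y].

End coverings.

Section potential.
Context {R : realType} {E : normedModType R[i]} {M : topologicalType}.
Variables (A : set (chart M E)) (omega : form2 E M) (theta : form1 E M).

(* The complex structure lifted along a local homeomorphism p. *)
Definition lifted_atlas {N : topologicalType} (p : N -> M) : set (chart N E) :=
  [set d | exists2 c, A c & cdom d `<=` p @^-1` cdom c /\
                            forall y, cdom d y -> coord d y = coord c (p y)].

(* p^* theta = dh and omega_t = e^{-h} p^* omega *)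
Definition kahler_covering {N : topologicalType} (p : N -> M) (h : N -> R)
    (omega_t : form2 E N) :=
  let AN := lifted_atlas p in
  [/\ galois_covering p, smooth_fun AN h, is_pullback1 AN A p theta (dfun h) &
      exists2 omega' : form2 E N, is_pullback2 AN A p omega omega' &
        omega_t = scale2 (fun y => expR (- h y)) omega'].

Definition is_potential {N : topologicalType} (p : N -> M)
    (omega_t : form2 E N) (psi : N -> R) :=
  let AN := lifted_atlas p in
  [/\ smooth_fun AN psi, forall y, 0 < psi y,
      eq_form2 AN omega_t (ddcfun psi) &
      exists chi : (N -> N) -> R, forall g, deck p g ->
        [/\ 0 < chi g,
            is_pullback2 AN AN g omega_t (scale2 (fun=> chi g) omega_t) &
            forall y, psi (g y) = chi g * psi y]].

(* Properness of psi as a map to the positive reals; deck transformations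
   acting by nontrivial homotheties make psi take values arbitrarily close to 0,
   so this is not properness as a map to R. *)
Definition proper_pos {N : topologicalType} (psi : N -> R) :=
  forall K : set R, compact K -> K `<=` [set r | 0 < r] ->
    compact (psi @^-1` K).

Definition has_proper_potential :=
  exists (N : topologicalType) (p : N -> M) (h : N -> R)
         (omega_t : form2 E N) (psi : N -> R),
    [/\ kahler_covering p h omega_t, is_potential p omega_t psi &
        proper_pos psi].

End potential.

Section ell2.
Context {R : realType}.
Implicit Types (z w : R[i]) (x y : nat -> R[i]).

Definition sqmod z : R := complex.Re z ^+ 2 + complex.Im z ^+ 2.

Lemma sqmodE z : `|z| = (Num.sqrt (sqmod z))%:C.
Proof. by rewrite normc_def. Qed.

Lemma sqmod_ge0 z : 0 <= sqmod z.
Proof. by rewrite addr_ge0 ?sqr_ge0. Qed.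

Lemma sqmodM z w : sqmod (z * w) = sqmod z * sqmod w.
Proof. by case: z w => [a b] [c d]; rewrite /sqmod /=; ring. Qed.

Lemma sqmodD z w (t : R) : 0 < t ->
  sqmod (z + w) <= (1 + t) * sqmod z + (1 + t^-1) * sqmod w.
Proof.
move=> t0; case: z w => [a b] [c d]; rewrite /sqmod /= -subr_ge0.
suff -> : (1 + t) * (a ^+ 2 + b ^+ 2) + (1 + t^-1) * (c ^+ 2 + d ^+ 2) -
  ((a + c) ^+ 2 + (b + d) ^+ 2) = t^-1 * ((t * a - c) ^+ 2 + (t * b - d) ^+ 2).
  by rewrite mulr_ge0 ?invr_ge0 ?addr_ge0 ?sqr_ge0 1?ltW.
by field; rewrite gt_eqF.
Qed.

Definition square_summable : {pred nat -> R[i]} :=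
  [pred x : nat -> R[i] | `[< cvgn (series (sqmod \o x)) >] ].

Lemma square_summableP x :
  reflect (cvgn (series (sqmod \o x))) (x \in square_summable).
Proof. exact: asboolP. Qed.

Lemma cvg_scale (a : R) (u : R^nat) : cvgn u ->
  cvgn ((fun=> a) * u) /\ limn ((fun=> a) * u) = a * limn u.
Proof.
move=> cu; have c : ((fun=> a) * u) @ \oo --> a * limn u.
  by apply: cvgM; [exact: cvg_cst|exact: cu].
by split; [apply/cvg_ex; exists (a * limn u)|exact: cvg_lim].
Qed.

Lemma sqmodD_cvg x y (t : R) : 0 < t ->
  cvgn (series (sqmod \o x)) -> cvgn (series (sqmod \o y)) ->
  cvgn (series (sqmod \o (x + y))) /\
  limn (series (sqmod \o (x + y))) <=
    (1 + t) * limn (series (sqmod \o x)) + (1 + t^-1) * limn (series (sqmod \o y)).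
Proof.
move=> t0 cx cy.
pose v : R^nat := (fun k => (1 + t) * sqmod (x k) + (1 + t^-1) * sqmod (y k)).
have sv : series v = (fun=> 1 + t) * series (sqmod \o x) +
                     (fun=> 1 + t^-1) * series (sqmod \o y).
  apply/funext => n; rewrite /series /= big_split /= -!mulr_sumr.
  by [].
have cv : cvgn (series v).
  rewrite sv; apply: is_cvgD.
    exact: (cvg_scale _ cx).1.
  exact: (cvg_scale _ cy).1.
have le k : (sqmod \o (x + y)) k <= v k by exact: sqmodD.
have cxy : cvgn (series (sqmod \o (x + y))).
  apply: series_le_cvg cv => // k; first exact: sqmod_ge0.
  exact: le_trans (sqmod_ge0 _) (le k).
split=> //; have -> : (1 + t) * limn (series (sqmod \o x)) +
    (1 + t^-1) * limn (series (sqmod \o y)) = limn (series v).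
  rewrite sv limD; first by rewrite (cvg_scale _ cx).2 (cvg_scale _ cy).2.
    exact: (cvg_scale _ cx).1.
  exact: (cvg_scale _ cy).1.
by apply: ler_lim => //; apply: nearW => n; apply: ler_sum => k _; exact: le.
Qed.

Lemma sqmodZ_series a x :
  series (sqmod \o (a *: x)) = (fun=> sqmod a) * series (sqmod \o x).
Proof.
apply/funext => n; rewrite /series /= -[RHS]/(sqmod a * _) mulr_sumr.
by apply: eq_bigr => k _; rewrite /= -sqmodM.
Qed.

Fact square_summable_submod : submod_closed square_summable.
Proof.
split.
  apply/square_summableP; have -> : sqmod \o (0 : nat -> R[i]) = fun=> 0.
    by apply/funext => k; rewrite /= /sqmod /= expr0n addr0.
  have -> : series (fun=> 0 : R) = fun=> 0.
    by apply/funext => n; rewrite /series /= big1.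
  exact: is_cvg_cst.
move=> a x y /square_summableP cx /square_summableP cy.
apply/square_summableP; apply: (proj1 (sqmodD_cvg (t := 1) _ _ cy)) => //.
rewrite sqmodZ_series; exact: (cvg_scale _ cx).1.
Qed.
HB.instance Definition _ := GRing.isSubmodClosed.Build R[i] (nat -> R[i])
  square_summable square_summable_submod.

Record ell2 := Ell2 { ell2_seq :> nat -> R[i]; _ : ell2_seq \in square_summable }.

HB.instance Definition _ := [isSub for ell2_seq].
HB.instance Definition _ := [Choice of ell2 by <:].
HB.instance Definition _ := [SubChoice_isSubLmodule of ell2 by <:].

Definition ell2_norm (z : ell2) : R := Num.sqrt (limn (series (sqmod \o z))).

Lemma ell2_cvg (z : ell2) : cvgn (series (sqmod \o z)).
Proof. by case: z => z /= /square_summableP. Qed.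

Arguments ell2_cvg z : clear implicits.

Lemma ell2_lim_ge (z : ell2) n : series (sqmod \o z) n <= limn (series (sqmod \o z)).
Proof.
apply: (nondecreasing_cvgn_le _ (ell2_cvg z)).
by apply: nondecreasing_series => k _ _; exact: sqmod_ge0.
Qed.

Lemma ell2_lim_ge0 (z : ell2) : 0 <= limn (series (sqmod \o z)).
Proof. by apply: le_trans (ell2_lim_ge z 0); rewrite /series /= big_geq. Qed.

Fact ell2_norm0_eq0 (z : ell2) : (ell2_norm z)%:C = 0 :> R[i] -> z = 0.
Proof.
move=> /complexI/eqP; rewrite sqrtr_eq0 => l0.
apply/val_inj/funext => k /=; apply/eqP; rewrite -normr_eq0 sqmodE.
suff -> : sqmod (z k) = 0 by rewrite sqrtr0.
apply/eqP; rewrite eq_le sqmod_ge0 andbT.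
apply: le_trans l0; apply: le_trans (ell2_lim_ge z k.+1).
rewrite /series /= big_nat_recr //= lerDr sumr_ge0 // => i _.
exact: sqmod_ge0.
Qed.

Fact ell2_normZ (a : R[i]) (z : ell2) :
  (ell2_norm (a *: z))%:C = `|a| * (ell2_norm z)%:C :> R[i].
Proof.
rewrite /ell2_norm sqmodZ_series (cvg_scale _ (ell2_cvg z)).2.
by rewrite sqrtrM ?sqmod_ge0 // sqmodE -rmorphM.
Qed.

Fact ell2_normD (z w : ell2) :
  (ell2_norm (z + w))%:C <= (ell2_norm z)%:C + (ell2_norm w)%:C :> R[i].
Proof.
rewrite -rmorphD /= lecR.
have [z0|z0] := eqVneq (ell2_norm z) 0.
  by rewrite (ell2_norm0_eq0 (congr1 _ z0)) add0r lerDr sqrtr_ge0.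
have [w0|w0] := eqVneq (ell2_norm w) 0.
  by rewrite (ell2_norm0_eq0 (congr1 _ w0)) addr0 lerDl sqrtr_ge0.
have zp : 0 < ell2_norm z by rewrite lt_def z0 sqrtr_ge0.
have wp : 0 < ell2_norm w by rewrite lt_def w0 sqrtr_ge0.
rewrite -(@ler_pXn2r _ 2) // ?nnegrE ?addr_ge0 ?sqrtr_ge0 // sqr_sqrtr ?ell2_lim_ge0 //.
have [|_] := @sqmodD_cvg z w (ell2_norm w / ell2_norm z) _ (ell2_cvg z) (ell2_cvg w).
  by rewrite divr_gt0.
move=> /le_trans; apply; rewrite -(sqr_sqrtr (ell2_lim_ge0 z)).
rewrite -(sqr_sqrtr (ell2_lim_ge0 w)) -/(ell2_norm z) -/(ell2_norm w).
by rewrite le_eqVlt; apply/orP; left; apply/eqP; field; rewrite z0 w0.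
Qed.

HB.instance Definition _ := Lmodule_isNormed.Build R[i] ell2
  ell2_normD ell2_normZ ell2_norm0_eq0.

End ell2.
Arguments ell2 R : clear implicits.

Section hopf.
Context {R : realType}.
Variable lambda : R[i].

Definition ell2_star : topologicalType :=
  set_type [set z : ell2 R | z != 0].

Definition hopf_rel (x y : ell2_star) : bool :=
  `[< exists k : int, set_val x = lambda ^ k *: set_val y >].

Fact hopf_rel_refl : reflexive hopf_rel.
Proof. by move=> x; apply/asboolP; exists 0; rewrite expr0z scale1r. Qed.

Lemma hopf_rel_neq0 (x y : ell2_star) (k : int) :
  set_val x = lambda ^ k *: set_val y -> lambda ^ k != 0.
Proof.
move=> xy; apply/eqP => k0; have : set_val x != 0 := set_valP x.
by rewrite xy k0 scale0r eqxx.
Qed.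

Fact hopf_rel_sym : symmetric hopf_rel.
Proof.
suff H x y : hopf_rel x y -> hopf_rel y x by move=> x y; apply/idP/idP; exact: H.
move=> /asboolP[k xy]; apply/asboolP; exists (- k).
by rewrite xy scalerA -invr_expz mulVf ?scale1r ?(hopf_rel_neq0 xy).
Qed.

Fact hopf_rel_trans : transitive hopf_rel.
Proof.
move=> y x z /asboolP[k xy] /asboolP[l yz]; apply/asboolP.
have [l0|l0] := eqVneq lambda 0; last first.
  by exists (k + l); rewrite expfzDr // xy yz scalerA.
exists l; have := hopf_rel_neq0 xy.
rewrite l0 expfz_eq0 eqxx andbT negbK => /eqP k0.
by rewrite xy k0 expr0z scale1r yz l0.
Qed.

Canonical hopf_equiv :=
  EquivRel hopf_rel hopf_rel_refl hopf_rel_sym hopf_rel_trans.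

Definition hopf : topologicalType := quotient_topology {eq_quot hopf_equiv}.

Definition hopf_proj (z : ell2_star) : hopf := \pi_{eq_quot hopf_equiv} z.

(* The quotient complex structure: the charts are the local inverses of the
   projection. *)
Definition hopf_atlas : set (chart hopf (ell2 R)) :=
  [set d | forall y, cdom d y ->
     exists2 z : ell2_star, coord d y = set_val z & hopf_proj z = y].

Definition flat_form : ell2 R -> ell2 R -> ell2 R -> R :=
  ddc (fun z : ell2 R => ell2_norm z ^+ 2).

(* ||z||^-2 omega_0, invariant under multiplication by lambda, read in the
   charts of hopf_atlas. *)
Definition hopf_form : form2 (ell2 R) hopf :=
  fun _ z u v => ell2_norm z ^- 2 * flat_form z u v.

End hopf.
Arguments hopf_atlas {R} lambda.
Arguments hopf_form {R} lambda.

(* Main.v *)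
(* Locally F lifts to a holomorphic map f into ell2, and omega is |f|^-2 times
   the pull-back of the flat form; put psi = |f|^2.  Since psi omega is closed,
   d omega = theta /\ omega gives (d psi + psi theta) /\ omega = 0, hence
   d psi = - psi theta because omega is nondegenerate and dim M >= 2.  This
   equation shows that psi is smooth and that h = - ln psi is a primitive of
   theta, while dd^c psi = psi omega by the chain rule.  As |lambda| <> 1, the
   functions ln |f| are well defined up to multiples of ln |lambda|, so they
   become a global function on a component N of a covering of M contained in
   M * R; there e^(2 height) is the potential, proper because N is closed in
   M * R and M is compact.

   Holomorphy is only complex differentiability, so f must be shown to have
   second derivatives.  As |df v|^2 = psi omega(v, iv) / 4 is continuous, df is
   locally bounded, and differentiation under the integral sign yields the
   Cauchy formula for the derivative of a scalar function <a, f> without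
   Goursat's lemma; differentiating this formula gives symmetric second
   derivatives.  Strong from weak: |df v|^2 is differentiable, so that the
   increments of df v along a line are o(t^(1/2)). *)

Require Import Defs.
From mathcomp Require Import all_boot all_order all_algebra complex ring lra.
From mathcomp Require Import all_classical all_reals all_analysis.
From mathcomp Require Import measurable_realfun.

Set Implicit Arguments.
Unset Strict Implicit.
Unset Printing Implicit Defensive.

Import Order.TTheory GRing.Theory Num.Theory.
Import numFieldNormedType.Exports.
Local Open Scope classical_set_scope.
Local Open Scope ring_scope.
Local Open Scope complex_scope.

(** * Differentiation under the integral sign and integrals of bounded derivatives *)

Section real_integrals.
Context {R : realType}.
Notation mu := (@lebesgue_measure R).
Implicit Types (a b c s t u v : R).

(** The differential [df] is never differentiated in norm: what is available is the derivative,
    along real lines, of [rip a (df v)] for each fixed [a]. Yet [psi om] and [dc psi] pair two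
    moving vectors of [ell2]. The product rule for such a pairing has the error
    [rip (p t - p 0) (q t - q 0)], and Cauchy-Schwarz makes it o(t) as soon as both increments are
    o(t^(1/2)). This is what the bound on the increments of [df v] is for.

    As long as second derivatives are not known to exist, [df] is only locally bounded, so the
    integration lemmas ask for bounded derivatives, not continuous ones. Symmetry needs no exchange
    of integrals: differentiating the Cauchy formula gives one mixed derivative as a circle
    integral, and the Cauchy formula applied once more recognises this integral as the other.

    Constants: [dd^c |z|^2 (u, v) = 4 Re <i u, v>] is the origin of the 4 relating [psi om] to [df];
    the 2 in the exponent of the potential is there because [psi = |f|^2] while the height is
    [ln |f|]. *)

Lemma continuous_integrable_itv (w : R -> R) a b :
  continuous w -> mu.-integrable `[a, b] (EFin \o w).
Proof.
move=> cw; apply: continuous_compact_integrable; first exact: segment_compact.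
exact: continuous_subspaceT.
Qed.

Lemma is_derive_continuous (w : R -> R) t l :
  is_derive t 1 w l -> {for t, continuous w}.
Proof. by case=> dw _; apply/differentiable_continuous/derivable1_diffP. Qed.

Lemma derive1_val (w : R -> R) t l : is_derive t 1 w l -> derive1 w t = l.
Proof. by case=> _ <-; rewrite derive1E. Qed.

Lemma derivable1_is_derive (w : R -> R) t :
  derivable w t 1 -> is_derive t 1 w (derive1 w t).
Proof. by move=> dw; apply: DeriveDef; [exact: dw|rewrite derive1E]. Qed.

(** [f'] is bounded but not assumed continuous in [x], so its integrability is part of the
    conclusion; the constant [c] serves as dominating function. *)
Lemma is_derive_under_integral (f f' : R -> R -> R) a b u v t c :
  (forall s, s \in `]u, v[ -> continuous (f s)) ->
  (forall s x, s \in `]u, v[ -> is_derive s 1 (f ^~ x) (f' s x)) ->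
  (forall s x, s \in `]u, v[ -> `|f' s x| <= c) ->
  t \in `]u, v[ ->
  mu.-integrable `[a, b] (EFin \o f' t) /\
  is_derive t 1 (fun s => \int[mu]_(x in `[a, b]) f s x)
    (\int[mu]_(x in `[a, b]) f' t x).
Proof.
move=> cf df bf tuv.
have mab : measurable (`[a, b] : set R) by exact: measurable_itv.
have d1E s x : s \in `]u, v[ -> partial1of2 f s x = f' s x.
  by move=> suv; apply: derive1_val; exact: df.
have intf s : s \in `]u, v[ -> mu.-integrable `[a, b] (EFin \o f s).
  by move=> suv; apply: continuous_integrable_itv; exact: cf.
have c0 : 0 <= c by exact: le_trans (normr_ge0 _) (bf t 0 tuv).
have derf1 s x : `]u, v[%classic s -> `[a, b]%classic x ->
    derivable (f ^~ x) s 1 by move=> suv _; case: (df s x suv).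
have intG : mu.-integrable `[a, b] (EFin \o (fun=> c)).
  by apply: continuous_integrable_itv => x; exact: cvg_cst.
have G_ub s x : `]u, v[%classic s -> `[a, b]%classic x ->
    `|partial1of2 f s x| <= c by move=> suv _; rewrite d1E ?bf.
split; last first.
  apply: DeriveDef.
    exact: (@derivable_under_integral _ _ _ mu f _ mab _ _ _ tuv intf derf1 _ (fun=> c0) intG G_ub).
  rewrite -derive1E.
  rewrite (@differentiation_under_integral _ _ _ mu f _ mab _ _ _ tuv intf derf1 _ (fun=> c0) intG G_ub).
  by apply: eq_Rintegral => x _; exact: d1E.
apply: measurable_bounded_integrable => //.
- exact/compact_finite_measure/segment_compact.
- have tuv' : u < t < v by move: tuv; rewrite in_itv.
  (* Measurability of [f' t]: it is the pointwise limit of the difference quotients with steps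
     [h n], and the factor [(v - t) / 2] keeps [t + h n] inside []u, v[]. *)
  pose h n : R := (v - t) / 2 * n.+1%:R^-1.
  have h0 n : 0 < h n by rewrite mulr_gt0 ?invr_gt0 ?ltr0n// divr_gt0; lra.
  have hv n : t + h n \in `]u, v[.
    rewrite in_itv/=; have := h0 n; have : h n <= (v - t) / 2.
      by rewrite /h ler_piMr ?invf_le1 ?ler1n ?ltr0n//; lra.
    lra.
  apply: (@measurable_realfun.measurable_fun_cvg _ _ _ _ (fun n x => (f (t + h n) x - f t x) / h n)).
  + move=> n; apply/measurable_funM => //; apply: measurable_funB.
      by apply: measurable_funTS; apply: continuous_measurable_fun; exact/cf/hv.
    by apply: measurable_funTS; apply: continuous_measurable_fun; exact: cf.
  + move=> x _; have [] := df t x tuv.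
    move=> /cvg_ex[l ft] fl; have hcvg : h n @[n --> \oo] --> (0 : R).
      rewrite -[X in _ --> X](mulr0 ((v - t) / 2)).
      by apply: cvgM; [exact: cvg_cst|exact: cvg_harmonic].
    have fl' : l = f' t x by rewrite -fl; apply/esym/cvg_lim.
    rewrite -fl'; move/cvgr_dnbhsP : ft => /(_ h).
    have hh : (forall n, h n != 0) /\ h n @[n --> \oo] --> (0 : R).
      by split => // n; rewrite gt_eqF.
    move=> /(_ hh); apply: cvg_trans; apply: near_eq_cvg; apply: nearW => n.
    by rewrite /= [(h n)%:A]mulr1 [h n + t]addrC mulrC.
- exists c; split; first exact: num_real.
  by move=> M cM x _ /=; apply: le_trans (ltW cM); exact: bf.
Qed.

Lemma continuous_antiderivative (w : R -> R) u v : continuous w ->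
  exists W : R -> R, forall s, s \in `]u, v[ -> is_derive s 1 W (w s).
Proof.
move=> cw; exists (fun s => \int[mu]_(x in `[u, s]) w x) => s.
rewrite in_itv/= => /andP[us sv].
have [dW Ww] := continuous_FTC1_closed sv (continuous_integrable_itv u v cw) us (cw s).
by apply: DeriveDef; [exact: dW|rewrite -derive1E].
Qed.

Lemma Rintegral_derive (W w : R -> R) a b : a < b -> continuous w ->
  (forall s, s \in `[a, b] -> is_derive s 1 W (w s)) ->
  \int[mu]_(x in `[a, b]) w x = W b - W a.
Proof.
move=> ab cw dW; rewrite /Rintegral (@continuous_FTC2 _ w W) //.
- exact: continuous_subspaceT.
- have cW s : s \in `[a, b] -> {for s, continuous W}.
    by move=> sab; exact: is_derive_continuous (dW s sab).
  split=> [s sab| |].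
  + by have [] := dW s (subset_itv_oo_cc sab).
  + by apply: cvg_at_right_filter; apply: cW; rewrite bound_itvE ltW.
  + by apply: cvg_at_left_filter; apply: cW; rewrite bound_itvE ltW.
- by move=> s sab; apply: derive1_val; exact: dW (subset_itv_oo_cc sab).
Qed.

(* [W] need not be C^1: differentiate [s |-> \int_a^b W (x + s) dx] at 0, once
   under the integral sign and once through an antiderivative of [W]. *)
Lemma Rintegral_bounded_derive (W w : R -> R) a b c : a < b ->
  (forall s, is_derive s 1 W (w s)) -> (forall s, `|w s| <= c) ->
  mu.-integrable `[a, b] (EFin \o w) /\
  \int[mu]_(x in `[a, b]) w x = W b - W a.
Proof.
move=> ab dW bw.
have cW : continuous W by move=> s; exact: is_derive_continuous (dW s).
have dshift (s x : R) : is_derive s 1 (fun y : R => x + y) 1.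
  by rewrite -[X in is_derive _ _ _ X]add0r; apply: is_deriveD.
have dWs (s x : R) : is_derive s 1 (fun y : R => W (x + y)) (w (x + s)).
  by rewrite -[X in is_derive _ _ _ X]mulr1; apply: (@is_derive1_comp _ W (+%R x)).
have z11 : (0 : R) \in `](-1), 1[ by rewrite in_itv/= oppr_lt0 ltr01.
have cWs s : s \in `](-1), 1[ -> continuous (fun x => W (x + s)).
  move=> _ x; apply: (@continuous_comp _ _ _ (fun y => y + s) W); last exact: cW.
  by apply: cvgD; [exact: cvg_id|exact: cvg_cst].
have [] := @is_derive_under_integral (fun s x => W (x + s)) (fun s x => w (x + s))
  a b (-1) 1 0 c cWs (fun s x _ => dWs s x) (fun s x _ => bw (x + s)) z11.
rewrite (_ : (fun x => w (x + 0)) = w); last by apply/funext => x; rewrite addr0.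
  move=> iw dI; split => //.
  (* The margin 1 at both ends leaves room for the shifts [a + s] and [b + s] with [|s| < 1]. *)
  have [V dV] := continuous_antiderivative (a - 1) (b + 1) cW.
  have dV0 : is_derive (0 : R) (1 : R) (fun s : R => V (b + s) - V (a + s)) (W b - W a).
    apply: is_deriveB; rewrite -[X in is_derive _ _ _ X]mulr1.
      by apply: (@is_derive1_comp _ V (+%R b)); rewrite addr0; apply: dV; rewrite in_itv/=; lra.
    by apply: (@is_derive1_comp _ V (+%R a)); rewrite addr0; apply: dV; rewrite in_itv/=; lra.
  case: dI => _ <-; case: dV0 => _ <-; apply: near_eq_derive.
  near=> s.
  have s11 : s \in `](-1), 1[ by near: s; exact: near_in_itvoo.
  move: s11; rewrite in_itv/= => /andP[s1 s2].
  have s11' : s \in `](-1), 1[ by rewrite in_itv/= s1.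
  have dVs (x : R) : x \in `[a, b] -> is_derive x 1 (fun y : R => V (y + s)) (W (x + s)).
    rewrite in_itv/= => /andP[ax xb].
    rewrite -[X in is_derive _ _ _ X]mulr1.
    have dVxs : is_derive (x + s) 1 V (W (x + s)) by apply: dV; rewrite in_itv/=; lra.
    have dxs : is_derive x 1 (fun y : R => y + s) 1.
      by rewrite -[X in is_derive _ _ _ X]addr0; apply: is_deriveD.
    exact: (@is_derive1_comp _ V (fun y => y + s) x _ _ dVxs dxs).
  exact: (Rintegral_derive ab (cWs s s11') dVs).
Unshelve. all: by end_near.
Qed.

End real_integrals.

(** * Derivatives of complex-valued functions of a real variable *)

Section complex_curves.
Context {R : realType}.
Implicit Types (t s : R) (F G : R -> R[i]) (l m : R[i]).

(** Without division, and with [h = 0] allowed: in this form error estimates can simply be added. *)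
Lemma is_derive_epsP (f : R -> R) t (l : R) :
  is_derive t 1 f l <->
  forall e, 0 < e -> exists2 d, 0 < d &
    forall h, `|h| < d -> `|f (t + h) - f t - h * l| <= e * `|h|.
Proof.
split.
  move=> [/cvg_ex[l' ft] fl] e e0.
  have {fl} fl' : l' = l by rewrite -fl; apply/esym/cvg_lim.
  rewrite fl' in ft.
  move/cvgrPdist_le : ft => /(_ _ e0); rewrite near_withinE => -[d /= d0 H].
  exists d => // h hd; have [->|h0] := eqVneq h 0.
    by rewrite addr0 subrr mul0r subr0 normr0 mulr0.
  have := H h; rewrite /= sub0r normrN => /(_ hd h0).
  rewrite [h%:A]mulr1 [h + t]addrC => Hh.
  have -> : f (t + h) - f t - h * l = - (h * (l - h^-1 *: (f (t + h) - f t))).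
    by rewrite mulrBr [h^-1 *: _]/(h^-1 * _) mulVKf// opprB.
  by rewrite normrN normrM mulrC ler_wpM2r.
move=> H.
have ft : h^-1 *: (f (h *: (1 : R) + t) - f t) @[h --> 0^'] --> l.
  apply/cvgrPdist_le => e e0; have [d d0 Hd] := H e e0.
  rewrite near_withinE; exists d => //= h; rewrite /= sub0r normrN => hd h0.
  have hn0 : 0 < `|h| by rewrite normr_gt0.
  rewrite -(ler_pM2l hn0) -normrM [X in _ <= X]mulrC mulrBr.
  rewrite [h^-1 *: _]/(h^-1 * _) mulVKf//.
  by rewrite [h *: 1]mulr1 [h + t]addrC -normrN opprB; exact: Hd.
apply: DeriveDef; first by apply/cvg_ex; exists l.
exact: cvg_lim.
Qed.

(** The quotient [f s / s] has derivative 0 on []0, r[], hence is constant by the mean value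
    theorem; since [f 0 = 0], its limit at 0 is [f' 0]. Only differentiability at 0 enters there,
    not continuity of [f']. *)
Lemma homogeneous_solution (f f' : R -> R) r t : 0 < t < r ->
  (forall s, `|s| < r -> is_derive s 1 f (f' s)) ->
  (forall s, `|s| < r -> s * f' s = f s) -> f t = t * f' 0.
Proof.
move=> /andP[t0 tr] df ff'.
have r0 : 0 < r by exact: lt_trans tr.
have f0 : f 0 = 0 by rewrite -(ff' 0) ?mul0r ?normr0.
have dq (s : R) : 0 < s < r -> is_derive s 1 (fun y : R => f y * y^-1) 0.
  move=> /andP[s0 sr].
  have ds : is_derive s 1 f (f' s) by apply: df; rewrite gtr0_norm.
  have s0' : s != 0 by rewrite gt_eqF.
  have dV : is_derive s 1 (fun y : R => y^-1) (- s ^- 2 *: 1) by apply: is_deriveV.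
  have -> : 0 = f s *: (- s ^- 2 *: 1) + s^-1 *: f' s :> R.
    rewrite -(ff' s) ?gtr0_norm//.
    by rewrite /GRing.scale/=; field.
  exact: is_deriveM.
have qcst (s : R) : 0 < s < t -> f s * s^-1 = f t * t^-1.
  move=> /andP[s0 st].
  have dst (y : R) : y \in `]s, t[ -> is_derive y 1 (fun y : R => f y * y^-1) 0.
    by rewrite in_itv/= => /andP[sy yt]; apply: dq; lra.
  have cst : {within `[s, t], continuous (fun y : R => f y * y^-1)}.
    apply: derivable_within_continuous => y; rewrite in_itv/= => /andP[sy yt].
    have yr : 0 < y < r by lra.
    by have [] := dq y yr.
  by have [y _] := MVT st dst cst; rewrite mul0r => /subr0_eq.
have dfz : is_derive (0 : R) (1 : R) f (f' 0) by apply: df; rewrite normr0.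
have tn0 : t != 0 by rewrite gt_eqF.
suff -> : f' 0 = f t * t^-1 by field.
apply/eqP; rewrite -subr_eq0 -normr_le0; apply/ler_addgt0Pl => e e0; rewrite addr0.
have [d d0 Hd] := (is_derive_epsP f 0 (f' 0)).1 dfz e e0.
pose s := Num.min (d / 2) (t / 2).
have s0 : 0 < s by rewrite lt_min; apply/andP; split; lra.
have sd : s < d by apply: (@le_lt_trans _ _ (d / 2)); rewrite ?ge_min ?lexx//; lra.
have st : s < t by apply: (@le_lt_trans _ _ (t / 2)); rewrite ?ge_min ?lexx ?orbT//; lra.
have := Hd s; rewrite gtr0_norm// add0r f0 subr0 => /(_ sd).
have sn0 : s != 0 by rewrite gt_eqF.
have -> : f s = s * (f t * t^-1) by rewrite -(qcst s) ?s0//; field.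
by rewrite -mulrBr normrM gtr0_norm// mulrC ler_pM2r// distrC.
Qed.

(** Taken componentwise, so that real calculus and the Lebesgue integral apply to each part
    unchanged. *)
Definition cderive F t (l : R[i]) :=
  is_derive t 1 (fun s => complex.Re (F s)) (complex.Re l) /\
  is_derive t 1 (fun s => complex.Im (F s)) (complex.Im l).

(** Bounding the two parts instead of the modulus matches componentwise integration; the price is
    the factor 2 in [cboundM]. *)
Definition cbound c (z : R[i]) := `|complex.Re z| <= c /\ `|complex.Im z| <= c.

Lemma ReM (z w : R[i]) : complex.Re (z * w) =
  complex.Re z * complex.Re w - complex.Im z * complex.Im w.
Proof. by case: z w => [? ?] [? ?]. Qed.

Lemma ImM (z w : R[i]) : complex.Im (z * w) =
  complex.Re z * complex.Im w + complex.Im z * complex.Re w.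
Proof. by case: z w => [? ?] [? ?]. Qed.

Lemma ReB (z w : R[i]) : complex.Re (z - w) = complex.Re z - complex.Re w.
Proof. by case: z w => [? ?] [? ?]. Qed.

Lemma ImB (z w : R[i]) : complex.Im (z - w) = complex.Im z - complex.Im w.
Proof. by case: z w => [? ?] [? ?]. Qed.

Lemma ReD (z w : R[i]) : complex.Re (z + w) = complex.Re z + complex.Re w.
Proof. by case: z w => [? ?] [? ?]. Qed.

Lemma ImD (z w : R[i]) : complex.Im (z + w) = complex.Im z + complex.Im w.
Proof. by case: z w => [? ?] [? ?]. Qed.

Lemma cbound0 c z : cbound c z -> 0 <= c.
Proof. by case=> /(le_trans (normr_ge0 _)). Qed.

Lemma cboundM c d z w : cbound c z -> cbound d w -> cbound (2 * c * d) (z * w).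
Proof.
move=> [z1 z2] [w1 w2]; have c0 := le_trans (normr_ge0 _) z1.
have cd x y : `|x| <= c -> `|y| <= d -> `|x * y| <= c * d.
  by move=> *; rewrite normrM ler_pM.
split; rewrite ?ReM ?ImM -mulrA mulr2n mulrDl mul1r.
  by apply: le_trans (ler_normB _ _) _; apply: lerD; exact: cd.
by apply: le_trans (ler_normD _ _) _; apply: lerD; exact: cd.
Qed.

Lemma cboundB c d z w : cbound c z -> cbound d w -> cbound (c + d) (z - w).
Proof.
move=> [z1 z2] [w1 w2]; split; rewrite ?ReB ?ImB.
  by apply: le_trans (ler_normB _ _) _; exact: lerD.
by apply: le_trans (ler_normB _ _) _; exact: lerD.
Qed.

Lemma cderive_cst (c : R[i]) t : cderive (fun=> c) t 0.
Proof. by split; apply: is_derive_cst. Qed.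

Lemma cderiveB F G t l m : cderive F t l -> cderive G t m ->
  cderive (fun s => F s - G s) t (l - m).
Proof.
move=> [F1 F2] [G1 G2]; split.
  by rewrite ReB; under eq_fun do rewrite ReB; apply: is_deriveB.
by rewrite ImB; under eq_fun do rewrite ImB; apply: is_deriveB.
Qed.

Lemma cderiveM F G t l m : cderive F t l -> cderive G t m ->
  cderive (fun s => F s * G s) t (F t * m + l * G t).
Proof.
move=> [F1 F2] [G1 G2]; split.
  under eq_fun do rewrite ReM.
  have -> : complex.Re (F t * m + l * G t) =
    (complex.Re (F t) *: complex.Re m + complex.Re (G t) *: complex.Re l) -
    (complex.Im (F t) *: complex.Im m + complex.Im (G t) *: complex.Im l).
    by rewrite ReD !ReM /GRing.scale/=; ring.
  by apply: is_deriveB; apply: is_deriveM.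
under eq_fun do rewrite ImM.
have -> : complex.Im (F t * m + l * G t) =
    (complex.Re (F t) *: complex.Im m + complex.Im (G t) *: complex.Re l) +
    (complex.Im (F t) *: complex.Re m + complex.Re (G t) *: complex.Im l).
  by rewrite ImD !ImM /GRing.scale/=; ring.
by apply: is_deriveD; apply: is_deriveM.
Qed.

Lemma cderiveMl (c : R[i]) F t l : cderive F t l -> cderive (fun s => c * F s) t (c * l).
Proof.
move=> dF; have := cderiveM (cderive_cst c t) dF.
by rewrite mul0r addr0.
Qed.

Lemma cderiveMr (c : R[i]) F t l : cderive F t l -> cderive (fun s => F s * c) t (l * c).
Proof.
move=> dF; have := cderiveM dF (cderive_cst c t).
by rewrite mulr0 add0r.
Qed.

Definition cis t : R[i] := cos t +i* sin t.

Lemma cisN t : cis t * cis (- t) = 1.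
Proof.
apply/eqP; rewrite /cis cosN sinN eq_complex /=; apply/andP; split; apply/eqP.
  by rewrite mulrN opprK -!expr2 cos2Dsin2.
by ring.
Qed.

Lemma cbound_cis t : cbound 1 (cis t).
Proof.
by split; rewrite /= ler_norml ?cos_geN1 ?cos_le1 ?sin_geN1 ?sin_le1.
Qed.

Lemma cis2pi : cis (pi *+ 2) = cis 0.
Proof. by rewrite /cis cos2pi sin2pi cos0 sin0. Qed.

Lemma cisN2pi : cis (- (pi *+ 2)) = cis 0.
Proof. by rewrite /cis cosN sinN cos2pi sin2pi cos0 sin0 oppr0. Qed.

Lemma cderive_cis t : cderive cis t ('i * cis t).
Proof.
split; rewrite ?ReM ?ImM /= !(mul0r, mul1r, add0r, addr0, sub0r).
  exact: is_derive_cos.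
exact: is_derive_sin.
Qed.

Lemma cderive_cisN t : cderive (fun s => cis (- s)) t (- 'i * cis (- t)).
Proof.
have dN : is_derive t 1 (-%R : R -> R) (-1) by apply: is_deriveN.
split; rewrite ?ReM ?ImM /= !(mul0r, oppr0, mulN1r, add0r, addr0, sub0r) ?opprK.
  have -> : sin (- t) = - sin (- t) * -1 by ring.
  exact: (@is_derive1_comp _ cos -%R t _ _ (is_derive_cos _) dN).
have -> : - cos (- t) = cos (- t) * -1 by ring.
exact: (@is_derive1_comp _ sin -%R t _ _ (is_derive_sin _) dN).
Qed.

Lemma cderive_real t : cderive (fun s => s%:C) t 1.
Proof. by split; [exact: is_derive_id|exact: is_derive_cst]. Qed.

End complex_curves.

(** * The Cauchy formula for the derivative at the centre of a disc *)

Section cauchy.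
Context {R : realType}.
Notation mu := (@lebesgue_measure R).
Notation twopi := (pi *+ 2 : R).
Implicit Types (t s r c : R) (w : R -> R[i]) (l z : R[i]).

Definition cint w : R[i] :=
  (\int[mu]_(x in `[0, twopi]) complex.Re (w x)) +i*
  (\int[mu]_(x in `[0, twopi]) complex.Im (w x)).

Definition cintegrable w :=
  mu.-integrable `[0, twopi] (EFin \o (fun x => complex.Re (w x))) /\
  mu.-integrable `[0, twopi] (EFin \o (fun x => complex.Im (w x))).

Definition ccontinuous w :=
  continuous (fun x => complex.Re (w x)) /\ continuous (fun x => complex.Im (w x)).

Lemma twopi_gt0 : 0 < twopi.
Proof. by rewrite pmulrn_lgt0 // pi_gt0. Qed.

Lemma ccontinuous_integrable w : ccontinuous w -> cintegrable w.
Proof. by case=> w1 w2; split; apply: continuous_integrable_itv. Qed.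

Lemma cderive_continuous w w' : (forall x, cderive w x (w' x)) -> ccontinuous w.
Proof. by move=> dw; split=> x; have [d1 d2] := dw x; exact: is_derive_continuous. Qed.

Lemma cintM (z : R[i]) w : cintegrable w ->
  cintegrable (fun x => z * w x) /\ cint (fun x => z * w x) = z * cint w.
Proof.
move=> [w1 w2]; have mI : measurable (`[0, twopi] : set (measurableTypeR R)) by exact: measurable_itv.
have iz (a : R) (f : R -> R) : mu.-integrable `[0, twopi] (EFin \o f) ->
    mu.-integrable `[0, twopi] (EFin \o (fun x => a * f x)).
  by move=> fi; apply: (integrableZl mI a fi).
have iD (f g : R -> R) : mu.-integrable `[0, twopi] (EFin \o f) ->
    mu.-integrable `[0, twopi] (EFin \o g) ->
    mu.-integrable `[0, twopi] (EFin \o (fun x => f x + g x)).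
  by move=> fi gi; apply: (integrableD mI fi gi).
have iB (f g : R -> R) : mu.-integrable `[0, twopi] (EFin \o f) ->
    mu.-integrable `[0, twopi] (EFin \o g) ->
    mu.-integrable `[0, twopi] (EFin \o (fun x => f x - g x)).
  by move=> fi gi; apply: (integrableB mI fi gi).
have eRe : (fun x => complex.Re (z * w x)) = (fun x =>
    complex.Re z * complex.Re (w x) - complex.Im z * complex.Im (w x)).
  by apply/funext => x; exact: ReM.
have eIm : (fun x => complex.Im (z * w x)) = (fun x =>
    complex.Re z * complex.Im (w x) + complex.Im z * complex.Re (w x)).
  by apply/funext => x; exact: ImM.
split; first by split; rewrite ?eRe ?eIm; [apply: iB|apply: iD]; exact: iz.
rewrite /cint eRe eIm; apply/eqP; rewrite eq_complex ReM ImM /=.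
rewrite RintegralB ?RintegralD//; try exact: iz.
by rewrite !RintegralZl ?eqxx.
Qed.

Lemma cintB w v : cintegrable w -> cintegrable v ->
  cint (fun x => w x - v x) = cint w - cint v.
Proof.
move=> [w1 w2] [v1 v2].
have mI : measurable (`[0, twopi] : set (measurableTypeR R)) by exact: measurable_itv.
rewrite /cint; apply/eqP; rewrite eq_complex ReB ImB /=; apply/andP; split; apply/eqP.
  by under eq_Rintegral do rewrite ReB; rewrite RintegralB.
by under eq_Rintegral do rewrite ImB; rewrite RintegralB.
Qed.

Lemma cint_cst z : cint (fun=> z) = twopi%:C * z.
Proof.
have mI : measurable (`[0, twopi] : set (measurableTypeR R)) by exact: measurable_itv.
rewrite /cint !Rintegral_cst//.
have -> : fine (mu `[0, twopi]) = twopi.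
  by rewrite lebesgue_measure_itv/= lte_fin twopi_gt0 /= subr0.
by case: z => x y; apply/eqP; rewrite eq_complex /=; apply/andP; split; apply/eqP; ring.
Qed.

Lemma cderive_under_integral (f f' : R -> R -> R[i]) (u v t c : R) :
  (forall s, u < s < v -> ccontinuous (f s)) ->
  (forall s x, u < s < v -> cderive (f ^~ x) s (f' s x)) ->
  (forall s x, u < s < v -> cbound c (f' s x)) ->
  u < t < v ->
  cintegrable (f' t) /\ cderive (fun s => cint (f s)) t (cint (f' t)).
Proof.
move=> cf df bf tuv.
have itv s : s \in `]u, v[ -> u < s < v by rewrite in_itv.
have tuv' : t \in `]u, v[ by rewrite in_itv.
have [i1 d1] := @is_derive_under_integral _ (fun s x => complex.Re (f s x))
  (fun s x => complex.Re (f' s x)) 0 twopi u v t c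
  (fun s h => (cf s (itv s h)).1) (fun s x h => (df s x (itv s h)).1)
  (fun s x h => (bf s x (itv s h)).1) tuv'.
have [i2 d2] := @is_derive_under_integral _ (fun s x => complex.Im (f s x))
  (fun s x => complex.Im (f' s x)) 0 twopi u v t c
  (fun s h => (cf s (itv s h)).2) (fun s x h => (df s x (itv s h)).2)
  (fun s x h => (bf s x (itv s h)).2) tuv'.
by split.
Qed.

Lemma cint_bounded_derive w w' c :
  (forall x, cderive w x (w' x)) -> (forall x, cbound c (w' x)) ->
  cint w' = w twopi - w 0.
Proof.
move=> dw bw; have p0 := twopi_gt0.
have [_ e1] := Rintegral_bounded_derive p0 (fun x => (dw x).1) (fun x => (bw x).1).
have [_ e2] := Rintegral_bounded_derive p0 (fun x => (dw x).2) (fun x => (bw x).2).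
by apply/eqP; rewrite eq_complex ReB ImB /= e1 e2 !eqxx.
Qed.

Lemma chomogeneous_solution (f f' : R -> R[i]) r t : 0 < t < r ->
  (forall s, `|s| < r -> cderive f s (f' s)) ->
  (forall s, `|s| < r -> s%:C * f' s = f s) -> f t = t%:C * f' 0.
Proof.
move=> tr df ff'; have sRe s : `|s| < r -> s * complex.Re (f' s) = complex.Re (f s).
  by move=> sr; rewrite -ff'// ReM /= mul0r subr0.
have sIm s : `|s| < r -> s * complex.Im (f' s) = complex.Im (f s).
  by move=> sr; rewrite -ff'// ImM /= mul0r addr0.
have e1 := homogeneous_solution tr (fun s h => (df s h).1) sRe.
have e2 := homogeneous_solution tr (fun s h => (df s h).2) sIm.
by apply/eqP; rewrite eq_complex ReM ImM /= !mul0r subr0 addr0 e1 e2 !eqxx.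
Qed.

(* With [K t x = (g (t e^{ix}) - g 0) e^{-ix}] one has
   [dK/dx = i (t dK/dt - K)], whose integral over a period vanishes; hence the
   integral [Phi] of [K t] satisfies [t Phi' = Phi] and is linear in [t]. *)
Lemma cauchy_derivative (g g' : R[i] -> R[i]) r c t : 0 < t < r ->
  (forall x s, `|s| < r ->
     cderive (fun y => g (y%:C * cis x)) s (cis x * g' (s%:C * cis x))) ->
  (forall x s, `|s| < r ->
     cderive (fun y => g (s%:C * cis y)) x ('i * (s%:C * cis x) * g' (s%:C * cis x))) ->
  (forall x s, `|s| < r -> cbound c (g (s%:C * cis x)) /\ cbound c (g' (s%:C * cis x))) ->
  cint (fun x => (g (t%:C * cis x) - g 0) * cis (- x)) = t%:C * (twopi%:C * g' 0).
Proof.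
move=> tr H1 H2 bg.
have r0 : 0 < r by case/andP: tr => /lt_trans; apply.
have g00 x : (0 : R)%:C * cis x = 0 by rewrite mul0r.
have [bg0 bg'0] : cbound c (g 0) /\ cbound c (g' 0).
  by have := bg 0 0; rewrite normr0 g00; apply.
have c0 := cbound0 bg0.
pose K s x := (g (s%:C * cis x) - g 0) * cis (- x).
pose D s x := g' (s%:C * cis x).
have dK1 s x : `|s| < r -> cderive (K ^~ x) s (D s x).
  move=> sr; have := cderiveMr (cis (- x)) (cderiveB (H1 x s sr) (cderive_cst (g 0) s)).
  by rewrite subr0 mulrAC cisN mul1r.
have dK2 s x : `|s| < r -> cderive (K s) x ('i * (s%:C * D s x - K s x)).
  move=> sr; have := cderiveM (cderiveB (H2 x s sr) (cderive_cst (g 0) x)) (cderive_cisN x).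
  rewrite subr0; congr cderive.
  rewrite /K -/(D s x) mulrBr addrC; congr (_ + _); last by ring.
  rewrite [RHS](_ : _ = 'i * (s%:C * D s x) * 1); last by rewrite mulr1.
  by rewrite -(cisN x); ring.
have cK s : `|s| < r -> ccontinuous (K s).
  by move=> sr; apply: (@cderive_continuous _ (fun x => 'i * (s%:C * D s x - K s x))) => x; exact: dK2.
have itv s : - r < s < r -> `|s| < r by rewrite ltr_norml.
have under s : `|s| < r ->
    cintegrable (D s) /\ cderive (fun y => cint (K y)) s (cint (D s)).
  move=> sr; apply: (@cderive_under_integral K D (- r) r s c).
  - by move=> y /itv; exact: cK.
  - by move=> y x /itv; exact: dK1.
  - by move=> y x /itv; rewrite /D => /(bg x y)[].
  - by rewrite -ltr_norml.
have KD s : `|s| < r -> s%:C * cint (D s) = cint (K s).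
  move=> sr; have [iD _] := under s sr.
  (* The angular derivative of [K s] contains [D s], which may be discontinuous in [x]; a bound is
     what [cint_bounded_derive] asks for. The constant is the one assembled by [cboundM] and
     [cboundB]. *)
  have bd x : cbound (2 * 1 * (2 * r * c + 2 * (c + c) * 1)) ('i * (s%:C * D s x - K s x)).
    apply: cboundM; first by split; rewrite /= ?normr0 ?normr1.
    apply: cboundB; first apply: cboundM.
    - by split; rewrite /= ?normr0 // ltW.
    - by have [] := bg x s sr.
    - apply: cboundM; last exact: cbound_cis.
      by apply: cboundB => //; have [] := bg x s sr.
  have := cint_bounded_derive (dK2 s ^~ sr) bd.
  have [isD esD] := cintM s%:C iD; have iK := ccontinuous_integrable (cK s sr).
  have isDK : cintegrable (fun x => s%:C * D s x - K s x).
    have mI : measurable (`[0, twopi] : set (measurableTypeR R)) by exact: measurable_itv.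
    split.
      rewrite (_ : (fun _ => _) = (fun x => complex.Re (s%:C * D s x) - complex.Re (K s x))).
        exact: (integrableB mI isD.1 iK.1).
      by apply/funext => x; rewrite ReB.
    rewrite (_ : (fun _ => _) = (fun x => complex.Im (s%:C * D s x) - complex.Im (K s x))).
      exact: (integrableB mI isD.2 iK.2).
    by apply/funext => x; rewrite ImB.
  have [_ ->] := cintM 'i isDK; rewrite cintB// esD.
  rewrite /K cis2pi cisN2pi oppr0 subrr => /eqP.
  have i0 : 'i != 0 :> R[i] by rewrite eq_complex /= oner_eq0 andbF.
  by rewrite mulf_eq0 (negPf i0) /= subr_eq0 => /eqP.
rewrite (chomogeneous_solution tr (fun s h => (under s h).2) KD).
by congr (_ * _); rewrite /D (_ : (fun _ => _) = fun=> g' 0) ?cint_cst//; apply/funext => x; rewrite g00.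
Qed.

End cauchy.

(** * Symmetry of mixed complex derivatives *)

Section mixed_derivatives.
Context {R : realType}.
Notation mu := (@lebesgue_measure R).
Notation twopi := (pi *+ 2 : R).
Implicit Types (t s r c : R) (phi : R -> R[i]) (z w : R[i]).

Lemma cderive_near (F G : R -> R[i]) (u v s : R) (l : R[i]) :
  u < s < v -> (forall y, u < y < v -> F y = G y) -> cderive F s l -> cderive G s l.
Proof.
move=> suv FG [[d1 e1] [d2 e2]].
have nearFG (k : R[i] -> R) : {near s, (fun y => k (F y)) =1 (fun y => k (G y))}.
  by near=> y; rewrite FG//; near: y; have := @near_in_itvoo _ u v s; rewrite in_itv/=; exact.
split; apply: DeriveDef.
- exact: (near_eq_derivable (nearFG (@complex.Re R)) d1).
- by rewrite -(near_eq_derive _ (nearFG (@complex.Re R))).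
- exact: (near_eq_derivable (nearFG (@complex.Im R)) d2).
- by rewrite -(near_eq_derive _ (nearFG (@complex.Im R))).
Unshelve. all: by end_near.
Qed.

(** The uniform bound on the velocity dominates the integrand when a circle integral is
    differentiated along [phi]. *)
Definition curve phi (phi' : R -> R[i]) :=
  (forall s, cderive phi s (phi' s)) /\ exists c, forall s, cbound c (phi' s).

(* Complex differentiability with derivative [g'] on the disc of radius [r],
   in the form stable under differentiation of parametric integrals: the chain
   rule along curves. *)
Definition hol r (g g' : R[i] -> R[i]) :=
  forall phi phi', curve phi phi' -> forall s, sqmod (phi s) < r ^+ 2 ->
    cderive (g \o phi) s (phi' s * g' (phi s)).

Definition cbounded r c (g : R[i] -> R[i]) :=
  forall z, sqmod z < r ^+ 2 -> cbound c (g z).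

Lemma sqmod_real t z : sqmod (t%:C * z) = t ^+ 2 * sqmod z.
Proof. by case: z => x y; rewrite /sqmod /=; ring. Qed.

Lemma sqmod_cis s : sqmod (cis s) = 1 :> R.
Proof. exact: cos2Dsin2. Qed.

Lemma sqmod_circle t r s : `|t| < r -> sqmod (t%:C * cis s) < r ^+ 2.
Proof.
move=> tr; rewrite sqmod_real sqmod_cis mulr1 -real_normK ?num_real//.
by rewrite ltr_pXn2r// nnegrE// ltW// (le_lt_trans (normr_ge0 _) tr).
Qed.

Lemma curve_line z w : curve (fun y => z + y%:C * w) (fun=> w).
Proof.
split=> [s|]; last first.
  exists (`|complex.Re w| + `|complex.Im w|) => s.
  by split; rewrite (lerDl, lerDr).
have := cderiveB (cderive_cst z s) (cderiveMr (- w) (cderive_real s)).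
rewrite mul1r sub0r opprK; congr cderive.
by apply/funext => y; rewrite mulrN opprK.
Qed.

Lemma curve_circle z t : curve (fun y => z + t%:C * cis y) (fun y => 'i * (t%:C * cis y)).
Proof.
split=> [s|].
  have := cderiveB (cderive_cst z s) (cderiveMl (- t%:C) (cderive_cis s)).
  rewrite sub0r mulNr opprK; have -> : t%:C * ('i * cis s) = 'i * (t%:C * cis s) by ring.
  by congr cderive; apply/funext => y; rewrite mulNr opprK.
exists (2 * 1 * (2 * `|t| * 1)) => s; apply: cboundM.
  by split; rewrite /= ?normr0 ?normr1.
by apply: cboundM; [split; rewrite /= ?normr0|exact: cbound_cis].
Qed.

Lemma curve_shift z phi (phi' : R -> R[i]) : curve phi phi' -> curve (fun y => z + phi y) phi'.
Proof.
move=> [dp bp]; split=> // s.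
have := cderiveB (cderive_cst z s) (cderiveMl (-1) (dp s)).
rewrite sub0r mulN1r opprK; congr cderive.
by apply/funext => y; rewrite mulN1r opprK.
Qed.

Lemma hol_cauchy (g g' : R[i] -> R[i]) r c t : 0 < t < r -> hol r g g' ->
  cbounded r c g -> cbounded r c g' ->
  cint (fun x => (g (t%:C * cis x) - g 0) * cis (- x)) = t%:C * (twopi%:C * g' 0).
Proof.
move=> tr hg bg bg'; apply: (@cauchy_derivative _ g g' r c t tr).
- move=> x s sr; have cl := curve_line 0 (cis x).
  have := hg _ _ cl s; rewrite add0r => /(_ (sqmod_circle x sr)).
  by congr cderive; apply/funext => y /=; rewrite add0r.
- move=> x s sr; have cl := curve_circle 0 s.
  have := hg _ _ cl x; rewrite add0r => /(_ (sqmod_circle x sr)).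
  by congr cderive; apply/funext => y /=; rewrite add0r.
- by move=> x s sr; split; [apply: bg|apply: bg']; exact: sqmod_circle.
Qed.

Lemma hol_shift (g g' : R[i] -> R[i]) r z : sqmod z < (r / 2) ^+ 2 -> hol r g g' ->
  hol (r / 2) (fun w => g (z + w)) (fun w => g' (z + w)).
Proof.
move=> zr hg phi phi' cphi s sr; apply: (hg _ _ (curve_shift z cphi)).
(* Weight 1 in [sqmodD] gives [|z + w|^2 <= 2 |z|^2 + 2 |w|^2 < r^2]; hence the halved radii. *)
apply: le_lt_trans (sqmodD z (phi s) ltr01) _.
by rewrite invr1; move: zr sr; rewrite expr_div_n; lra.
Qed.

Lemma cbounded_shift (g : R[i] -> R[i]) r c z : sqmod z < (r / 2) ^+ 2 ->
  cbounded r c g -> cbounded (r / 2) c (fun w => g (z + w)).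
Proof.
move=> zr bg w wr; apply: bg; apply: le_lt_trans (sqmodD z w ltr01) _.
by rewrite invr1; move: zr wr; rewrite expr_div_n; lra.
Qed.

Lemma twopi_scaleK r z : 0 < r ->
  (r * twopi)%:C^-1 * (r%:C * (twopi%:C * z)) = z.
Proof.
move=> r0; rewrite [r%:C * _]mulrA -rmorphM mulrA mulVf ?mul1r//.
by rewrite eq_complex /= eqxx andbT mulf_neq0// gt_eqF// twopi_gt0.
Qed.

Lemma cbound_cint (w : R -> R[i]) c : cintegrable w -> (forall x, cbound c (w x)) ->
  cbound (c * twopi) (cint w).
Proof.
move=> [w1 w2] bw.
have mI : measurable (`[0, twopi] : set (measurableTypeR R)) by exact: measurable_itv.
have ic : mu.-integrable `[0, twopi] (EFin \o (fun=> c)).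
  by apply: continuous_integrable_itv => x; exact: cvg_cst.
have -> : c * twopi = \int[mu]_(x in `[0, twopi]) c.
  rewrite Rintegral_cst//.
  have -> : fine (mu `[0, twopi]) = twopi; last by [].
  by rewrite lebesgue_measure_itv/= lte_fin twopi_gt0 /= subr0.
split; (apply: le_trans (le_normr_Rintegral _ _) _ => //);
  apply: le_Rintegral => //; try exact: integrable_norm.
  by move=> x _; have [] := bw x.
by move=> x _; have [] := bw x.
Qed.

Lemma curve_stays phi (phi' : R -> R[i]) r s : curve phi phi' -> sqmod (phi s) < r ^+ 2 ->
  exists u v, u < s < v /\ forall y, u < y < v -> sqmod (phi y) < r ^+ 2.
Proof.
move=> [dphi _] sr.
have [cR cI] := cderive_continuous dphi.
have cm : {for s, continuous (fun y => sqmod (phi y))}.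
  rewrite (_ : (fun _ => _) = (fun y => complex.Re (phi y) * complex.Re (phi y) +
    complex.Im (phi y) * complex.Im (phi y))); last by apply/funext => y; rewrite -!expr2.
  by apply: cvgD; apply: cvgM; [exact: cR|exact: cR|exact: cI|exact: cI].
have /cvgr_lt /(_ _ sr) := cm => /nbhs_ballP[e /= e0 He].
exists (s - e), (s + e); split; first by lra.
by move=> y yse; apply: He; rewrite /ball /= distrC ltr_distl; lra.
Qed.

(** The Cauchy formula writes [g1 z w] as an integral of [g] over a circle around [z]. There [w]
    enters only through [g], whose derivative in [w] is [g2], so differentiating under the integral
    sign shows that [g1 z] is differentiable too, although nothing was assumed on [g1] in that
    variable. The bound on [h] allows the Cauchy formula to be applied again, to [g1 z]. *)
Lemma mixed_hol (g g1 g2 : R[i] -> R[i] -> R[i]) r c rho z :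
  0 < rho < r / 2 -> sqmod z < (r / 2) ^+ 2 ->
  (forall w, sqmod w < r ^+ 2 -> hol r (g ^~ w) (g1 ^~ w)) ->
  (forall z, sqmod z < r ^+ 2 -> hol r (g z) (g2 z)) ->
  (forall w, sqmod w < r ^+ 2 -> cbounded r c (g ^~ w)) ->
  (forall w, sqmod w < r ^+ 2 -> cbounded r c (g1 ^~ w)) ->
  (forall w, sqmod w < r ^+ 2 -> cbounded r c (g2 ^~ w)) ->
  let h w := (rho * twopi)%:C^-1 *
    cint (fun x => (g2 (z + rho%:C * cis x) w - g2 z w) * cis (- x)) in
  hol (r / 2) (g1 z) h /\ exists c', cbounded (r / 2) c' h.
Proof.
move=> rhor zr h1 h2 bg bg1 bg2 h.
have r0 : 0 < r by lra.
have half w : sqmod w < (r / 2) ^+ 2 -> sqmod w < r ^+ 2.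
  by rewrite expr_div_n; have := sqr_ge0 r; lra.
have zx x : sqmod (z + rho%:C * cis x) < r ^+ 2.
  apply: le_lt_trans (sqmodD _ _ ltr01) _.
  have : sqmod (rho%:C * cis x) < (r / 2) ^+ 2.
    by apply: sqmod_circle; rewrite gtr0_norm; lra.
  by move: zr; rewrite invr1 expr_div_n; lra.
have zr' := half _ zr.
pose F w x := (g (z + rho%:C * cis x) w - g z w) * cis (- x).
pose F' w x := (g2 (z + rho%:C * cis x) w - g2 z w) * cis (- x).
have g1E w : sqmod w < r ^+ 2 -> (rho * twopi)%:C^-1 * cint (F w) = g1 z w.
  move=> wr; have := hol_cauchy rhor (hol_shift zr (h1 w wr))
    (cbounded_shift zr (bg w wr)) (cbounded_shift zr (bg1 w wr)).
  by rewrite addr0 => ->; rewrite twopi_scaleK//; case/andP: rhor.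
have cF w : sqmod w < r ^+ 2 -> ccontinuous (F w).
  move=> wr; pose dF x := (g (z + rho%:C * cis x) w - g z w) * (- 'i * cis (- x)) +
    ('i * (rho%:C * cis x) * g1 (z + rho%:C * cis x) w - 0) * cis (- x).
  apply: (@cderive_continuous _ _ dF) => x.
  apply: (cderiveM (F := fun x => g (z + rho%:C * cis x) w - g z w)); last exact: cderive_cisN.
  apply: cderiveB; last exact: cderive_cst.
  exact: (h1 w wr _ _ (curve_circle z rho) x (zx x)).
have bF' w x : sqmod w < r ^+ 2 -> cbound (2 * (c + c) * 1) (F' w x).
  by move=> wr; apply: cboundM (cbound_cis _); apply: cboundB; apply: (bg2 w wr).
have main phi phi' (cphi : curve phi phi') (s : R) : sqmod (phi s) < (r / 2) ^+ 2 ->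
    cintegrable (fun x => phi' s * F' (phi s) x) /\
    cderive (fun y => cint (F (phi y))) s (cint (fun x => phi' s * F' (phi s) x)).
  move=> sr; have [u [v [suv Huv]]] := curve_stays cphi sr.
  have [_ [K bK]] := cphi.
  apply: (@cderive_under_integral _ (fun y => F (phi y))
    (fun y x => phi' y * F' (phi y) x) u v s (2 * K * (2 * (c + c) * 1))) => //.
  - by move=> y /Huv/half; exact: cF.
  - move=> y x /Huv/half yr; rewrite /F' mulrA; apply: cderiveMr; rewrite mulrBr.
    apply: cderiveB; last exact: (h2 z zr' _ _ cphi y yr).
    exact: (h2 _ (zx x) _ _ cphi y yr).
  - by move=> y x /Huv/half yr; apply: cboundM (bK y) _; exact: bF'.
(* Read off from [main] along the line through [w] with velocity 1, at time 0. *)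
have iF' w : sqmod w < (r / 2) ^+ 2 -> cintegrable (F' w).
  move=> wr; have := main _ _ (curve_line w 1) 0; rewrite mul0r addr0.
  move=> /(_ wr)[+ _]; rewrite (_ : (fun x => 1 * _) = F' w)//.
  by apply/funext => x; rewrite mul1r.
split; last first.
  set k := (rho * twopi)%:C^-1.
  exists (2 * (`|complex.Re k| + `|complex.Im k|) * (2 * (c + c) * 1 * twopi)) => w wr.
  apply: cboundM; first by split; rewrite (lerDl, lerDr).
  by apply: cbound_cint; [exact: iF'|move=> x; exact/bF'/half].
move=> phi phi' cphi s sr.
have [u [v [suv Huv]]] := curve_stays cphi sr.
have g1F y : u < y < v -> (rho * twopi)%:C^-1 * cint (F (phi y)) = g1 z (phi y).
  by move=> /Huv/half yr; exact: g1E.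
apply: (cderive_near suv g1F).
have [_ d] := main _ _ cphi s sr.
have [_ e] := cintM (phi' s) (iF' _ sr).
by rewrite /h mulrCA -/(F' (phi s)) -e; exact: cderiveMl.
Qed.

(** Applying [mixed_hol] to [g] and to [g] with its variables exchanged produces both mixed
    derivatives, [X] and [Y]. By construction [X 0] is a circle integral of [g2 ^~ 0]; since [Y] is
    the derivative of that function, the Cauchy formula identifies the integral with [Y 0]. *)
Lemma mixed_derivatives_symmetric (g g1 g2 : R[i] -> R[i] -> R[i]) r c : 0 < r ->
  (forall w, sqmod w < r ^+ 2 -> hol r (g ^~ w) (g1 ^~ w)) ->
  (forall z, sqmod z < r ^+ 2 -> hol r (g z) (g2 z)) ->
  (forall z w, sqmod z < r ^+ 2 -> sqmod w < r ^+ 2 ->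
     [/\ cbound c (g z w), cbound c (g1 z w) & cbound c (g2 z w)]) ->
  exists l, cderive (fun s : R => g1 0 s%:C) 0 l /\ cderive (fun s : R => g2 s%:C 0) 0 l.
Proof.
move=> r0 h1 h2 b.
have rhor : 0 < r / 4 < r / 2 by lra.
have z0 q : 0 < q -> sqmod (0 : R[i]) < q ^+ 2.
  by move=> q0; rewrite /sqmod /= expr0n addr0 exprn_gt0.
have z0r2 : sqmod (0 : R[i]) < (r / 2) ^+ 2 by apply: z0; lra.
have bl k w : sqmod w < r ^+ 2 -> (k = g \/ k = g1 \/ k = g2) -> cbounded r c (k ^~ w).
  by move=> wr [->|[->|->]] z zr; have [] := b z w zr wr.
have br k w : sqmod w < r ^+ 2 -> (k = g \/ k = g1 \/ k = g2) -> cbounded r c (k w).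
  by move=> wr [->|[->|->]] z zr; have [] := b w z wr zr.
have [hX _] := @mixed_hol g g1 g2 r c (r / 4) 0 rhor z0r2 h1 h2 (fun w wr => bl g w wr (or_introl erefl))
  (fun w wr => bl g1 w wr (or_intror (or_introl erefl)))
  (fun w wr => bl g2 w wr (or_intror (or_intror erefl))).
have [hY [c' bY]] := @mixed_hol (fun w z => g z w) (fun w z => g2 z w)
  (fun w z => g1 z w) r c (r / 4) 0 rhor z0r2 h2 h1 (fun w wr => br g w wr (or_introl erefl))
  (fun w wr => br g2 w wr (or_intror (or_intror erefl)))
  (fun w wr => br g1 w wr (or_intror (or_introl erefl))).
set X : R[i] -> R[i] := (X in hol _ _ X) in hX.
set Y : R[i] -> R[i] := (X in hol _ _ X) in hY bY.
have line s : (fun y : R => 0 + y%:C * 1) s = s%:C :> R[i] by rewrite add0r mulr1.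
have XY : X 0 = Y 0.
  have cm (k : R[i] -> R[i]) (a d : R) : a <= d -> cbounded (r / 2) a k -> cbounded (r / 2) d k.
    by move=> ad ka z /ka[k1 k2]; split; apply: le_trans ad.
  have bg2 : cbounded (r / 2) c (g2 ^~ 0).
    move=> z zr; have [] := b z 0 _ (z0 r r0) => //.
    by move: zr; rewrite expr_div_n; have := sqr_ge0 r; lra.
  have := hol_cauchy rhor hY (cm _ _ (Num.max c c') _ bg2) (cm _ _ (Num.max c c') _ bY).
  rewrite !le_max !lexx orbT => /(_ isT isT) e.
  rewrite /X (_ : (fun x => _) = (fun x => (g2 ((r / 4)%:C * cis x) 0 - g2 0 0) * cis (- x))).
    by rewrite e twopi_scaleK//; lra.
  by apply/funext => x; rewrite add0r.
exists (X 0); split.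
  have := hX _ _ (curve_line 0 1) 0; rewrite mul0r addr0 mul1r => /(_ z0r2).
  by congr cderive; apply/funext => y /=; rewrite add0r mulr1.
rewrite XY; have := hY _ _ (curve_line 0 1) 0; rewrite mul0r addr0 mul1r => /(_ z0r2).
by congr cderive; apply/funext => y /=; rewrite add0r mulr1.
Qed.

End mixed_derivatives.

(** * The real inner product of [ell2] and the flat form *)

Section ell2_inner_product.
Context {R : realType}.
Implicit Types (a b z w u v : ell2 R) (c : R[i]) (t s : R).

Definition rdot (x y : R[i]) : R :=
  complex.Re x * complex.Re y + complex.Im x * complex.Im y.

(** The real part of the Hermitian product. Its imaginary part is recovered by replacing [a] with
    ['i%C *: a]. *)
Definition rip a z : R := limn (series (fun k => rdot (a k) (z k))).

Lemma ell2_scaleE c z k : (c *: z) k = c * z k. Proof. by []. Qed.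

Lemma rdotC x y : rdot x y = rdot y x.
Proof. by rewrite /rdot; ring. Qed.

(** Polarisation: each term is half of [|a + z|^2 - |a|^2 - |z|^2], and the three series
    converge. *)
Lemma rip_cvg a z : cvgn (series (fun k => rdot (a k) (z k))).
Proof.
pose A := series (sqmod \o a); pose B := series (sqmod \o z).
pose C := series (sqmod \o (a + z)).
have -> : series (fun k => rdot (a k) (z k)) = (fun=> 2^-1) * (C - A - B).
  apply/funext => n; rewrite /series /= -[RHS]/(2^-1 * (C n - A n - B n)).
  rewrite /C /A /B /series /= -!sumrB mulr_sumr; apply: eq_bigr => k _.
  rewrite -[X in _ = _ * (X - _ - _)]/(sqmod (a k + z k)).
  rewrite -[X in _ = _ * (_ - X - _)]/(sqmod (a k)) -[X in _ = _ * (_ - _ - X)]/(sqmod (z k)).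
  case: (a k) (z k) => [x1 x2] [y1 y2].
  by rewrite /rdot /sqmod /=; field.
by apply: (cvg_scale _ _).1; apply: is_cvgB; [apply: is_cvgB|]; exact: ell2_cvg.
Qed.

Lemma ripC a z : rip a z = rip z a.
Proof. by rewrite /rip; under eq_fun do rewrite rdotC. Qed.

Lemma ripDr a z w : rip a (z + w) = rip a z + rip a w.
Proof.
rewrite /rip -limD; [|exact: rip_cvg|exact: rip_cvg]; congr (limn _).
apply/funext => n; rewrite -[LHS]/(\sum_(0 <= k < n) rdot (a k) (z k + w k)).
rewrite -[RHS]/(\sum_(0 <= k < n) rdot (a k) (z k) + \sum_(0 <= k < n) rdot (a k) (w k)).
by rewrite -big_split; apply: eq_bigr => k _; rewrite /rdot ReD ImD /=; ring.
Qed.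

Lemma ripZr a z (t : R) : rip a (t%:C *: z) = t * rip a z.
Proof.
rewrite /rip -(cvg_scale t (@rip_cvg a z)).2; congr (limn _).
apply/funext => n; rewrite -[LHS]/(\sum_(0 <= k < n) rdot (a k) (t%:C * z k)).
rewrite -[RHS]/(t * \sum_(0 <= k < n) rdot (a k) (z k)) mulr_sumr.
by apply: eq_bigr => k _; rewrite /rdot ReM ImM /=; ring.
Qed.

Lemma ripNr a z : rip a (- z) = - rip a z.
Proof.
by rewrite -mulN1r -ripZr rmorphN rmorph1 scaleN1r.
Qed.

Lemma ripBr a z w : rip a (z - w) = rip a z - rip a w.
Proof. by rewrite ripDr ripNr. Qed.

Lemma ripDl a z w : rip (z + w) a = rip z a + rip w a.
Proof. by rewrite ripC ripDr !(ripC a). Qed.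

Lemma ripBl a z w : rip (z - w) a = rip z a - rip w a.
Proof. by rewrite ripC ripBr !(ripC a). Qed.

Lemma ripZl a z (t : R) : rip (t%:C *: z) a = t * rip z a.
Proof. by rewrite ripC ripZr (ripC a). Qed.

Lemma ripii a z : rip ('i%C *: a) ('i%C *: z) = rip a z.
Proof.
rewrite /rip; congr (limn (series _)); apply/funext => k.
by rewrite !ell2_scaleE /rdot !ReM !ImM /=; ring.
Qed.

Lemma mulii : 'i * 'i = -1 :> R[i].
Proof. by rewrite -expr2 sqr_i. Qed.

Lemma ripi a z : rip ('i%C *: a) z = - rip a ('i%C *: z).
Proof. by rewrite -[LHS]ripii scalerA mulii scaleN1r ripC ripNr ripC. Qed.

Lemma rip_complex a c z :
  rip a (c *: z) = complex.Re c * rip a z + complex.Im c * rip a ('i%C *: z).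
Proof.
case: c => x y /=.
have -> : (x +i* y) *: z = x%:C *: z + y%:C *: ('i *: z).
  rewrite scalerA -scalerDl; congr (_ *: _).
  by apply/eqP; rewrite eq_complex /=; apply/andP; split; apply/eqP; ring.
by rewrite ripDr !ripZr.
Qed.

Lemma rip_norm z : rip z z = ell2_norm z ^+ 2.
Proof.
by rewrite /ell2_norm sqr_sqrtr ?ell2_lim_ge0.
Qed.

Lemma ell2_norm_ge0 z : 0 <= ell2_norm z.
Proof. exact: sqrtr_ge0. Qed.

Lemma normE z : `|z| = (ell2_norm z)%:C.
Proof. by []. Qed.

Lemma ell2_norm_eq0 z : (ell2_norm z == 0) = (z == 0).
Proof.
apply/eqP/eqP => [z0|->]; first by apply: ell2_norm0_eq0; rewrite z0.
by have := normr0 (ell2 R); rewrite normE => /complexI.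
Qed.

Lemma cauchy_schwarz a z : `|rip a z| <= ell2_norm a * ell2_norm z.
Proof.
have [->|z0] := eqVneq z 0.
  by rewrite -(scale0r 0) ripZr mul0r normr0 mulr_ge0 ?ell2_norm_ge0.
have zp : 0 < ell2_norm z ^+ 2 by rewrite exprn_gt0// lt_def ell2_norm_eq0 z0 ell2_norm_ge0.
pose t := rip a z / ell2_norm z ^+ 2.
have : 0 <= rip (a - t%:C *: z) (a - t%:C *: z) by rewrite rip_norm sqr_ge0.
rewrite ripBl !ripBr !ripZl !ripZr (ripC z a) !rip_norm.
have -> : ell2_norm a ^+ 2 - t * rip a z - (t * rip a z - t * (t * ell2_norm z ^+ 2)) =
    ell2_norm a ^+ 2 - rip a z ^+ 2 / ell2_norm z ^+ 2.
  by rewrite /t; field; rewrite ell2_norm_eq0.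
rewrite subr_ge0 ler_pdivrMr// -exprMn -[X in X <= _]real_normK ?num_real//.
by rewrite ler_pXn2r// nnegrE// mulr_ge0 ?ell2_norm_ge0.
Qed.

Lemma ell2_norm_triangle z w : ell2_norm (z + w) <= ell2_norm z + ell2_norm w.
Proof. by rewrite -lecR rmorphD; exact: ell2_normD. Qed.

Lemma ell2_normi z : ell2_norm ('i%C *: z) = ell2_norm z.
Proof.
apply/eqP; rewrite -(@eqrXn2 _ 2) ?ell2_norm_ge0//.
by rewrite -!rip_norm ripii.
Qed.

Lemma rderive_norm2 z v :
  rderivable (fun y : ell2 R => ell2_norm y ^+ 2) z v /\
  rderive (fun y : ell2 R => ell2_norm y ^+ 2) z v = 2 * rip z v.
Proof.
suff H : is_derive (0 : R) (1 : R)
    (fun t : R => ell2_norm (z + t%:C *: v) ^+ 2) (2 * rip z v).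
  by split; [case: H|exact: derive1_val].
apply/is_derive_epsP => e e0; exists (e / (ell2_norm v ^+ 2 + 1)).
  by rewrite divr_gt0// ltr_wpDl ?sqr_ge0.
move=> h hd; rewrite add0r.
have -> : ell2_norm (z + h%:C *: v) ^+ 2 - ell2_norm (z + 0%:C *: v) ^+ 2 -
    h * (2 * rip z v) = h * h * ell2_norm v ^+ 2.
  rewrite scale0r addr0 -!rip_norm ripDl !ripDr !ripZl !ripZr (ripC v z).
  by ring.
rewrite normrM [`|h * h|]normrM (ger0_norm (sqr_ge0 _)) mulrAC ler_wpM2r//.
move: hd; rewrite ltr_pdivlMr; last by rewrite ltr_wpDl ?sqr_ge0.
by move=> /ltW; apply: le_trans; rewrite ler_wpM2l// lerDl.
Qed.

(** The 1-form [dc] of the squared norm depends linearly on the base point, so its derivatives are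
    constant. The two halves of the exterior derivative, [- 2 rip u (i v)] and [2 rip v (i u)],
    coincide because multiplication by i is skew; each contributes 2. *)
Lemma flat_formE z u v : flat_form z u v = 4 * rip ('i%C *: u) v.
Proof.
have dcE y w : dc (fun z : ell2 R => ell2_norm z ^+ 2) y w = - (2 * rip y ('i%C *: w)).
  by rewrite /dc (rderive_norm2 y _).2.
have rd y w w' : rderive (fun x => - (2 * rip x w)) y w' = - (2 * rip w' w).
  apply: derive1_val; apply/is_derive_epsP => e e0; exists 1 => // h _.
  rewrite add0r scale0r addr0 ripDl ripZl.
  have -> : - (2 * (rip y w + h * rip w' w)) - - (2 * rip y w) -
    h * - (2 * rip w' w) = 0 by ring.
  by rewrite normr0 mulr_ge0// ltW.
rewrite /flat_form /ddc /d1.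
have -> : (fun y => dc (fun z : ell2 R => ell2_norm z ^+ 2) y v) =
    (fun x => - (2 * rip x ('i%C *: v))) by apply/funext => y; exact: dcE.
have -> : (fun y => dc (fun z : ell2 R => ell2_norm z ^+ 2) y u) =
    (fun x => - (2 * rip x ('i%C *: u))) by apply/funext => y; exact: dcE.
rewrite !rd ripi (ripC v) ripi; ring.
Qed.

End ell2_inner_product.

(** * Real-valued norms and neighbourhoods *)

Section real_norm.
Context {R : realType} {E : normedModType R[i]}.
Implicit Types (x y h : E) (W : set E).

(** The norm of a module over [R[i]] is itself an element of [R[i]]; its real part carries all of it
    and allows real epsilon-delta estimates. *)
Definition rnorm x : R := complex.Re `|x|.

Lemma rnormE x : `|x| = (rnorm x)%:C.
Proof.
have := normr_ge0 x; rewrite /rnorm; case: `|x| => a b.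
by rewrite lecE /= => /andP[/eqP -> _].
Qed.

Lemma rnorm_ge0 x : 0 <= rnorm x.
Proof. by have := normr_ge0 x; rewrite rnormE lecR. Qed.

Lemma rnorm0 : rnorm 0 = 0.
Proof. by rewrite /rnorm normr0. Qed.

Lemma rnormD x y : rnorm (x + y) <= rnorm x + rnorm y.
Proof.
by rewrite -lecR rmorphD /= -!rnormE; exact: ler_normD.
Qed.

Lemma rnormN x : rnorm (- x) = rnorm x.
Proof. by rewrite /rnorm normrN. Qed.

Lemma rnormZ (c : R[i]) x : rnorm (c *: x) = Num.sqrt (sqmod c) * rnorm x.
Proof. by apply: complexI; rewrite -rnormE normrZ rmorphM /= -rnormE sqmodE. Qed.

Lemma rnormZr (t : R) x : rnorm (t%:C *: x) = `|t| * rnorm x.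
Proof. by rewrite rnormZ /sqmod /= expr0n addr0 sqrtr_sqr. Qed.

Lemma ball_rnorm x y (d : R) : ball x d%:C y <-> rnorm (x - y) < d.
Proof. by rewrite -ball_normE /= rnormE ltcR. Qed.

Lemma near_rnormP x (P : set E) :
  nbhs x P <-> exists2 d, 0 < d & forall h, rnorm h < d -> P (x + h).
Proof.
split=> [/nbhs_ballP[e /= e0 He]|[d d0 Hd]].
  have eE : e = (complex.Re e)%:C.
    by move: e0; case: (e) => a b; rewrite ltcE /= => /andP[/eqP ->].
  exists (complex.Re e); first by move: e0; rewrite {1}eE ltcR.
  move=> h hd; apply: He; rewrite eE; apply/ball_rnorm.
  by rewrite opprD addNKr rnormN.
apply/nbhs_ballP; exists d%:C; first by rewrite /= ltcR.
move=> y /ball_rnorm xy; rewrite -(subrKC x y); apply: Hd.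
by rewrite -rnormN opprB.
Qed.

Lemma open_rnorm W x : open W -> W x ->
  exists2 d, 0 < d & forall h, rnorm h < d -> W (x + h).
Proof. by move=> oW Wx; apply/near_rnormP; exact: open_nbhs_nbhs. Qed.

Lemma continuous_rnorm (f : E -> R) x : {for x, continuous f} ->
  forall e, 0 < e -> exists2 d, 0 < d & forall h, rnorm h < d -> `|f (x + h) - f x| < e.
Proof.
move=> cf e e0; have /cvgrPdist_lt /(_ _ e0) /near_rnormP[d d0 Hd] := cf.
by exists d => // h /Hd; rewrite distrC.
Qed.

Lemma rnorm_line (d : R) v : 0 < d ->
  exists2 d', 0 < d' & forall t : R, `|t| < d' -> rnorm (t%:C *: v) < d.
Proof.
move=> d0; have v0 : 0 < rnorm v + 1 by rewrite ltr_wpDl ?rnorm_ge0.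
exists (d / (rnorm v + 1)); first by rewrite divr_gt0.
move=> t; rewrite ltr_pdivlMr// rnormZr; apply: le_lt_trans.
by rewrite ler_wpM2l// lerDl.
Qed.

End real_norm.

(** * Weak differentiation of curves in [ell2] *)

Section holomorphic_into_ell2.
Context {R : realType} {E : normedModType R[i]}.
Context (f : E -> ell2 R).
Implicit Types (x y u v w : E) (a : ell2 R).

Lemma rnorm_ell2 (z : ell2 R) : rnorm z = ell2_norm z.
Proof. by []. Qed.

Lemma diff_eps x : differentiable f x -> forall e, 0 < e -> exists2 d, 0 < d &
  forall h, rnorm h < d -> ell2_norm (f (x + h) - f x - 'd f x h) <= e * rnorm h.
Proof.
move=> df e e0; have /eqaddoP/(_ e%:C) := diff_locally df.
rewrite ltcR => /(_ e0) /near_rnormP[d d0 Hd]; exists d => // h /Hd.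
rewrite add0r -[X in `|X| <= _]/(f (h + x) - (f x + 'd f x h)).
by rewrite opprD addrA (addrC h) [X in _ <= _ * X]rnormE -rmorphM normE lecR.
Qed.

End holomorphic_into_ell2.

Section chain_rule.
Context {R : realType} {E : normedModType R[i]} (f : E -> ell2 R).
Implicit Types (x y u v w : E) (a : ell2 R).

Lemma is_derive_lip (g : R -> R) (t l : R) : is_derive t 1 g l ->
  exists2 d, 0 < d & forall h, `|h| < d -> `|g (t + h) - g t| <= (`|l| + 1) * `|h|.
Proof.
move=> /is_derive_epsP /(_ 1 ltr01)[d d0 Hd]; exists d => // h /Hd H.
rewrite -(subrK (h * l) (g (t + h) - g t)); apply: le_trans (ler_normD _ _) _.
rewrite normrM [`|h| * _]mulrC mulrDl addrC; exact: lerD.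
Qed.

Lemma sqrt_sqmod_le (z : R[i]) : Num.sqrt (sqmod z) <= `|complex.Re z| + `|complex.Im z|.
Proof.
rewrite -(@ler_pXn2r _ 2) ?nnegrE ?sqrtr_ge0 ?addr_ge0// sqr_sqrtr ?sqmod_ge0//.
rewrite sqrrD !real_normK ?num_real// /sqmod mulr2n.
have : 0 <= `|complex.Re z| * `|complex.Im z| by rewrite mulr_ge0.
lra.
Qed.

Lemma cderive_lip (phi : R -> R[i]) (s : R) (l : R[i]) : cderive phi s l ->
  exists C d, [/\ 0 <= C, 0 < d & forall h, `|h| < d ->
    Num.sqrt (sqmod (phi (s + h) - phi s)) <= C * `|h|].
Proof.
move=> [/is_derive_lip[d1 d10 H1] /is_derive_lip[d2 d20 H2]].
exists (`|complex.Re l| + 1 + (`|complex.Im l| + 1)), (Num.min d1 d2); split.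
- by rewrite !addr_ge0.
- by rewrite lt_min d10 d20.
- move=> h; rewrite lt_min => /andP[h1 h2].
  apply: le_trans (sqrt_sqmod_le _) _; rewrite ReB ImB mulrDl.
  by apply: lerD; [exact: H1|exact: H2].
Qed.

(** Complex linearity of the differential lets the direction [v] be multiplied by a complex curve
    [phi], as required by [hol]; real lines are the case [phi t = t%:C]. *)
Lemma is_derive_holomorphic a x v (phi : R -> R[i]) (s : R) (l : R[i]) :
  differentiable f (x + phi s *: v) -> cderive phi s l ->
  is_derive s 1 (fun t => rip a (f (x + phi t *: v)))
    (rip a (l *: 'd f (x + phi s *: v) v)).
Proof.
set y := x + phi s *: v => df dphi; set w := 'd f y v.
apply/is_derive_epsP => e e0.
have [C [d1 [C0 d10 H1]]] := cderive_lip dphi.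
pose na := ell2_norm a; pose nv := rnorm v.
have na0 : 0 <= na by exact: ell2_norm_ge0.
have nv0 : 0 <= nv by exact: rnorm_ge0.
have wa : 0 < `|rip a w| + `|rip a ('i%C *: w)| + 1 by rewrite ltr_wpDl ?addr_ge0.
have wb : 0 < na * C * nv + 1 by rewrite ltr_wpDl// !mulr_ge0.
(* Half of [e] pays for the linearisation of [phi], the other half for the remainder of [f]; the
   added 1 keeps the denominators positive. *)
pose e1 := e / 2 / (`|rip a w| + `|rip a ('i%C *: w)| + 1).
pose e2 := e / 2 / (na * C * nv + 1).
have e10 : 0 < e1 by rewrite /e1 divr_gt0// divr_gt0.
have e20 : 0 < e2 by rewrite /e2 divr_gt0// divr_gt0.
have [d2 d20 H2] := (is_derive_epsP _ _ _).1 dphi.1 e1 e10.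
have [d3 d30 H3] := (is_derive_epsP _ _ _).1 dphi.2 e1 e10.
have [d4 d40 H4] := diff_eps df e20.
have cv : 0 < C * nv + 1 by rewrite ltr_wpDl// mulr_ge0.
exists (Num.min (Num.min d1 d2) (Num.min d3 (d4 / (C * nv + 1)))).
  by rewrite !lt_min d10 d20 d30 divr_gt0.
move=> h; rewrite !lt_min => /andP[/andP[hd1 hd2] /andP[hd3 hd4]].
pose dl := phi (s + h) - phi s.
have dln : rnorm (dl *: v) <= C * nv * `|h|.
  by rewrite rnormZ mulrAC ler_wpM2r//; exact: H1.
have yE : x + phi (s + h) *: v = y + dl *: v.
  by rewrite /y /dl scalerBl addrA addrAC addrK.
rewrite yE; set rem := f (y + dl *: v) - f y - 'd f y (dl *: v).
have remE : f (y + dl *: v) = f y + (dl *: w + rem).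
  rewrite /rem linearZ /= -/w.
  have H (A b c : ell2 R) : A = b + (c + (A - b - c)) by rewrite [c + _]addrC subrK addrC subrK.
  exact: H.
have remn : ell2_norm rem <= e2 * (C * nv * `|h|).
  apply: le_trans (H4 _ _) _; last by rewrite ler_wpM2l// ltW.
  apply: le_lt_trans dln _; move: hd4; rewrite ltr_pdivlMr// mulrC.
  by apply: le_lt_trans; rewrite ler_wpM2r// lerDl.
move: rem remE remn => rem remE remn.
rewrite remE -/y !ripDr (rip_complex a dl) (rip_complex a l) ReB ImB.
have -> : rip a (f y) + ((complex.Re (phi (s + h)) - complex.Re (phi s)) * rip a w +
    (complex.Im (phi (s + h)) - complex.Im (phi s)) * rip a ('i%C *: w) + rip a rem) -
    rip a (f y) - h * (complex.Re l * rip a w + complex.Im l * rip a ('i%C *: w)) =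
  (complex.Re (phi (s + h)) - complex.Re (phi s) - h * complex.Re l) * rip a w +
  (complex.Im (phi (s + h)) - complex.Im (phi s) - h * complex.Im l) * rip a ('i%C *: w) +
  rip a rem by ring.
apply: le_trans (ler_normD _ _) _.
have -> : e * `|h| = e / 2 * `|h| + e / 2 * `|h| by field.
apply: lerD.
  apply: le_trans (ler_normD _ _) _; rewrite !normrM.
  apply: (@le_trans _ _ (e1 * `|h| * (`|rip a w| + `|rip a ('i%C *: w)| + 1))); last first.
    by rewrite /e1 mulrAC mulfVK ?gt_eqF.
  rewrite 2!mulrDr; apply: ler_wpDr; first by rewrite mulr1 mulr_ge0// ltW.
  by apply: lerD; rewrite ler_wpM2r//; [exact: H2|exact: H3].
apply: le_trans (cauchy_schwarz _ _) _.
apply: (@le_trans _ _ (na * (e2 * (C * nv * `|h|)))); first by rewrite ler_wpM2l.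
have -> : na * (e2 * (C * nv * `|h|)) = e2 * (na * C * nv) * `|h| by ring.
rewrite ler_wpM2r// /e2 mulrAC ler_pdivrMr// ler_wpM2l//; first by rewrite divr_ge0// ltW.
by rewrite lerDl.
Qed.

(** A little-o condition at 0, stronger than Hölder continuity there: the increment is o(|t|^(1/2)),
    squared to avoid the root. *)
Definition half_holder (p : R -> ell2 R) := forall e, 0 < e -> exists2 d, 0 < d &
  forall t, `|t| < d -> ell2_norm (p t - p 0) ^+ 2 <= e * `|t|.

(** Each curve is tested only against the initial value of the other; apart from that, the expansion
    at 0 contains only the cross term of the two increments, which Cauchy-Schwarz makes o(t). *)
Lemma is_derive_rip (p q : R -> ell2 R) (b c : R) :
  half_holder p -> half_holder q ->
  is_derive (0 : R) (1 : R) (fun t : R => rip (p 0) (q t)) b ->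
  is_derive (0 : R) (1 : R) (fun t : R => rip (q 0) (p t)) c ->
  is_derive (0 : R) (1 : R) (fun t : R => rip (p t) (q t)) (b + c).
Proof.
move=> hp hq /is_derive_epsP db /is_derive_epsP dc; apply/is_derive_epsP => e e0.
have e40 : 0 < e / 4 by rewrite divr_gt0.
have [d1 d10 H1] := hp _ e40; have [d2 d20 H2] := hq _ e40.
have [d3 d30 H3] := db _ e40; have [d4 d40 H4] := dc _ e40.
exists (Num.min (Num.min d1 d2) (Num.min d3 d4)); first by rewrite !lt_min d10 d20 d30 d40.
move=> h; rewrite !lt_min => /andP[/andP[hd1 hd2] /andP[hd3 hd4]].
have := H3 _ hd3; have := H4 _ hd4; have := H1 _ hd1; have := H2 _ hd2.
rewrite add0r; set P := ell2_norm (p h - p 0); set Q := ell2_norm (q h - q 0).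
move=> Q1 P1 c1 b1; have cs := cauchy_schwarz (p h - p 0) (q h - q 0).
have PQ : P * Q <= e / 4 * `|h|.
  have : 0 <= (P - Q) ^+ 2 by exact: sqr_ge0.
  rewrite sqrrB; move: Q1 P1; rewrite mulr2n; lra.
have -> : rip (p h) (q h) - rip (p 0) (q 0) - h * (b + c) =
  (rip (p 0) (q h) - rip (p 0) (q 0) - h * b) + (rip (q 0) (p h) - rip (q 0) (p 0) - h * c) +
  rip (p h - p 0) (q h - q 0).
  by rewrite ripBl !ripBr (ripC (q 0)) (ripC (q 0)); ring.
apply: le_trans (ler_normD _ _) _.
apply: (@le_trans _ _ ((e / 4 * `|h| + e / 4 * `|h|) + e / 4 * `|h|)).
  apply: lerD; last exact: le_trans cs PQ.
  by apply: le_trans (ler_normD _ _) _; exact: lerD.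
have h0 := normr_ge0 h; have : 0 <= e * `|h| by rewrite mulr_ge0// ltW.
lra.
Qed.

(* The difference quotient of [|p t - p 0|^2] has a limit, which is
   nonnegative on the right of 0 and nonpositive on the left. *)
Lemma half_holder_derivable (p : R -> ell2 R) (b c : R) :
  is_derive (0 : R) (1 : R) (fun t : R => rip (p 0) (p t)) b ->
  is_derive (0 : R) (1 : R) (fun t : R => rip (p t) (p t)) c ->
  half_holder p.
Proof.
move=> /is_derive_epsP db /is_derive_epsP dc.
pose N t := ell2_norm (p t - p 0) ^+ 2.
have NE t : N t = rip (p t) (p t) - rip (p 0) (p 0) - 2 * (rip (p 0) (p t) - rip (p 0) (p 0)).
  by rewrite /N -rip_norm ripBl !ripBr (ripC (p t) (p 0)); ring.
have dN e : 0 < e -> exists2 d, 0 < d &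
    forall h, `|h| < d -> `|N h - h * (c - 2 * b)| <= e * `|h|.
  move=> e0; have e30 : 0 < e / 3 by rewrite divr_gt0.
  have [d1 d10 H1] := db _ e30; have [d2 d20 H2] := dc _ e30.
  exists (Num.min d1 d2); first by rewrite lt_min d10.
  move=> h; rewrite lt_min => /andP[/H1 + /H2]; rewrite add0r NE => b1 c1.
  have -> : rip (p h) (p h) - rip (p 0) (p 0) - 2 * (rip (p 0) (p h) - rip (p 0) (p 0)) -
    h * (c - 2 * b) = (rip (p h) (p h) - rip (p 0) (p 0) - h * c) -
    2 * (rip (p 0) (p h) - rip (p 0) (p 0) - h * b) by ring.
  apply: le_trans (ler_normB _ _) _; rewrite normrM (ger0_norm (ler0n _ 2)); lra.
have l0 : c - 2 * b = 0.
  apply/eqP; rewrite -normr_le0; apply/ler_addgt0Pl => e e0; rewrite addr0.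
  have [d d0 Hd] := dN e e0; pose k := d / 2.
  have k0 : 0 < k by rewrite /k; lra.
  have kd : `|k| < d by rewrite gtr0_norm// /k; lra.
  have Hk := Hd _ kd; have := Hd (- k); rewrite normrN => /(_ kd).
  move: Hk; rewrite (gtr0_norm k0).
  have N0 t : 0 <= N t by exact: sqr_ge0.
  have := N0 k; have := N0 (- k).
  set m := c - 2 * b => n1 n2; rewrite !ler_norml => /andP[a1 a2] /andP[a3 a4].
  rewrite -(ler_pM2l k0 (- e)) -(ler_pM2l k0 m).
  move: (N k) (N (- k)) n1 n2 a1 a2 a3 a4 => N1 N2 n1 n2 a1 a2 a3 a4.
  by clear -n1 n2 a1 a2 a3 a4; apply/andP; split; lra.
move=> e e0; have [d d0 Hd] := dN e e0; exists d => // t /Hd.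
by rewrite l0 mulr0 subr0; apply: le_trans; exact: ler_norm.
Qed.

(** Frechet differentiability bounds the increment by a multiple of |t|, so its square is O(t^2). *)
Lemma half_holder_line x u : differentiable f x ->
  half_holder (fun t : R => f (x + t%:C *: u)).
Proof.
move=> df; set p := fun t : R => _.
have dr a : is_derive (0 : R) (1 : R) (fun t : R => rip a (p t)) (rip a ('d f x u)).
  have := @is_derive_holomorphic a x u (fun t : R => t%:C) 0 1.
  by rewrite scale0r addr0 scale1r => /(_ df (cderive_real 0)).
pose K := ell2_norm ('d f x u).
have [d d0 Hd] := diff_eps df ltr01.
have [d' d'0 Hd'] := @rnorm_line R E d u d0.
pose C := 2 * (K + rnorm u) ^+ 2 + 1.
have C0 : 0 < C by rewrite /C ltr_wpDl// mulr_ge0// sqr_ge0.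
move=> e e0; exists (Num.min d' (e / C)); first by rewrite lt_min d'0 divr_gt0.
move=> t; rewrite lt_min => /andP[td' te].
have := Hd _ (Hd' _ td'); rewrite mul1r rnormZr linearZ /= => H.
have pn : ell2_norm (p t - p 0) <= (K + rnorm u) * `|t|.
  rewrite /p scale0r addr0 -(subrK (t%:C *: 'd f x u) (f _ - _)).
  apply: le_trans (ell2_norm_triangle _ _) _.
  rewrite addrC mulrDl; apply: lerD; last by rewrite [rnorm u * _]mulrC.
  have := rnormZr t ('d f x u); rewrite -/(rnorm _) !rnorm_ell2 => ->.
  by rewrite mulrC.
have n0 := ell2_norm_ge0 (p t - p 0).
apply: (@le_trans _ _ (((K + rnorm u) * `|t|) ^+ 2)).
  by rewrite ler_pXn2r// nnegrE// (le_trans n0 pn).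
rewrite exprMn [`|t| ^+ 2]expr2 mulrA ler_wpM2r//.
move: te; rewrite ltr_pdivlMr// => /ltW; apply: le_trans.
rewrite mulrC ler_wpM2l// /C; have := sqr_ge0 (K + rnorm u); lra.
Qed.

End chain_rule.

(** * Symmetric weak second derivatives of a holomorphic map into [ell2] *)

Section weak_hessian.
Context {R : realType} {E : normedModType R[i]} (f : E -> ell2 R) (W : set E).
Context (oW : open W) (dW : forall x, W x -> differentiable f x).
Implicit Types (x y u v : E) (a : ell2 R).

Definition locally_bounded (g : E -> ell2 R) x :=
  exists c d, 0 < d /\ forall h, rnorm h < d -> ell2_norm (g (x + h)) <= c.

Lemma differentiable_locally_bounded x : W x -> locally_bounded f x.
Proof.
move=> /dW/differentiable_continuous/cvgrPdist_lt /(_ 1 ltr01)/near_rnormP[d d0 Hd].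
exists (ell2_norm (f x) + 1), d; split => // h /Hd.
rewrite normE -[X in _ < X](rmorph1 (real_complex R)) ltcR => /ltW H.
rewrite -[f (x + h)](subKr (f x)); apply: le_trans (ell2_norm_triangle _ _) _.
by rewrite -[X in _ + X <= _]rnorm_ell2 rnormN lerD2l.
Qed.

Lemma cbound_rip a (z : ell2 R) c : ell2_norm z <= c ->
  cbound (ell2_norm a * c) (rip a z +i* rip ('i%C *: a) z).
Proof.
move=> zc; split=> /=; apply: le_trans (cauchy_schwarz _ _) _; rewrite ?ell2_normi.
  by rewrite ler_wpM2l// ell2_norm_ge0.
by rewrite ler_wpM2l// ell2_norm_ge0.
Qed.

(** The combination is the Hermitian product of [z] with [a]: composing with it turns [f] into
    scalar holomorphic functions. *)
Lemma rip_linearC a (c : R[i]) (z : ell2 R) :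
  rip a (c *: z) +i* rip ('i%C *: a) (c *: z) = c * (rip a z +i* rip ('i%C *: a) z).
Proof.
apply/eqP; rewrite eq_complex ReM ImM /= (rip_complex a c) (rip_complex ('i%C *: a) c) ripii ripi.
by apply/andP; split; apply/eqP; ring.
Qed.

Lemma cderive_rip a x v (phi : R -> R[i]) (s : R) (l : R[i]) :
  W (x + phi s *: v) -> cderive phi s l ->
  let y := x + phi s *: v in
  cderive (fun t => rip a (f (x + phi t *: v)) +i* rip ('i%C *: a) (f (x + phi t *: v))) s
    (l * (rip a ('d f y v) +i* rip ('i%C *: a) ('d f y v))).
Proof.
move=> Wy dphi y; rewrite -rip_linearC.
have H b := is_derive_holomorphic b (dW Wy) dphi.
by rewrite /cderive /=; split; [exact: (H a)|exact: (H ('i%C *: a))].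
Qed.

(** Restricting the scalar function attached to [a] to the complex plane through [x] spanned by [u]
    and [v] gives a function of two complex variables to which [mixed_derivatives_symmetric]
    applies; the local bounds on [df u] and [df v] bound its partial derivatives. *)
Lemma weak_hessian_symmetric a x u v : W x ->
  locally_bounded (fun y => 'd f y u) x -> locally_bounded (fun y => 'd f y v) x ->
  exists b, is_derive (0 : R) (1 : R) (fun t : R => rip a ('d f (x + t%:C *: u) v)) b /\
            is_derive (0 : R) (1 : R) (fun t : R => rip a ('d f (x + t%:C *: v) u)) b.
Proof.
move=> Wx [c1 [d1 [d10 H1]]] [c2 [d2 [d20 H2]]].
have [c0 [d0 [d00 H0]]] := differentiable_locally_bounded Wx.
have [d3 d30 H3] := open_rnorm oW Wx.
pose d := Num.min (Num.min d0 d1) (Num.min d2 d3).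
have dp : 0 < d by rewrite !lt_min d00 d10 d20 d30.
pose c := Num.max c0 (Num.max c1 c2).
have uv0 : 0 < rnorm u + rnorm v + 1 by rewrite ltr_wpDl// addr_ge0// rnorm_ge0.
(* Then [|z u + w v| <= r (|u| + |v|) < d] on the bidisc of radius [r]; the 1 gives the strict
   inequality even when [u] and [v] vanish. *)
pose r := d / (rnorm u + rnorm v + 1).
have r0 : 0 < r by rewrite divr_gt0.
have small (z w : R[i]) : sqmod z < r ^+ 2 -> sqmod w < r ^+ 2 ->
    rnorm (z *: u + w *: v) < d.
  have lt_r (q : R[i]) : sqmod q < r ^+ 2 -> Num.sqrt (sqmod q) <= r.
    move=> qr; rewrite -(@ler_pXn2r _ 2) ?nnegrE ?sqrtr_ge0 ?ltW//.
    by rewrite sqr_sqrtr ?sqmod_ge0// ltW.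
  move=> /lt_r zr /lt_r wr; apply: le_lt_trans (rnormD _ _) _; rewrite !rnormZ.
  apply: (@le_lt_trans _ _ (r * rnorm u + r * rnorm v)).
    by apply: lerD; rewrite ler_wpM2r// rnorm_ge0.
  by rewrite -mulrDr /r -mulrA gtr_pMr// mulrC ltr_pdivrMr// mul1r ltrDl.
pose pt z w := x + (z *: u + w *: v).
have Wpt z w : sqmod z < r ^+ 2 -> sqmod w < r ^+ 2 -> W (pt z w).
  by move=> zr wr; apply: H3; apply: lt_le_trans (small _ _ zr wr) _; rewrite !ge_min lexx !orbT.
pose La (z : ell2 R) := rip a z +i* rip ('i%C *: a) z.
pose g z w := La (f (pt z w)).
pose g1 z w := La ('d f (pt z w) u).
pose g2 z w := La ('d f (pt z w) v).
have hol1 w : sqmod w < r ^+ 2 -> hol r (g ^~ w) (g1 ^~ w).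
  move=> wr phi phi' [dphi _] s sr.
  have ptE z : pt z w = (x + w *: v) + z *: u by rewrite /pt addrCA addrC.
  have := @cderive_rip a (x + w *: v) u phi s (phi' s); rewrite -ptE.
  move=> /(_ (Wpt _ _ sr wr) (dphi s)); congr cderive.
  by apply/funext => t /=; rewrite -ptE.
have hol2 z : sqmod z < r ^+ 2 -> hol r (g z) (g2 z).
  move=> zr phi phi' [dphi _] s sr.
  have ptE w : pt z w = (x + z *: u) + w *: v by rewrite /pt addrA.
  have := @cderive_rip a (x + z *: u) v phi s (phi' s); rewrite -ptE.
  move=> /(_ (Wpt _ _ zr sr) (dphi s)); congr cderive.
  by apply/funext => t /=; rewrite -ptE.
have bd z w : sqmod z < r ^+ 2 -> sqmod w < r ^+ 2 ->
    [/\ cbound (ell2_norm a * c) (g z w), cbound (ell2_norm a * c) (g1 z w) &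
        cbound (ell2_norm a * c) (g2 z w)].
  move=> zr wr; have := small _ _ zr wr; rewrite !lt_min => /andP[/andP[e0 e1] /andP[e2 _]].
  split; apply: cbound_rip; rewrite /c !le_max.
  - by rewrite (H0 _ e0).
  - by rewrite (H1 _ e1) orbT.
  - by rewrite (H2 _ e2) !orbT.
have [l [[l1 _] [l2 _]]] := mixed_derivatives_symmetric r0 hol1 hol2 bd.
exists (complex.Re l); split.
  by move: l2; congr is_derive; apply/funext => t; rewrite /g2 /pt scale0r addr0.
by move: l1; congr is_derive; apply/funext => t; rewrite /g1 /pt scale0r add0r.
Qed.

End weak_hessian.

(** * The local potential [|f|^2] *)

Section lck_potential_local.
Context {R : realType} {E : normedModType R[i]} (f : E -> ell2 R) (W : set E).
Context (oW : open W) (dW : forall x, W x -> differentiable f x)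
  (f_neq0 : forall x, W x -> f x != 0).
Context (om : E -> E -> E -> R) (th : E -> E -> R).
Context (omE : forall x u v, W x ->
    om x u v = ell2_norm (f x) ^- 2 * flat_form (f x) ('d f x u) ('d f x v))
  (om_derivable : forall x u v w, W x -> rderivable (fun y => om y u v) x w)
  (om_continuous : forall x u v, W x -> {for x, continuous (fun y => om y u v)})
  (om_pos : forall x u, W x -> u != 0 -> 0 < om x u ('i%C *: u))
  (d_om : forall x u v w, W x -> d2 om x u v w = wedge12 (th x) (om x) u v w)
  (dim_ge2 : forall u : E, exists v, forall c : R[i], v != c *: u).
Implicit Types (x y u v w : E) (a : ell2 R).

Let psi y : R := ell2_norm (f y) ^+ 2.

Lemma is_derive0_near (F G : R -> R) (d l : R) : 0 < d ->
  (forall t, `|t| < d -> F t = G t) ->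
  is_derive (0 : R) (1 : R) F l -> is_derive (0 : R) (1 : R) G l.
Proof.
move=> d0 FG [d1 e1].
have nFG : {near (0 : R), F =1 G}.
  by apply/nbhs_ballP; exists d => //= t; rewrite /ball /= sub0r normrN; exact: FG.
apply: DeriveDef; first exact: near_eq_derivable nFG d1.
by rewrite -(near_eq_derive _ nFG).
Qed.

Lemma W_line x u : W x ->
  exists2 d, 0 < d & forall t : R, `|t| < d -> W (x + t%:C *: u).
Proof.
move=> Wx; have [d d0 Hd] := open_rnorm oW Wx.
have [d' d'0 Hd'] := @rnorm_line R E d u d0.
by exists d' => // t /Hd'; exact: Hd.
Qed.

Lemma line0 x u : x + (0 : R)%:C *: u = x.
Proof. by rewrite scale0r addr0. Qed.

Lemma psi_gt0 x : W x -> 0 < psi x.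
Proof.
by move=> Wx; rewrite exprn_gt0// lt_def ell2_norm_ge0 ell2_norm_eq0 f_neq0.
Qed.

Lemma psi_om x u v : W x -> psi x * om x u v = 4 * rip ('i%C *: 'd f x u) ('d f x v).
Proof. by move=> Wx; rewrite omE// flat_formE mulVKf// gt_eqF// psi_gt0. Qed.

Lemma rip_diff_diff x v : W x ->
  rip ('d f x v) ('d f x v) = psi x * om x v ('i%C *: v) / 4.
Proof. by move=> Wx; rewrite psi_om// linearZ /= ripii mulrAC divff ?mul1r. Qed.

Lemma diff_locally_bounded x v : W x -> locally_bounded (fun y => 'd f y v) x.
Proof.
move=> Wx; have [c0 [d0 [d00 H0]]] := differentiable_locally_bounded dW Wx.
have [d1 d10 H1] := continuous_rnorm (@om_continuous x v ('i%C *: v) Wx) ltr01.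
have [d3 d30 H3] := open_rnorm oW Wx.
exists (c0 ^+ 2 * (`|om x v ('i%C *: v)| + 1) / 4 + 1), (Num.min d0 (Num.min d1 d3)).
split; first by rewrite !lt_min d00 d10 d30.
move=> h; rewrite !lt_min => /andP[/H0 fc /andP[/H1 omc /H3 Wh]].
have psic : psi (x + h) <= c0 ^+ 2.
  rewrite ler_pXn2r// nnegrE ?ell2_norm_ge0//.
  exact: le_trans (ell2_norm_ge0 _) fc.
have omc' : `|om (x + h) v ('i%C *: v)| <= `|om x v ('i%C *: v)| + 1.
  rewrite -[X in `|X| <= _](subrK (om x v ('i%C *: v))) addrC.
  by apply: le_trans (ler_normD _ _) _; rewrite lerD2l ltW.
set X := ell2_norm _.
have XX : X ^+ 2 <= c0 ^+ 2 * (`|om x v ('i%C *: v)| + 1) / 4.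
  rewrite /X -rip_norm rip_diff_diff// ler_wpM2r//.
  apply: ler_pM => //; first exact/ltW/psi_gt0.
    have := rip_diff_diff v Wh; rewrite rip_norm => e.
    by have : 0 <= psi (x + h) * om (x + h) v ('i%C *: v) / 4;
      [rewrite -e sqr_ge0|rewrite pmulr_lge0// pmulr_rge0// psi_gt0].
  exact: le_trans (ler_norm _) omc'.
(* [(X - 1/2)^2 >= 0] gives [X <= X^2 + 1/4], whence the [+ 1] in the chosen bound. *)
have := sqr_ge0 (X - 2^-1); rewrite sqrrB; move: XX; rewrite mulr2n; lra.
Qed.

Lemma is_derive_line a x u : W x ->
  is_derive (0 : R) (1 : R) (fun t : R => rip a (f (x + t%:C *: u))) (rip a ('d f x u)).
Proof.
move=> Wx; have := @is_derive_holomorphic R E f a x u (fun t : R => t%:C) 0 1.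
by rewrite line0 scale1r; apply; [exact: dW|exact: cderive_real].
Qed.

Lemma is_derive_psi x u : W x ->
  is_derive (0 : R) (1 : R) (fun t : R => psi (x + t%:C *: u)) (2 * rip (f x) ('d f x u)).
Proof.
move=> Wx; pose p t := f (x + t%:C *: u).
have hp : half_holder p by apply: half_holder_line; exact: dW.
have dp := is_derive_line (p 0) u Wx.
have := is_derive_rip hp hp dp dp.
rewrite /p line0 mulr2n mulrDl mul1r; congr is_derive.
by apply/funext => t; rewrite rip_norm.
Qed.

(** The weak second derivative of [f] paired with [a]; on [W] it is a genuine derivative by
    [is_derive_diff]. *)
Definition hess x a u v : R := derive1 (fun t : R => rip a ('d f (x + t%:C *: u) v)) 0.

Lemma hess_sym x a u v : W x -> hess x a u v = hess x a v u.
Proof.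
move=> Wx; have [b [b1 b2]] := weak_hessian_symmetric oW dW a Wx
  (diff_locally_bounded u Wx) (diff_locally_bounded v Wx).
by rewrite /hess (derive1_val b1) (derive1_val b2).
Qed.

Lemma is_derive_diff x a u v : W x ->
  is_derive (0 : R) (1 : R) (fun t : R => rip a ('d f (x + t%:C *: u) v)) (hess x a u v).
Proof.
move=> Wx; have [b [b1 _]] := weak_hessian_symmetric oW dW a Wx
  (diff_locally_bounded u Wx) (diff_locally_bounded v Wx).
by rewrite /hess (derive1_val b1).
Qed.

Lemma is_derive_psi_om x u v w : W x ->
  is_derive (0 : R) (1 : R) (fun t : R => psi (x + t%:C *: u) * om (x + t%:C *: u) v w)
    (2 * rip (f x) ('d f x u) * om x v w + psi x * rderive (fun y => om y v w) x u).
Proof.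
move=> Wx; have dpsi := is_derive_psi u Wx.
have dom : is_derive (0 : R) (1 : R) (fun t : R => om (x + t%:C *: u) v w)
    (rderive (fun y => om y v w) x u).
  exact: derivable1_is_derive (@om_derivable x v w u Wx).
have := is_deriveM dpsi dom; rewrite line0 addrC; congr is_derive.
by rewrite /GRing.scale /= mulrC.
Qed.

Lemma half_holder_diff x u v : W x -> half_holder (fun t : R => 'd f (x + t%:C *: u) v).
Proof.
move=> Wx; have [d d0 Hd] := W_line u Wx.
apply: (half_holder_derivable (is_derive_diff _ u v Wx)).
have FG (t : R) : `|t| < d ->
    4^-1 * (psi (x + t%:C *: u) * om (x + t%:C *: u) v ('i%C *: v)) =
    rip ('d f (x + t%:C *: u) v) ('d f (x + t%:C *: u) v).
  by move=> /Hd Wt; rewrite rip_diff_diff// mulrC.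
apply: (is_derive0_near d0 FG).
exact: is_deriveZ (is_derive_psi_om u v ('i%C *: v) Wx).
Qed.

Lemma half_holder_i (p : R -> ell2 R) :
  half_holder p -> half_holder (fun t => 'i%C *: p t).
Proof.
move=> hp e /hp[d d0 Hd]; exists d => // t /Hd.
by rewrite -scalerBr ell2_normi.
Qed.

(** Up to the factor 4 the function is the pull-back of the flat form, evaluated on [v] and [w]. The
    formula exhibits its closedness: in the alternating sum over [u], [v], [w] the symmetric Hessian
    terms cancel. *)
Lemma is_derive_eta x u v w : W x ->
  is_derive (0 : R) (1 : R)
    (fun t : R => rip ('i%C *: 'd f (x + t%:C *: u) v) ('d f (x + t%:C *: u) w))
    (hess x ('i%C *: 'd f x v) u w - hess x ('i%C *: 'd f x w) u v).
Proof.
move=> Wx; pose p t := 'i%C *: 'd f (x + t%:C *: u) v.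
pose q t := 'd f (x + t%:C *: u) w.
have hp : half_holder p by apply: half_holder_i; exact: half_holder_diff.
have hq : half_holder q by exact: half_holder_diff.
have p0 : p 0 = 'i%C *: 'd f x v by rewrite /p line0.
have q0 : q 0 = 'd f x w by rewrite /q line0.
apply: (is_derive_rip hp hq); first by rewrite p0; exact: is_derive_diff.
rewrite q0.
rewrite (_ : (fun t : R => _) =
  - (fun t : R => rip ('i%C *: 'd f x w) ('d f (x + t%:C *: u) v))).
  exact: is_deriveN (is_derive_diff _ u v Wx).
apply/funext => t; rewrite -[RHS]/(- rip ('i%C *: 'd f x w) ('d f (x + t%:C *: u) v)).
by rewrite ripi opprK.
Qed.

(** Two computations of one derivative, that of [psi om] along [u]: by the product rule, and through
    [psi_om] as the pull-back of the flat form. *)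
Lemma d_psi_om x u v w : W x ->
  2 * rip (f x) ('d f x u) * om x v w + psi x * rderive (fun y => om y v w) x u =
  4 * (hess x ('i%C *: 'd f x v) u w - hess x ('i%C *: 'd f x w) u v).
Proof.
move=> Wx; have [d d0 Hd] := W_line u Wx.
have := is_deriveZ (4 : R) (is_derive_eta u v w Wx).
have d1 := is_derive_psi_om u v w Wx.
move=> d2; have := is_derive0_near d0 _ d1.
move=> /(_ (fun t : R => 4 * rip ('i%C *: 'd f (x + t%:C *: u) v) ('d f (x + t%:C *: u) w))).
case=> [t /Hd Wt|_ <-]; first exact: psi_om.
by have [_ e2] := d2; exact: e2.
Qed.

(* Closedness of [psi om] and [d om = th /\ om] give [(d psi + psi th) /\ om = 0]. *)
Lemma wedge_eq0 x u v w : W x ->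
  wedge12 (fun u => 2 * rip (f x) ('d f x u) + psi x * th x u) (om x) u v w = 0.
Proof.
move=> Wx; have := @d_om x u v w Wx; rewrite /d2 /wedge12.
have := d_psi_om u v w Wx; have := d_psi_om v u w Wx; have := d_psi_om w u v Wx.
rewrite (hess_sym _ u w Wx) (hess_sym _ u v Wx) (hess_sym _ v w Wx).
move=> e3 e2 e1 e0.
(* Here [p] stands for [psi], the [a]'s for [d psi], the [t]'s for [th], the [o]'s for [om], and
   [A], [B], [C] for derivatives of [om]. Symmetry has left three Hessian values [h1], [h2], [h3],
   and [(h1 - h2) - (h3 - h2) + (h3 - h1) = 0]. *)
have alg (p a1 a2 a3 t1 t2 t3 o1 o2 o3 A B C h1 h2 h3 : R) :
    a3 * o3 + p * C = 4 * (h3 - h1) -> a2 * o2 + p * B = 4 * (h3 - h2) ->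
    a1 * o1 + p * A = 4 * (h1 - h2) ->
    A - B + C = t1 * o1 - t2 * o2 + t3 * o3 ->
    (a1 + p * t1) * o1 - (a2 + p * t2) * o2 + (a3 + p * t3) * o3 = 0.
  move=> c3 c2 c1 c0.
  have -> : (a1 + p * t1) * o1 - (a2 + p * t2) * o2 + (a3 + p * t3) * o3 =
    (a1 * o1 + p * A) - (a2 * o2 + p * B) + (a3 * o3 + p * C) +
    p * (t1 * o1 - t2 * o2 + t3 * o3 - (A - B + C)) by ring.
  by rewrite c0 subrr mulr0 addr0 c1 c2 c3; ring.
exact: (alg _ _ _ _ _ _ _ _ _ _ _ _ _ _ _ _ e3 e2 e1 e0).
Qed.

Lemma om_rip x u v : W x -> om x u v = (psi x)^-1 * (4 * rip ('i%C *: 'd f x u) ('d f x v)).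
Proof. by move=> Wx; rewrite -psi_om// mulKf// gt_eqF// psi_gt0. Qed.

(** Gram-Schmidt for the Hermitian metric: from a vector outside the complex line of [u] subtract
    its projection [c *: u]. The difference is nonzero because the dimension is at least 2. *)
Lemma om_orthogonal x u : W x ->
  exists v, [/\ v != 0, om x u v = 0 & om x u ('i%C *: v) = 0].
Proof.
move=> Wx; have [v0 Hv0] := dim_ge2 u.
have [u0|u0] := eqVneq u 0.
  exists v0; split; first by have := Hv0 0; rewrite scale0r.
    by rewrite om_rip// u0 linear0 scaler0 -[X in rip X](scale0r 0) ripZl !(mul0r, mulr0).
  by rewrite om_rip// u0 linear0 scaler0 -[X in rip X](scale0r 0) ripZl !(mul0r, mulr0).
have p0 := om_pos Wx u0.
pose r v := rip ('i%C *: 'd f x u) ('d f x v).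
have omr v : om x u v = (psi x)^-1 * (4 * r v) by exact: om_rip.
have rB v c w : r (v - c *: w) = r v - (complex.Re c * r w + complex.Im c * r ('i%C *: w)).
  by rewrite /r linearB ripBr !linearZ /= -rip_complex.
have ru : r u = 0.
  by have := ripi ('d f x u) ('d f x u); rewrite [in RHS]ripC -/(r u); lra.
have q0 : r ('i%C *: u) != 0.
  by apply: contraTneq (om_pos Wx u0); rewrite omr => ->; rewrite !mulr0 ltxx.
(* As [r u = 0], the condition on [v] involves only the imaginary part of [c] and the condition on
   [i v] only its real part; each is solved by dividing by [r (i u)], nonzero by positivity of the
   metric. *)
pose c := (r ('i%C *: v0) / r ('i%C *: u)) +i* (r v0 / r ('i%C *: u)).
exists (v0 - c *: u); split; first by rewrite subr_eq0.
  by rewrite omr rB ru /=; apply/eqP; rewrite !mulf_eq0 subr_eq0; apply/orP; right;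
    apply/orP; right; rewrite mulr0 add0r divfK.
rewrite scalerBr scalerA omr rB ru ReM ImM /=; apply/eqP; rewrite !mulf_eq0.
apply/orP; right; apply/orP; right; rewrite !(mulr0, mul0r, mul1r, add0r, addr0).
by rewrite divfK// subrr.
Qed.

(** On the triple [u], [v], [i v] with [v] from [om_orthogonal], the identity [wedge_eq0] retains
    only the term with [om x v (i v)], which is positive and can be divided out. *)
Lemma d_psi x u : W x -> 2 * rip (f x) ('d f x u) = - psi x * th x u.
Proof.
move=> Wx; have [v [v0 uv uiv]] := om_orthogonal u Wx.
have := wedge_eq0 u v ('i%C *: v) Wx; rewrite /wedge12 uv uiv !mulr0 subr0 addr0.
move/eqP; rewrite mulf_eq0 [X in _ || X]gt_eqF ?om_pos// orbF addr_eq0 mulNr.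
by move/eqP.
Qed.

Lemma rderive_psi x u : W x ->
  rderivable psi x u /\ rderive psi x u = - psi x * th x u.
Proof.
move=> Wx; have dp := is_derive_psi u Wx; rewrite -d_psi//.
by split; [case: dp|exact: derive1_val].
Qed.

Lemma is_derive_dc x u v : W x ->
  is_derive (0 : R) (1 : R) (fun t : R => dc psi (x + t%:C *: u) v)
    (2 * (hess x ('i%C *: f x) u v - rip ('d f x u) ('i%C *: 'd f x v))).
Proof.
move=> Wx; have [d d0 Hd] := W_line u Wx.
pose p t := f (x + t%:C *: u); pose q t := 'd f (x + t%:C *: u) ('i%C *: v).
have hp : half_holder p by apply: half_holder_line; exact: dW.
have hq : half_holder q by exact: half_holder_diff.
have p0 : p 0 = f x by rewrite /p line0.
have q0 : q 0 = 'i%C *: 'd f x v by rewrite /q line0 linearZ.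
have dpq : is_derive (0 : R) (1 : R) (fun t : R => rip (p t) (q t))
    (- hess x ('i%C *: f x) u v + rip ('i%C *: 'd f x v) ('d f x u)).
  apply: (is_derive_rip hp hq); last by rewrite q0; exact: is_derive_line.
  rewrite p0 (_ : (fun t : R => _) =
    - (fun t : R => rip ('i%C *: f x) ('d f (x + t%:C *: u) v))).
    exact: is_deriveN (is_derive_diff _ u v Wx).
  apply/funext => t; rewrite -[RHS]/(- rip ('i%C *: f x) ('d f (x + t%:C *: u) v)).
  by rewrite /q linearZ /= ripi opprK.
have := is_deriveZ (- 2 : R) dpq; rewrite -[(- 2 : R) *: _]/(- 2 * _).
rewrite (ripC ('i%C *: 'd f x v)).
have -> : - 2 * (- hess x ('i%C *: f x) u v + rip ('d f x u) ('i%C *: 'd f x v)) =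
  2 * (hess x ('i%C *: f x) u v - rip ('d f x u) ('i%C *: 'd f x v)) by ring.
apply: is_derive0_near d0 _ => t /Hd Wt.
rewrite /dc; have dp := is_derive_psi ('i%C *: v) Wt.
by rewrite [rderive _ _ _](derive1_val dp) -mulNr.
Qed.

(** Since [df] commutes with i, the second derivatives of [f] enter symmetrically in [u] and [v] and
    cancel; what remains is the flat form on [df u] and [df v], as for the squared norm itself. *)
Lemma ddc_psi x u v : W x -> ddc psi x u v = psi x * om x u v.
Proof.
move=> Wx; rewrite /ddc /d1 psi_om//.
rewrite [rderive _ x u](derive1_val (is_derive_dc u v Wx)).
rewrite [rderive _ x v](derive1_val (is_derive_dc v u Wx)).
rewrite (hess_sym _ u v Wx) -[rip ('d f x v) _]opprK -ripi ripi (ripC ('d f x v)) ripi.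
ring.
Qed.

End lck_potential_local.

(** * A covering of [M] inside [M * R] *)

Lemma continuous_pair {T U V : topologicalType} (f : T -> U) (g : T -> V) x :
  {for x, continuous f} -> {for x, continuous g} ->
  {for x, continuous (fun x => (f x, g x))}.
Proof. by move=> cf cg; exact: (cvg_pair cf cg). Qed.

Section covering_by_heights.
Context {R : realType} {M : topologicalType} (ell : R) (L : set (M * R)).
Implicit Types (m : M) (t : R) (V : set M) (s : M -> R) (k j : int).

(** An evenly covered neighbourhood in explicit form, [s] being one branch of the height.
    Connectedness of [V] puts each translated graph inside a single component of [L]. *)
Definition fibre_chart V s :=
  [/\ open V, connected V, forall m, V m -> {for m, continuous s} &
      forall m t, V m -> (L (m, t) <-> exists k, t = s m + k%:~R * ell)].

Context (ell0 : ell != 0) (connM : connected [set: M]) (pt : M * R) (Lpt : L pt)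
  (loc : forall m, exists V s, V m /\ fibre_chart V s).

Definition total_set : set (M * R) := connected_component L pt.
Definition total_space : topologicalType := set_type total_set.
Local Notation C := total_set.
Local Notation N := total_space.
Definition total_proj (y : N) : M := (set_val y).1.
Definition height (y : N) : R := (set_val y).2.
Local Notation p := total_proj.

Definition total_mk (x : M * R) (Cx : C x) : N := exist _ x (mem_set Cx).

Lemma total_setP (y : N) : C (p y, height y).
Proof. by rewrite /p /height -surjective_pairing; exact: set_valP. Qed.

Lemma total_inj (x y : N) : p x = p y -> height x = height y -> x = y.
Proof.
move=> pxy hxy; apply: val_inj; rewrite -[LHS]/(set_val x) -[RHS]/(set_val y).
rewrite [LHS]surjective_pairing [RHS]surjective_pairing.
by congr pair; [exact: pxy|exact: hxy].
Qed.

Lemma total_sub_L x : C x -> L x.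
Proof. exact: connected_component_sub. Qed.

Lemma total_connected_sub (B : set (M * R)) x :
  C x -> B x -> B `<=` L -> connected B -> B `<=` C.
Proof.
move=> Cx Bx BL cB y By; apply: (connected_component_trans Cx).
exact: (connected_component_max Bx BL cB By).
Qed.

Lemma continuous_graph s m (c : R) : {for m, continuous s} ->
  {for m, continuous (fun m => (m, s m + c))}.
Proof.
move=> cs; apply: continuous_pair; first exact: cvg_id.
by apply: cvgD; [exact: cs|exact: cvg_cst].
Qed.

Lemma total_sheet V s m1 m2 k : fibre_chart V s -> V m1 -> V m2 ->
  C (m1, s m1 + k%:~R * ell) -> C (m2, s m2 + k%:~R * ell).
Proof.
move=> [oV cV cs LV] Vm1 Vm2 C1.
pose B := (fun m => (m, s m + k%:~R * ell)) @` V.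
have cB : connected B.
  apply: connected_continuous_connected => //.
  apply: continuous_in_subspaceT => m /set_mem Vm.
  by apply: continuous_graph; exact: cs.
have BL : B `<=` L by move=> _ [m Vm <-]; apply/LV => //; exists k.
have B1 : B (m1, s m1 + k%:~R * ell) by exists m1.
by apply: (total_connected_sub C1 B1 BL cB); exists m2.
Qed.

Lemma total_fibre V s m t : fibre_chart V s -> V m -> C (m, t) ->
  exists k, t = s m + k%:~R * ell.
Proof. by move=> [_ _ _ LV] Vm /total_sub_L/LV; apply. Qed.

Lemma multiple_small k : `|k%:~R * ell| < `|ell| -> k = 0.
Proof.
rewrite normrM gtr_pMl ?normr_gt0// -intr_norm -[X in _ < X](rmorph1 (intmul (1 : R))).
rewrite ltr_int => k1; apply/eqP; rewrite -normr_le0.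
by move: k1; case: `|k| => // -[].
Qed.

Lemma multiple_inj k j : k%:~R * ell = j%:~R * ell -> k = j.
Proof. by move=> /(mulIf ell0) /intr_inj. Qed.

Lemma multiple_near k j : `|k%:~R * ell - j%:~R * ell| < `|ell| -> k = j.
Proof. by rewrite -mulrBl -rmorphB => /multiple_small/subr0_eq. Qed.

Lemma L_translate m t k : L (m, t) -> L (m, t + k%:~R * ell).
Proof.
have [V [s [Vm [_ _ _ LV]]]] := loc m; move=> /LV -/(_ Vm)[j ->].
by apply/LV => //; exists (j + k); rewrite rmorphD mulrDl addrA.
Qed.

(** Translation by [k ell] preserves [L], so it carries the component to a connected subset of [L];
    meeting the component in one point, this subset lies in it. Deck transformations arise in this
    way. *)
Lemma total_translate m t k : C (m, t) -> C (m, t + k%:~R * ell) ->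
  forall x, C x -> C (x.1, x.2 + k%:~R * ell).
Proof.
move=> C1 C2 x Cx; pose T (x : M * R) := (x.1, x.2 + k%:~R * ell).
have cB : connected (T @` C).
  apply: connected_continuous_connected; first exact: component_connected.
  apply: continuous_subspaceT => -[m' t']; apply: continuous_pair; first exact: cvg_fst.
  by apply: cvgD; [exact: cvg_snd|exact: cvg_cst].
have BL : T @` C `<=` L.
  by move=> _ [[m' t'] /total_sub_L Lm' <-]; exact: L_translate.
have B1 : (T @` C) (m, t + k%:~R * ell) by exists (m, t).
by apply: (total_connected_sub C2 B1 BL cB); exists x.
Qed.

(** By [total_sheet] the image of the component contains or misses each chart neighbourhood
    entirely, so it is open and closed in the connected [M]. *)
Lemma total_proj_surj m : exists t, C (m, t).
Proof.
pose P : set M := [set m | exists t, C (m, t)].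
have Ppt : P pt.1.
  by exists pt.2; rewrite -surjective_pairing; exact: connected_component_refl.
have step V s m1 m2 : fibre_chart V s -> V m1 -> V m2 -> P m1 -> P m2.
  move=> cVs V1 V2 [t Ct]; have [k tk] := total_fibre cVs V1 Ct.
  by exists (s m2 + k%:~R * ell); apply: (total_sheet cVs V1 V2); rewrite -tk.
have oP : open P.
  rewrite openE => m1 Pm1; have [V [s [Vm cVs]]] := loc m1.
  have oV : open V by case: cVs.
  by apply: filterS (open_nbhs_nbhs (conj oV Vm)) => m2 V2; exact: (step _ _ _ _ cVs Vm V2 Pm1).
have cP : closed P.
  rewrite -openC openE => m1 nPm1; have [V [s [Vm cVs]]] := loc m1.
  have oV : open V by case: cVs.
  apply: filterS (open_nbhs_nbhs (conj oV Vm)) => m2 V2 Pm2; apply: nPm1; exact: (step _ _ _ _ cVs V2 Vm Pm2).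
suff PT : P = [set: M] by have : P m by rewrite PT.
by apply: connM; [exists pt.1|exists P => //; rewrite setTI|exists P => //; rewrite setTI].
Qed.

Lemma total_val_continuous : continuous (set_val : N -> M * R).
Proof. exact: initial_continuous. Qed.

Lemma total_proj_continuous : continuous p.
Proof.
move=> y; apply: (@continuous_comp _ _ _ (set_val : N -> M * R) fst).
  exact: total_val_continuous.
exact: cvg_fst.
Qed.

Lemma height_continuous : continuous height.
Proof.
move=> y; apply: (@continuous_comp _ _ _ (set_val : N -> M * R) snd).
  exact: total_val_continuous.
exact: cvg_snd.
Qed.

Lemma total_connected : connected [set: N].
Proof.
move=> B [y By] [B1 oB1 B1E] [B2 cB2 B2E].
rewrite setTI in B1E; rewrite setTI in B2E; subst B1 B2.
have [Q1 oQ1 Q1E] := oB1; move: cB2; rewrite -openC => -[Q2 oQ2 Q2E].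
have e1 : set_val @` B = C `&` Q1.
  apply/seteqP; split=> [_ [z Bz <-]|x [Cx Qx]].
    by split; [exact: set_valP|move: Bz; rewrite -Q1E].
  by exists (total_mk Cx) => //; rewrite -Q1E.
have e2 : set_val @` B = C `&` ~` Q2.
  apply/seteqP; split=> [_ [z Bz <-]|x [Cx Qx]].
    split; first exact: set_valP.
    by move=> Q2z; have : (~` B) z by rewrite -Q2E.
  exists (total_mk Cx) => //; apply: contrapT => nB.
  by have : (~` B) (total_mk Cx) by []; rewrite -Q2E.
have eC : set_val @` B = C.
  apply: (@component_connected _ L pt).
  - by exists (set_val y); exists y.
  - by exists Q1.
  - by exists (~` Q2) => //; rewrite closedC.
have BC x : C x -> (set_val @` B) x by rewrite eC.
apply/seteqP; split=> // z _.
by have [w Bw /val_inj <-] := BC _ (set_valP z).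
Qed.

(** [height - s] is continuous and takes its values in the multiples of [ell], which are [|ell|]
    apart, so it is locally constant. *)
Lemma height_near V s y k : fibre_chart V s -> V (p y) ->
  height y = s (p y) + k%:~R * ell ->
  \forall z \near y, V (p z) /\ height z = s (p z) + k%:~R * ell.
Proof.
move=> cVs Vy hy; have [oV _ cs _] := cVs.
have e0 : 0 < `|ell| by rewrite normr_gt0.
have ch : {for y, continuous (fun z => height z - s (p z))}.
  have c1 : height z @[z --> y] --> height y by exact: height_continuous.
  have c2 : s (p z) @[z --> y] --> s (p y).
    apply: (@continuous_comp _ _ _ p s); first exact: total_proj_continuous.
    exact: cs.
  exact: (cvgB c1 c2).
have n1 : \forall z \near y, `|(height y - s (p y)) - (height z - s (p z))| < `|ell|.
  by move/cvgrPdist_lt : ch => /(_ _ e0).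
have n2 : \forall z \near y, V (p z).
  by apply: total_proj_continuous; exact: open_nbhs_nbhs.
apply: filterS2 n1 n2 => z zl Vz; split => //.
have [j hj] := total_fibre cVs Vz (total_setP z).
move: zl; rewrite hy hj [s (p y) + _]addrC addrK [s (p z) + _]addrC addrK.
by move=> /multiple_near ->; rewrite addrC.
Qed.

Definition sheet V s k : set N := [set y | V (p y) /\ height y = s (p y) + k%:~R * ell].

Lemma sheet_open V s k : fibre_chart V s -> open (sheet V s k).
Proof. by move=> cVs; rewrite openE => y [Vy hy]; exact: height_near. Qed.

Lemma total_covering_map : covering_map p.
Proof.
split; first exact: total_proj_continuous.
move=> m0; have [V [s [Vm cVs]]] := loc m0; exists V.
have [oV cV cs LV] := cVs; split=> //.
(* Not every translate of the graph need lie in the component. Testing at [m0] selects those that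
   do, and by [total_sheet] the choice of test point in [V] does not matter. *)
exists [set sheet V s k | k in [set k | C (m0, s m0 + k%:~R * ell)]]; split.
- have [t Ct] := total_proj_surj m0; have [k tk] := total_fibre cVs Vm Ct.
  by exists (sheet V s k); exists k => //=; rewrite -tk.
- move=> _ _ [k Ck <-] [j Cj <-] [y [[Vy hk] [_ hj]]].
  by have := hk; rewrite hj => /addrI/multiple_inj ->.
- apply/seteqP; split=> [y Vy|y [_ [k Ck <-]] []//].
  have [k hk] := total_fibre cVs Vy (total_setP y).
  exists (sheet V s k) => //; exists k => //=.
  by apply: (total_sheet cVs Vy Vm); rewrite -hk; exact: total_setP.
- move=> _ [k Ck <-]; split.
  + exact: sheet_open.
  + apply/seteqP; split=> [_ [y [Vy _] <-]//|m V'm].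
    by exists (total_mk (total_sheet cVs Vm V'm Ck)).
  + move=> x y /set_mem[_ hx] /set_mem[_ hy] pxy; apply: total_inj => //.
    by rewrite hx hy pxy.
  + move=> W WU [Q oQ QW]; rewrite openE => _ [y Wy <-].
    have [Vy hy] := WU _ Wy.
    have cg := @continuous_graph s (p y) (k%:~R * ell) (cs _ Vy).
    have nQ : nbhs (p y, s (p y) + k%:~R * ell) Q.
      apply: open_nbhs_nbhs; split=> //.
      by rewrite -hy /p /height -surjective_pairing; move: Wy; rewrite -QW.
    have nV : nbhs (p y) V by exact: open_nbhs_nbhs.
    apply: filterS2 nV (cg _ nQ) => m V'm /= Qm.
    have Cm : C (m, s m + k%:~R * ell) by exact: (total_sheet cVs Vm V'm Ck).
    by exists (total_mk Cm) => //; rewrite -QW.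
Qed.

Lemma continuous_to_total (T : topologicalType) (f : T -> N) :
  continuous (fun x => set_val (f x)) -> continuous f.
Proof.
move=> /continuousP cf; apply/continuousP => _ [Q oQ <-].
exact: cf Q oQ.
Qed.

(** Heights of two points in one fibre differ by a multiple of [ell], and translation by it is the
    required deck transformation; [total_translate], applied in both directions, keeps it and its
    inverse inside [N]. *)
Lemma total_galois : galois_covering p.
Proof.
split; [exact: total_connected|exact: total_covering_map|].
move=> x y pxy; have [V [s [Vx cVs]]] := loc (p x).
have [k hk] := total_fibre cVs Vx (total_setP x).
have Vy : V (p y) by rewrite -pxy.
have [j hj] := total_fibre cVs Vy (total_setP y).
have hxy : height y = height x + (j - k)%:~R * ell.
  by rewrite hj hk pxy rmorphB mulrBl; ring.
have hyx : height x = height y + (k - j)%:~R * ell.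
  by rewrite hj hk pxy rmorphB mulrBl; ring.
have Cy := total_setP y; have Cx := total_setP x.
have T1 := @total_translate (p x) (height x) (j - k) Cx.
have T2 := @total_translate (p y) (height y) (k - j) Cy.
rewrite -hxy pxy in T1; rewrite -hyx -pxy in T2.
pose g (z : N) : N := total_mk (T1 Cy _ (set_valP z)).
pose g' (z : N) : N := total_mk (T2 Cx _ (set_valP z)).
have cg (a : R) (h : N -> N) : (forall z, set_val (h z) = (p z, height z + a)) -> continuous h.
  move=> hE; apply: continuous_to_total.
  rewrite (_ : (fun _ => _) = (fun z => (p z, height z + a))); last exact/funext.
  move=> z; apply: continuous_pair; first exact: total_proj_continuous.
  have c1 : height z' @[z' --> z] --> height z by exact: height_continuous.
  exact: (cvgD c1 (cvg_cst a)).
exists g; last by apply: total_inj => //; rewrite hxy.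
split; [exact: (cg ((j - k)%:~R * ell))|by []|].
exists g'; split; first exact: (cg ((k - j)%:~R * ell)).
  move=> z; apply: total_inj => //; rewrite /height /= -addrA -mulrDl -rmorphD.
  by rewrite subrKA subrr rmorph0 mul0r addr0.
move=> z; apply: total_inj => //; rewrite /height /= -addrA -mulrDl -rmorphD.
by rewrite subrKA subrr rmorph0 mul0r addr0.
Qed.

(** [height (g y) - height y] is continuous with values in the multiples of [ell], hence locally
    constant, hence constant on the connected [N]. Thus every deck transformation is a
    translation. *)
Lemma deck_height g : deck p g -> exists c, forall y, height (g y) = height y + c.
Proof.
move=> [cg pg _]; have pgE y : p (g y) = p y by rewrite -[in RHS]pg.
pose D y := height (g y) - height y.
have [t0 Ct0] := total_proj_surj pt.1; pose y0 := total_mk Ct0.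
exists (D y0); suff DE : forall y, D y = D y0.
  by move=> y; rewrite -(DE y) /D addrC subrK.
have Dk y : exists k, D y = k%:~R * ell.
  have [V [s [Vy cVs]]] := loc (p y).
  have [k hk] := total_fibre cVs Vy (total_setP y).
  have Vg : V (p (g y)) by rewrite pgE.
  have [j hj] := total_fibre cVs Vg (total_setP (g y)).
  by exists (j - k); rewrite /D hj hk pgE rmorphB mulrBl; ring.
have cD : continuous D.
  move=> z; have c1 : height z' @[z' --> z] --> height z by exact: height_continuous.
  have c2 : height (g z') @[z' --> z] --> height (g z).
    by apply: (@continuous_comp _ _ _ g height); [exact: cg|exact: height_continuous].
  exact: (cvgB c2 c1).
have e0 : 0 < `|ell| by rewrite normr_gt0.
have Dloc z : \forall w \near z, D w = D z.
  have := cD z; move/cvgrPdist_lt => /(_ _ e0); apply: filterS => w.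
  by have [k ->] := Dk z; have [j ->] := Dk w; move=> /multiple_near ->.
have oP : open [set y | D y = D y0].
  by rewrite openE => z Dz; apply: filterS (Dloc z) => w /= ->.
have cP : closed [set y | D y = D y0].
  rewrite -openC openE => z Dz; apply: filterS (Dloc z) => w /= e Dw.
  by apply: Dz; rewrite /= -e.
have : [set y | D y = D y0] = [set: N].
  apply: total_connected; first by exists y0.
    by exists [set y | D y = D y0] => //; rewrite setTI.
  by exists [set y | D y = D y0] => //; rewrite setTI.
by move=> /seteqP[_ /(_ _ I)] H y; exact: H.
Qed.

(** Above a chart the component is a union of graphs at vertical distance at least [|ell|] from one
    another, so the heights over a single point cannot accumulate. *)
Lemma total_closed : closed C.
Proof.
rewrite -openC openE => -[m t] nC; have [V [s [Vm cVs]]] := loc m.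
have [oV _ cs _] := cVs; pose a := t - s m.
have l0 : 0 < `|ell| by rewrite normr_gt0.
(* If no admissible multiple is closer to [a] than [|ell| / 2], that number serves. Otherwise the
   distance to such a multiple does: a closer one would be less than [|ell|] away from it, hence
   equal to it. *)
have [e e0 He] : exists2 e, 0 < e & forall k, C (m, s m + k%:~R * ell) ->
    e <= `|a - k%:~R * ell|.
  have [[k [Ck ak]]|nk] := pselect (exists k, C (m, s m + k%:~R * ell) /\
      `|a - k%:~R * ell| < `|ell| / 2); last first.
    exists (`|ell| / 2); first by rewrite divr_gt0.
    by move=> k Ck; rewrite leNgt; apply/negP => ak; apply: nk; exists k.
  have ak0 : 0 < `|a - k%:~R * ell|.
    rewrite normr_gt0; apply/eqP => ak0; apply: nC; move: Ck.
    by rewrite -(subr0_eq ak0) /a addrC subrK.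
  exists `|a - k%:~R * ell| => // j Cj; rewrite leNgt; apply/negP => aj.
  suff jk : k = j by move: aj; rewrite jk ltxx.
  apply: multiple_near; have -> : k%:~R * ell - j%:~R * ell =
    (a - j%:~R * ell) - (a - k%:~R * ell) by ring.
  by apply: le_lt_trans (ler_normB _ _) _; lra.
have cf : {for (m, t), continuous (fun x : M * R => x.2 - s x.1)}.
  have c1 : x.2 @[x --> (m, t)] --> t by exact: cvg_snd.
  have c2 : s x.1 @[x --> (m, t)] --> s (m, t).1.
    by apply: (@continuous_comp _ _ _ (@fst M R) s); [exact: cvg_fst|exact: cs].
  exact: (cvgB c1 c2).
have n1 : \forall x \near (m, t), `|a - (x.2 - s x.1)| < e.
  by move/cvgrPdist_lt : cf => /(_ _ e0).
have n2 : \forall x \near (m, t), V x.1 by apply: cvg_fst; exact: open_nbhs_nbhs.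
apply: filterS2 n1 n2 => -[m' t'] /= h Vm' Cm'.
have [k tk] := total_fibre cVs Vm' Cm'.
have Ck : C (m, s m + k%:~R * ell) by apply: (total_sheet cVs Vm' Vm); rewrite -tk.
have := He _ Ck; rewrite leNgt => /negP; apply.
by move: h; rewrite tk [s m' + _]addrC addrK.
Qed.

(** The part of the component in [M * K] is closed in a compact set; the rest of the proof
    transports filters between this subset and the type [N]. *)
Lemma height_proper (K : set R) : compact [set: M] -> compact K ->
  compact [set y : N | K (height y)].
Proof.
move=> cM cK; pose A : set (M * R) := ([set: M] `*` K) `&` C.
have cA : compact A.
  rewrite /A; apply: compact_closedI; last exact: total_closed.
  exact: compact_setX.
move=> F PF FK.
have FA : (set_val @ F) A.
  have : F (set_val @^-1` A).
    by apply: (@filterS _ F _ _ _ _ FK) => y Ky; split; [split|exact: set_valP].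
  by [].
have [x [[[_ Kx] Cx] clx]] := cA (set_val @ F) _ FA.
exists (total_mk Cx); split; first exact: Kx.
move=> B U FB [U' [[Q oQ QU'] U'x] U'U].
have FB' : (set_val @ F) (set_val @` B).
  have : F (set_val @^-1` (set_val @` B)).
    by apply: (@filterS _ F _ _ _ _ FB) => y By; exists y.
  by [].
have nQ : nbhs x Q by apply: open_nbhs_nbhs; split=> //; move: U'x; rewrite -QU'.
have [_ [[z Bz <-] Qz]] := clx _ _ FB' nQ.
by exists z; split => //; apply: U'U; rewrite -QU'.
Qed.

End covering_by_heights.

(** * Charts of the Hopf manifold *)

Lemma rnorm_continuous {R : realType} {E : normedModType R[i]} :
  continuous (@rnorm R E).
Proof.
move=> x; apply/cvgrPdist_lt => e e0; apply/near_rnormP; exists e => // h hd.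
have n1 := rnormD x h; have := rnormD (x + h) (- h).
by rewrite addrK rnormN => n2; rewrite ltr_norml; apply/andP; split; lra.
Qed.

Section hopf_charts.
Local Open Scope quotient_scope.
Context {R : realType} (lambda : R[i]) (l0 : lambda != 0) (l1 : `|lambda| != 1).
Implicit Types (x : ell2 R) (z w : ell2_star (R := R)) (k : int).

Definition cmod (c : R[i]) : R := Num.sqrt (sqmod c).
Definition lognorm x : R := ln (ell2_norm x).
(** The shift of [ln |z|] under the generator of the group. *)
Definition period : R := ln (cmod lambda).

Lemma cmodE c : `|c| = (cmod c)%:C.
Proof. exact: sqmodE. Qed.

Lemma cmod_gt0 c : c != 0 -> 0 < cmod c.
Proof. by rewrite -normr_gt0 cmodE ltcR. Qed.

Lemma cmodM c d : cmod (c * d) = cmod c * cmod d.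
Proof. by rewrite /cmod sqmodM sqrtrM ?sqmod_ge0. Qed.

Lemma ell2_normZc c x : ell2_norm (c *: x) = cmod c * ell2_norm x.
Proof. by have := rnormZ c x; rewrite !rnorm_ell2. Qed.

Lemma ell2_norm_gt0 x : (0 < ell2_norm x) = (x != 0).
Proof. by rewrite lt_def ell2_norm_ge0 ell2_norm_eq0 andbT. Qed.

Lemma ln_cmod_exp k : ln (cmod (lambda ^ k)) = k%:~R * period.
Proof.
have nat_case n : ln (cmod (lambda ^+ n)) = n%:R * period.
  elim: n => [|n IHn]; first by rewrite expr0 mul0r /cmod /sqmod /= expr0n expr1n addr0 sqrtr1 ln1.
  rewrite exprS cmodM lnM ?posrE ?cmod_gt0 ?expf_neq0// IHn -/period.
  by rewrite mulrSr mulrDl mul1r addrC.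
case: k => n; first by rewrite -exprnP nat_case.
rewrite NegzE -exprnN.
have : cmod (lambda ^- n.+1) * cmod (lambda ^+ n.+1) = 1.
  by rewrite -cmodM mulVf ?expf_neq0// /cmod /sqmod /= expr0n expr1n addr0 sqrtr1.
have p1 : 0 < cmod (lambda ^+ n.+1) by rewrite cmod_gt0// expf_neq0.
have p2 : 0 < cmod (lambda ^- n.+1) by rewrite cmod_gt0// invr_eq0 expf_neq0.
move=> /(congr1 (@ln R)); rewrite lnM ?posrE// ln1 nat_case rmorphN mulNr => /eqP.
by rewrite addr_eq0 => /eqP.
Qed.

Lemma period_neq0 : period != 0.
Proof.
apply/eqP => p0; move/negP: l1; apply.
have m0 := cmod_gt0 l0; have := lnK m0; rewrite -/period p0 expR0 => e.
by rewrite cmodE -e.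
Qed.

Lemma lognormZ k x : x != 0 -> lognorm (lambda ^ k *: x) = lognorm x + k%:~R * period.
Proof.
move=> x0; rewrite /lognorm ell2_normZc lnM ?posrE ?ell2_norm_gt0//.
  by rewrite ln_cmod_exp addrC.
by rewrite cmod_gt0// expfz_neq0.
Qed.

Lemma hopf_projP z w :
  hopf_proj lambda z = hopf_proj lambda w <-> exists k, set_val z = lambda ^ k *: set_val w.
Proof.
split=> [/eqquotP/asboolP//|zw]; apply/eqquotP; exact/asboolP.
Qed.

Lemma hopf_proj_surj (y : hopf lambda) : exists z, hopf_proj lambda z = y.
Proof. by exists (repr y); rewrite /hopf_proj reprK. Qed.

Definition star_mk x (x0 : x != 0) : ell2_star (R := R) :=
  exist _ x (@mem_set _ [set x : ell2 R | x != 0] x x0).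

Lemma star_neq0 z : set_val z != 0.
Proof. by have : set_val z != 0 := set_valP z. Qed.

Lemma exp_lambda_neq0 k : lambda ^ k != 0.
Proof. exact: expfz_neq0. Qed.

(** The saturation of [O] is the union of its images under powers of [lambda], each of them open. *)
Lemma hopf_proj_open (O : set (ell2 R)) : open O ->
  open [set y : hopf lambda | exists2 z, O (set_val z) & hopf_proj lambda z = y].
Proof.
move=> oO; exists (\bigcup_k [set x | O (lambda ^ k *: x)]).
  apply: bigcup_open => k _.
  have /continuousP cs := @scaler_continuous _ (ell2 R) (lambda ^ k).
  exact: cs.
apply/seteqP; split=> [z [k _ /= Oz]|z /= [w Ow /hopf_projP[k wz]]].
  have z0 : lambda ^ k *: set_val z != 0 by rewrite scaler_eq0 negb_or exp_lambda_neq0 star_neq0.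
  by exists (star_mk z0) => //; apply/hopf_projP; exists k.
by exists k => //=; rewrite -wz.
Qed.

Lemma lognorm_continuous x : x != 0 -> {for x, continuous lognorm}.
Proof.
move=> x0; apply: (@continuous_comp _ _ _ (@rnorm R (ell2 R)) (@ln R)).
  exact: rnorm_continuous.
by apply: continuous_ln; rewrite rnorm_ell2 ell2_norm_gt0.
Qed.

Section annulus.
Context (z0 : ell2_star (R := R)).

(** Its total logarithmic width is [|period|], just small enough to contain at most one point of
    each orbit; the projection is therefore injective on it and its inverse is a chart. *)
Definition annulus : set (ell2 R) :=
  [set x | x != 0 /\ `|lognorm x - lognorm (set_val z0)| < `|period| / 2].

Lemma annulus_open : open annulus.
Proof.
rewrite openE => x [x0 xp]; apply/near_rnormP.
have e0 : 0 < `|period| / 2 - `|lognorm x - lognorm (set_val z0)| by rewrite subr_gt0.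
have [d d0 Hd] := continuous_rnorm (lognorm_continuous x0) e0.
have nx0 : 0 < ell2_norm x by rewrite ell2_norm_gt0.
exists (Num.min d (ell2_norm x)); first by rewrite lt_min d0.
move=> h; rewrite lt_min => /andP[/Hd hd hx]; split.
  apply: contraTneq hx => xh; rewrite -leNgt -rnorm_ell2 -rnormN.
  by rewrite (_ : - x = h)//; apply/eqP; rewrite eq_sym -addr_eq0 addrC xh.
rewrite -(subrKA (lognorm x)); apply: le_lt_trans (ler_normD _ _) _.
by rewrite -ltrBrDr.
Qed.

Lemma annulus_inj z w : annulus (set_val z) -> annulus (set_val w) ->
  hopf_proj lambda z = hopf_proj lambda w -> set_val z = set_val w.
Proof.
move=> [_ az] [_ aw] /hopf_projP[k zw].
have kl : k%:~R * period = (lognorm (set_val z) - lognorm (set_val z0)) -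
    (lognorm (set_val w) - lognorm (set_val z0)).
  by rewrite zw lognormZ ?star_neq0//; ring.
have : `|k%:~R * period| < `|period|.
  by rewrite kl; apply: le_lt_trans (ler_normB _ _) _; lra.
rewrite normrM gtr_pMl ?normr_gt0 ?period_neq0// -intr_norm.
rewrite -[X in _ < X](rmorph1 (intmul (1 : R))) ltr_int => k1.
have k0 : k = 0 by apply/eqP; rewrite -normr_le0; move: k1; case: `|k| => // -[].
by rewrite zw k0 expr0z scale1r.
Qed.

Definition hopf_cdom : set (hopf lambda) :=
  [set y | exists2 z, annulus (set_val z) & hopf_proj lambda z = y].

(** On [hopf_cdom] the representative in the annulus is unique by [annulus_inj], so [xget] returns
    it; elsewhere the value is the default 0. *)
Definition hopf_coord (y : hopf lambda) : ell2 R :=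
  xget 0 [set x | exists z, [/\ x = set_val z, annulus x & hopf_proj lambda z = y]].

Definition hopf_param x : hopf lambda :=
  if pselect (x != 0) is left x0 then hopf_proj lambda (star_mk x0)
  else hopf_proj lambda z0.

Lemma hopf_coordE z : annulus (set_val z) -> hopf_coord (hopf_proj lambda z) = set_val z.
Proof.
move=> az; rewrite /hopf_coord; case: xgetP => [x _ [w [-> aw wz]]|].
  exact: annulus_inj wz.
by move=> /(_ (set_val z)) /=; case; exists z.
Qed.

Lemma hopf_paramE z : hopf_param (set_val z) = hopf_proj lambda z.
Proof.
rewrite /hopf_param; case: pselect => [x0|]; last by case; exact: star_neq0.
by congr hopf_proj; apply: val_inj.
Qed.

Lemma hopf_cimgE : hopf_coord @` hopf_cdom = annulus.
Proof.
apply/seteqP; split=> [_ [_ [z az <-] <-]|x ax]; first by rewrite hopf_coordE.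
have [x0 _] := ax; exists (hopf_proj lambda (star_mk x0)).
  by exists (star_mk x0).
by rewrite hopf_coordE.
Qed.

Lemma hopf_cdom_open : open hopf_cdom.
Proof. exact/hopf_proj_open/annulus_open. Qed.

Lemma hopf_cimg_open : open (hopf_coord @` hopf_cdom).
Proof. by rewrite hopf_cimgE; exact: annulus_open. Qed.

Lemma hopf_coordK y : hopf_cdom y -> hopf_param (hopf_coord y) = y.
Proof. by move=> [z az <-]; rewrite hopf_coordE// hopf_paramE. Qed.

Lemma hopf_coord_continuous y : hopf_cdom y -> {for y, continuous hopf_coord}.
Proof.
move=> [z az <-] U; rewrite /prop_for hopf_coordE// nbhsE => -[Q [oQ Qz] QU].
have oAQ : open (annulus `&` Q) by apply: openI => //; exact: annulus_open.
apply: filterS (open_nbhs_nbhs (conj (hopf_proj_open oAQ) _)).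
  by move=> _ [w [aw Qw] <-]; apply: QU; rewrite /= hopf_coordE.
by exists z.
Qed.

Lemma hopf_param_continuous x : (hopf_coord @` hopf_cdom) x -> {for x, continuous hopf_param}.
Proof.
rewrite hopf_cimgE => -[x0 _] U.
rewrite -[x in hopf_param x]/(set_val (star_mk x0)) hopf_paramE nbhsE => -[Q [oQ Qz] QU].
have [P oP PE] : exists2 P, open P & set_val @^-1` P = hopf_proj lambda @^-1` Q.
  exact: oQ.
have Px : P x by have : (set_val @^-1` P) (star_mk x0) by rewrite PE.
have on0 : open [set x : ell2 R | x != 0].
  rewrite openE => v /= v0; apply/near_rnormP; exists (ell2_norm v); first by rewrite ell2_norm_gt0.
  move=> h hv; apply: contraTneq hv => vh; rewrite -leNgt -rnorm_ell2 -rnormN.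
  by rewrite (_ : - v = h)//; apply/eqP; rewrite eq_sym -addr_eq0 addrC vh.
have := open_nbhs_nbhs (conj (openI oP on0) (conj Px x0)).
apply: filterS => v [Pv v0]; apply: QU.
rewrite /= -[v]/(set_val (star_mk v0)) hopf_paramE.
by have : (hopf_proj lambda @^-1` Q) (star_mk v0) by rewrite -PE.
Qed.

Definition hopf_chart : chart (hopf lambda) (ell2 R) :=
  Chart hopf_cdom_open hopf_cimg_open hopf_coordK hopf_coord_continuous
    hopf_param_continuous.

End annulus.

(** The representative [z] can be prescribed, so that a given height is the logarithm of the norm of
    the coordinate itself, with no multiple of the period to carry along. *)
Lemma hopf_chart_at z : exists d, [/\ hopf_atlas lambda d,
  cdom d (hopf_proj lambda z) & Defs.coord d (hopf_proj lambda z) = set_val z].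
Proof.
have az : annulus z (set_val z).
  by split; [exact: star_neq0|rewrite subrr normr0 divr_gt0// normr_gt0 period_neq0].
exists (hopf_chart z); split; [|by exists z|exact: hopf_coordE].
by move=> _ [w aw <-]; exists w => //; exact: hopf_coordE.
Qed.

End hopf_charts.

(** * Calculus of smooth functions along real lines *)

Section smooth_functions.
Context {R : realType} {E : normedModType R[i]}.
Implicit Types (F G : E -> R) (U : set E) (x u v : E).

Lemma near_line x u (P : set E) : nbhs x P ->
  exists2 d, 0 < d & forall t : R, `|t| < d -> P (x + t%:C *: u).
Proof.
move=> /near_rnormP[d d0 Hd]; have [d' d'0 Hd'] := @rnorm_line R E d u d0.
by exists d' => // t /Hd'; exact: Hd.
Qed.

Lemma rderive_near F G x v : {near x, F =1 G} -> rderivable F x v ->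
  rderivable G x v /\ rderive G x v = rderive F x v.
Proof.
move=> FG dF; have [d d0 Hd] := near_line v FG.
have dF' := derivable1_is_derive dF.
have dG : is_derive (0 : R) (1 : R) (fun t : R => G (x + t%:C *: v)) (rderive F x v).
  exact: is_derive0_near d0 Hd dF'.
by split; [case: dG|exact: derive1_val dG].
Qed.

Lemma near_open U x (P : set E) : open U -> U x -> (forall y, U y -> P y) -> nbhs x P.
Proof. by move=> oU Ux UP; apply: filterS (open_nbhs_nbhs (conj oU Ux)). Qed.

Lemma continuous_near F G x : {near x, F =1 G} ->
  {for x, continuous F} -> {for x, continuous G}.
Proof.
move=> FG cF; suff : G y @[y --> x] --> G x by [].
rewrite -(nbhs_singleton FG); apply: cvg_trans cF.
exact: near_eq_cvg.
Qed.

Lemma eq_Ck k U F G : open U -> (forall x, U x -> F x = G x) -> Ck k U F -> Ck k U G.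
Proof.
elim: k F G => [|k IH] F G oU FG [cF dF]; split.
- by move=> x Ux; exact: continuous_near (near_open oU Ux FG) (cF x Ux).
- by [].
- by move=> x Ux; exact: continuous_near (near_open oU Ux FG) (cF x Ux).
- move=> v; have [dv Cv] := dF v.
  have H x : U x -> rderivable G x v /\ rderive G x v = rderive F x v.
    by move=> Ux; apply: rderive_near (dv x Ux); apply: (near_open oU Ux).
  split; first by move=> x /H[].
  by apply: (IH _ _ oU _ Cv) => x /H[_ ->].
Qed.

Lemma Ck_le k U F : Ck k.+1 U F -> Ck k U F.
Proof.
elim: k F => [|k IH] F [cF dF]; split => //.
by move=> v; have [dv Cv] := dF v; split => //; exact: IH.
Qed.

Lemma CkD k U F G : open U -> Ck k U F -> Ck k U G -> Ck k U (fun x => F x + G x).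
Proof.
move=> oU; elim: k F G => [|k IH] F G [cF dF] [cG dG].
  by split=> // x Ux; apply: cvgD; [exact: cF|exact: cG].
split; first by move=> x Ux; apply: cvgD; [exact: cF|exact: cG].
move=> v; have [dFv CF] := dF v; have [dGv CG] := dG v.
have H x : U x -> is_derive (0 : R) (1 : R) (fun t : R => F (x + t%:C *: v) + G (x + t%:C *: v))
    (rderive F x v + rderive G x v).
  move=> Ux; have d1 := derivable1_is_derive (dFv x Ux).
  have d2 := derivable1_is_derive (dGv x Ux).
  exact: is_deriveD d1 d2.
split; first by move=> x /H[].
by apply: (eq_Ck oU _ (IH _ _ CF CG)) => x /H d; rewrite /rderive (derive1_val d).
Qed.

Lemma CkM k U F G : open U -> Ck k U F -> Ck k U G -> Ck k U (fun x => F x * G x).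
Proof.
move=> oU; elim: k F G => [|k IH] F G CF CG.
  by have [cF _] := CF; have [cG _] := CG; split=> // x Ux; apply: cvgM; [exact: cF|exact: cG].
have CF' := Ck_le CF; have CG' := Ck_le CG.
have [cF dF] := CF; have [cG dG] := CG.
split; first by move=> x Ux; apply: cvgM; [exact: cF|exact: cG].
move=> v; have [dFv CFv] := dF v; have [dGv CGv] := dG v.
have H x : U x -> is_derive (0 : R) (1 : R) (fun t : R => F (x + t%:C *: v) * G (x + t%:C *: v))
    (F x * rderive G x v + rderive F x v * G x).
  move=> Ux; have d1 := derivable1_is_derive (dFv x Ux).
  have d2 := derivable1_is_derive (dGv x Ux).
  have := is_deriveM d1 d2; rewrite scale0r addr0; congr is_derive.
  by rewrite /GRing.scale /= [G x * _]mulrC.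
split; first by move=> x /H[].
apply: (eq_Ck oU _ (CkD oU (IH _ _ CF' CGv) (IH _ _ CFv CG'))) => x /H d.
by rewrite /rderive (derive1_val d).
Qed.

Lemma Ck_cst k U (c : R) : Ck k U (fun=> c).
Proof.
elim: k c => [|k IH] c; (split; first by move=> x _; exact: cvg_cst) => // v.
have H x : is_derive (0 : R) (1 : R) (fun t : R => c) 0 by exact: is_derive_cst.
split; first by move=> x _; case: (H x).
rewrite (_ : (fun x => _) = fun=> 0); first exact: IH.
by apply/funext => x; exact: derive1_val (H x).
Qed.

Lemma smooth_primitive U F (a : E -> E -> R) : open U ->
  (forall x, U x -> {for x, continuous F}) ->
  (forall x v, U x -> rderivable F x v /\ rderive F x v = a x v) ->
  (forall v, smooth_on U (a ^~ v)) -> smooth_on U F.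
Proof.
move=> oU cF dF sa [|k]; first by split.
split=> // v; split; first by move=> x /(dF x v)[].
by apply: (eq_Ck oU _ (sa v k)) => x /(dF x v)[].
Qed.

(* The derivatives of [F] are products of [F] with smooth functions, so its
   regularity bootstraps. *)
Lemma smooth_exponential U F (a : E -> E -> R) : open U ->
  (forall x, U x -> {for x, continuous F}) ->
  (forall x v, U x -> rderivable F x v /\ rderive F x v = - F x * a x v) ->
  (forall v, smooth_on U (a ^~ v)) -> smooth_on U F.
Proof.
move=> oU cF dF sa; elim => [|k IH]; first by split.
split=> // v; split; first by move=> x /(dF x v)[].
apply: (eq_Ck oU _ (CkM oU (CkM oU (Ck_cst k U (-1)) IH) (sa v k))) => x /(dF x v)[_ ->].
by rewrite mulN1r.
Qed.

(** First derivatives have to agree on a whole neighbourhood before second ones can be compared at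
    [x]; this explains the different ranges of the two derivability hypotheses. *)
Lemma ddc_near F G x u v (U : set E) : open U -> U x ->
  (forall y, U y -> F y = G y) ->
  (forall y w, U y -> rderivable F y w) ->
  (forall w w', rderivable (fun y => dc F y w) x w') ->
  ddc G x u v = ddc F x u v.
Proof.
move=> oU Ux FG dF ddF.
have dcE w : {near x, (fun y => dc F y w) =1 (fun y => dc G y w)}.
  apply: (near_open oU Ux) => y Uy; rewrite /dc.
  have nFG : {near y, F =1 G} by exact: (near_open oU Uy).
  by have [_ ->] := rderive_near nFG (dF y ('i%C *: w) Uy).
rewrite /ddc /d1.
by have [_ ->] := rderive_near (dcE v) (ddF v u); have [_ ->] := rderive_near (dcE u) (ddF u v).
Qed.

Lemma connected_rnorm_ball x (d : R) : 0 < d -> connected [set y | rnorm (y - x) < d].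
Proof.
move=> d0; rewrite (_ : [set _ | _] = \bigcup_(v in [set v | rnorm v < d])
    ((fun t : R => x + t%:C *: v) @` `[0, 1])).
  apply: bigcup_connected.
    by exists x => v _; exists 0; rewrite /= ?in_itv/= ?lexx ?ler01// scale0r addr0.
  move=> v _; apply: connected_continuous_connected; first exact: segment_connected.
  apply: continuous_subspaceT => t U /(near_line v)[e e0 He].
  apply/nbhs_ballP; exists e => //= s; rewrite /ball /= distrC => ts.
  have := He _ ts; congr U.
  by rewrite rmorphB scalerBl -addrA [t%:C *: v + _]addrC subrK.
apply/seteqP; split=> [y yd|_ [v vd [t t01 <-]]] /=.
  exists (y - x) => //; exists 1; rewrite /= ?in_itv/= ?lexx ?ler01//.
  by rewrite scale1r addrC subrK.
rewrite addrC addKr rnormZr; apply: le_lt_trans vd.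
move: t01; rewrite /= in_itv/= => /andP[t0 t1].
by rewrite ger0_norm// ler_piMl// rnorm_ge0.
Qed.

End smooth_functions.

(** * Germs of maps read in charts *)

Lemma near_diff {R : realType} {V W : normedModType R[i]} (f g : V -> W) x :
  {near x, f =1 g} -> differentiable f x -> 'd g x = 'd f x :> (V -> W).
Proof.
move=> fg df; apply: diff_unique; first exact: diff_continuous.
have fgx : f x = g x by exact: nbhs_singleton fg.
apply/eqaddoP => e e0; have /eqaddoP/(_ e e0) := diff_locally df.
have nfg : \forall h \near 0, f (h + x) = g (h + x).
  have sx : h + x @[h --> (0 : V)] --> 0 + x.
    exact: (cvgD cvg_id (cvg_cst x)).
  have fg' : nbhs (0 + x) [set y | f y = g y] by rewrite add0r.
  exact: (sx _ fg').
apply: filterS2 nfg => h e1.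
rewrite -[(f \o shift x - _) h]/(f (h + x) - (f x + 'd f x h)).
by rewrite -[(g \o shift x - _) h]/(g (h + x) - (g x + 'd f x h)) e1 fgx.
Qed.

Section charts.
Context {R : realType} {E : normedModType R[i]} {M : topologicalType}.
Implicit Types (c : chart M E) (m : M) (x : E).

Lemma cimg_param c x : cimg c x -> cdom c (param c x) /\ Defs.coord c (param c x) = x.
Proof. by move=> [m cm <-]; rewrite coordK. Qed.

Lemma cimg_coord c m : cdom c m -> cimg c (Defs.coord c m).
Proof. by move=> cm; exists m. Qed.

Lemma cimg_nbhs c x : cimg c x -> nbhs x (cimg c).
Proof. by move=> cx; apply: open_nbhs_nbhs; split => //; exact: cimg_open. Qed.

Lemma local_dom_param {N : topologicalType} {G : normedModType R[i]}
    (F : M -> N) c (e : chart N G) x :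
  local_dom F c e x <-> cimg c x /\ cdom e (F (param c x)).
Proof.
split=> [[m [cm em] <-]|[cx ex]]; first by rewrite coordK//; split => //; exists m.
by have [cp <-] := cimg_param cx; exists (param c x).
Qed.

Lemma local_dom_open {N : topologicalType} {G : normedModType R[i]}
    (F : M -> N) c (e : chart N G) : continuous F -> open (local_dom F c e).
Proof.
move=> cF; rewrite openE => x /local_dom_param[cx ex].
have nE : nbhs (F (param c x)) (cdom e).
  by apply: open_nbhs_nbhs; split => //; exact: cdom_open.
have cp : {for x, continuous (F \o param c)}.
  by apply: continuous_comp; [exact: param_continuous|exact: cF].
apply: filterS2 (cimg_nbhs cx) (cp _ nE) => y cy ey.
exact/local_dom_param.
Qed.

(** Local connectedness: [B] is the image under [param c] of a small ball, which is a union of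
    segments through its centre. *)
Lemma connected_chart_nbhs c m (V : set M) : cdom c m -> open V -> V m ->
  exists B, [/\ open B, connected B, B m & B `<=` V].
Proof.
move=> cm oV Vm; pose x0 := Defs.coord c m.
have cx0 : cimg c x0 by exact: cimg_coord.
have nV : nbhs (param c x0) V by rewrite coordK//; exact: open_nbhs_nbhs.
have nc : nbhs x0 (cimg c `&` (V \o param c)).
  exact: filterI (cimg_nbhs cx0) (param_continuous cx0 nV).
have [d d0 Hd] := (near_rnormP _ _).1 nc.
pose D := [set y | rnorm (y - x0) < d].
have Dc y : D y -> cimg c y /\ V (param c y).
  by move=> Dy; have := Hd _ Dy; rewrite addrC subrK.
exists (param c @` D); split.
- rewrite openE => _ [y Dy <-]; have [cy _] := Dc _ Dy.
  have [py ey] := cimg_param cy.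
  have nD : nbhs (Defs.coord c (param c y)) D.
    rewrite ey; apply/near_rnormP; exists (d - rnorm (y - x0)); first by rewrite subr_gt0.
    move=> h hd; rewrite /D /= addrAC; apply: le_lt_trans (rnormD _ _) _.
    by rewrite -ltrBrDl.
  have nV' : nbhs (param c y) (cdom c).
    by apply: open_nbhs_nbhs; split => //; exact: cdom_open.
  have nD' : nbhs (param c y) (Defs.coord c @^-1` D) by exact: Defs.coord_continuous py _ nD.
  apply: filterS2 nV' nD' => m' cm' Dm'.
  by exists (Defs.coord c m'); rewrite ?coordK.
- apply: connected_continuous_connected; first exact: connected_rnorm_ball.
  apply: continuous_in_subspaceT => y /set_mem Dy.
  by apply: param_continuous; have [] := Dc _ Dy.
- by exists x0; rewrite ?coordK// /D /= subrr rnorm0.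
- by move=> _ [y Dy <-]; have [] := Dc _ Dy.
Qed.

(** The transition map is replaced by any [f] with the same germ because the projection and the deck
    transformations, read in lifted charts, agree with it only near [x]. *)
Lemma pullback_germ (A : set (chart M E)) (om : form2 E M) (th : form1 E M)
    c c' x (f : E -> E) :
  complex_atlas A -> is_form2 A om -> is_form1 A th -> A c -> A c' ->
  local_dom id c c' x -> {near x, local_map id c c' =1 f} ->
  (forall u, th c x u = th c' (f x) ('d f x u)) /\
  (forall u v, om c x u v = om c' (f x) ('d f x u) ('d f x v)).
Proof.
move=> [_ [_ holA]] [_ _ _ pom] [_ _ pth] Ac Ac' cx nf.
have df := holA c c' Ac Ac' x cx.
have fx : local_map id c c' x = f x by exact: nbhs_singleton nf.
have dE := near_diff nf df.
have dEu u : 'd f x u = 'd (local_map id c c') x u := congr1 (fun k => k u) dE.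
split=> [u|u v]; rewrite -fx.
  exact: (etrans (pth c c' Ac Ac' x cx u) (esym (congr1 (th c' _) (dEu u)))).
exact: (etrans (pom c c' Ac Ac' x cx u v) (esym (congr2 (om c' _) (dEu u) (dEu v)))).
Qed.

End charts.

Lemma row_not_multiple {K : fieldType} n (u : 'rV[K]_n) : (2 <= n)%N ->
  exists v : 'rV[K]_n, forall c : K, v != c *: u.
Proof.
case: n u => [|[|n]] // u _.
have [[i ui]|u0] := pselect (exists i, u ord0 i != 0).
  have [j ji] : exists j : 'I_n.+2, j != i.
    have [->|i0] := eqVneq i ord0; first by exists ord_max.
    by exists ord0; rewrite eq_sym.
  exists (delta_mx ord0 j) => c; apply/eqP => /matrixP H.
  have := H ord0 i; rewrite !mxE eqxx /= [i == j]eq_sym (negPf ji) => /esym/eqP.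
  rewrite mulf_eq0 (negPf ui) orbF => /eqP c0.
  by have := H ord0 j; rewrite !mxE !eqxx c0 mul0r => /eqP; rewrite oner_eq0.
have u00 : u ord0 ord0 = 0 by apply/eqP/negPn/negP => h; apply: u0; exists ord0.
exists (delta_mx ord0 ord0) => c; apply/eqP => /matrixP H.
by have := H ord0 ord0; rewrite !mxE !eqxx u00 mulr0 => /eqP; rewrite oner_eq0.
Qed.

(** * The global potential on the covering *)

Section lifted_potential.
Context {R : realType} (n : nat) {M : topologicalType}.
Local Notation E := 'rV[R[i]]_n.
Context (A : set (chart M E)) (omega : form2 E M) (theta : form1 E M)
  (lambda : R[i]) (F : M -> hopf lambda).
Context (n_ge2 : (2 <= n)%N) (mfM : complex_manifold A) (cptM : compact [set: M])
  (lck : lck_structure A omega theta) (l0 : lambda != 0) (l1 : `|lambda| != 1)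
  (holF : holomorphic A (hopf_atlas lambda) F)
  (pbF : is_pullback2 A (hopf_atlas lambda) F (hopf_form lambda) omega).

Let atlasA : complex_atlas A. Proof. by case: mfM. Qed.
Let form_omega : is_form2 A omega. Proof. by case: lck => -[]. Qed.
Let form_theta : is_form1 A theta. Proof. by case: lck. Qed.
Let contF : continuous F. Proof. by case: holF. Qed.
Let period0 : period lambda != 0. Proof. exact: period_neq0. Qed.

Section local_potential.
Context (c : chart M E) (e : chart (hopf lambda) (ell2 R)).
Context (Ac : A c) (Be : hopf_atlas lambda e).
Let f := local_map F c e.
Let W := local_dom F c e.
Let psi (x : E) : R := ell2_norm (f x) ^+ 2.

Let oW : open W. Proof. exact: local_dom_open. Qed.
Let dW x : W x -> differentiable f x. Proof. by case: holF => _; apply. Qed.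
Let Wc x : W x -> cimg c x. Proof. by move=> /local_dom_param[]. Qed.

Lemma local_map_neq0 x : W x -> f x != 0.
Proof.
by move=> /local_dom_param[_ /Be[z ez _]]; rewrite /f /local_map /= ez star_neq0.
Qed.

Let om_der x u v w : W x -> rderivable (fun y => omega c y u v) x w.
Proof.
move=> Wx; have [_ _ sm _] := form_omega.
by have [_ /(_ w)[+ _]] := sm c u v Ac 1%N; apply; exact: Wc.
Qed.

Let om_cont x u v : W x -> {for x, continuous (fun y => omega c y u v)}.
Proof.
move=> Wx; have [_ _ sm _] := form_omega.
by have [+ _] := sm c u v Ac 0%N; apply; exact: Wc.
Qed.

Let om_pos x u : W x -> u != 0 -> 0 < omega c x u ('i%C *: u).
Proof. by move=> Wx; have [[_ _ + ] _ _ _] := lck; apply => //; exact: Wc. Qed.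

Let d_om x u v w : W x -> d2 (omega c) x u v w = wedge12 (theta c x) (omega c x) u v w.
Proof. by move=> Wx; have [_ _ _ +] := lck; apply => //; exact: Wc. Qed.

Let omE x u v : W x -> omega c x u v =
  ell2_norm (f x) ^- 2 * flat_form (f x) ('d f x u) ('d f x v).
Proof. by move=> Wx; rewrite (pbF Ac Be Wx). Qed.

Lemma rderive_local x u : W x ->
  rderivable psi x u /\ rderive psi x u = - psi x * theta c x u.
Proof.
exact: (rderive_psi oW dW local_map_neq0 omE om_der om_cont om_pos d_om
  (fun u => row_not_multiple u n_ge2)).
Qed.

Lemma ddc_local x u v : W x -> ddc psi x u v = psi x * omega c x u v.
Proof. exact: (ddc_psi oW dW local_map_neq0 omE om_der om_cont). Qed.

Lemma rderivable_dc_local x u v : W x -> rderivable (fun y => dc psi y v) x u.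
Proof.
by move=> Wx; case: (is_derive_dc oW dW local_map_neq0 omE om_der om_cont u v Wx).
Qed.

End local_potential.

(* A point [z] above [F m] is determined by [ln |z|], as [|lambda| <> 1]: this is
   the pull-back by [F] of the covering of the Hopf manifold, embedded in [M * R]. *)
Definition log_fibre : set (M * R) := [set mt |
  exists z, hopf_proj lambda z = F mt.1 /\ lognorm (set_val z) = mt.2].
Local Notation L := log_fibre.
Local Notation ell := (period lambda).

(** Where [F] stays in one Hopf chart, the logarithm of the norm of the coordinate is a continuous
    branch of the height; all other representatives are multiples by powers of [lambda], which shift
    it by multiples of the period. *)
Lemma log_fibre_chart m z : hopf_proj lambda z = F m ->
  exists e V, [/\ hopf_atlas lambda e, Defs.coord e (F m) = set_val z, V m,
    V `<=` F @^-1` cdom e &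
    fibre_chart ell L V (fun m => lognorm (Defs.coord e (F m)))].
Proof.
move=> zm; have [e [Be ez cez]] := hopf_chart_at l0 l1 z.
rewrite zm in ez cez.
have [c Ac cm] := atlasA.1 m.
have oV : open (F @^-1` cdom e).
  by have /continuousP := contF; apply; exact: cdom_open.
have [V [oB cB Vm VF]] := connected_chart_nbhs cm oV ez.
exists e, V; split=> //; split=> // [m' Vm'|m' t Vm'].
  have em' : cdom e (F m') by exact: VF.
  apply: (@continuous_comp _ _ _ (Defs.coord e \o F)).
    by apply: continuous_comp; [exact: contF|exact: Defs.coord_continuous].
  by apply: lognorm_continuous; have [w ew _] := Be _ em'; rewrite /= ew star_neq0.
have em' : cdom e (F m') by exact: VF.
have [w ew wF] := Be _ em'; rewrite ew; split=> [[z' [/= z'F <-]]|[k ->]].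
  have /hopf_projP[k ->] : hopf_proj lambda z' = hopf_proj lambda w by rewrite z'F.
  by exists k; rewrite lognormZ// star_neq0.
have w0 : lambda ^ k *: set_val w != 0.
  by rewrite scaler_eq0 negb_or exp_lambda_neq0// star_neq0.
exists (star_mk w0); split; last by rewrite -lognormZ// star_neq0.
by rewrite /= -wF; apply/hopf_projP; exists k.
Qed.

Let fibre_charts m : exists V s, V m /\ fibre_chart ell L V s.
Proof.
have [z zm] := hopf_proj_surj (F m).
by have [e [V [_ _ Vm _ cV]]] := log_fibre_chart zm; exists V; eexists; split; [exact: Vm|exact: cV].
Qed.

Context (pt : M * R) (Lpt : L pt).
Local Notation N := (total_space L pt).
Local Notation p := (@total_proj R M L pt).
Local Notation AN := (lifted_atlas A p).

Let connM : connected [set: M]. Proof. by case: mfM. Qed.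

Definition potential (y : N) : R := expR (2 * height y).

Lemma potential_gt0 y : 0 < potential y.
Proof. exact: expR_gt0. Qed.

Lemma height2_continuous : continuous (fun y : N => 2 * height y).
Proof.
rewrite (_ : (fun _ => _) = (fun y => height y + height y)).
  move=> y; have c1 : height z @[z --> y] --> height y by exact: height_continuous.
  exact: (cvgD c1 c1).
by apply/funext => y; rewrite mulr2n mulrDl mul1r.
Qed.

Lemma potential_continuous : continuous potential.
Proof.
move=> y; apply: (@continuous_comp _ _ _ (fun y => 2 * height y) expR).
  exact: height2_continuous.
exact: continuous_expR.
Qed.

Definition lifts (d : chart N E) (c : chart M E) :=
  [/\ A c, cdom d `<=` p @^-1` cdom c &
      forall y, cdom d y -> Defs.coord d y = Defs.coord c (p y)].

Lemma lifted_atlasP d : AN d <-> exists c, lifts d c.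
Proof. by split=> [[c Ac [dc cE]]|[c [Ac dc cE]]]; exists c. Qed.

Lemma lifts_cimg d c x : lifts d c -> cimg d x ->
  [/\ cimg c x, cdom d (param d x) & param c x = p (param d x)].
Proof.
move=> [_ dc cE] dx; have [dp ep] := cimg_param dx; have cp := dc _ dp.
have xE : x = Defs.coord c (p (param d x)) by rewrite -cE// ep.
by split=> //; rewrite xE; [exact: cimg_coord|rewrite -xE {1}xE coordK].
Qed.

Lemma potential_local d c x : lifts d c -> cimg d x ->
  exists e W, [/\ open W, W x, hopf_atlas lambda e, W `<=` local_dom F c e &
    forall x', W x' -> ell2_norm (local_map F c e x') ^+ 2 = potential (param d x')].
Proof.
move=> dc dx; have [cx dpx pE] := lifts_cimg dc dx; set y := param d x in dpx pE.
have [z [/= zF hz]] : L (p y, height y) by exact: (total_sub_L (total_setP y)).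
have [e [V [Be ez Vy VF cV]]] := log_fibre_chart zF.
(* The Hopf chart was taken at a representative [z] whose logarithm is the height of [y], so the
   sheet has index 0; [height_near] keeps this index nearby, and there the potential is exactly
   [|f|^2]. *)
have hy : height y = lognorm (Defs.coord e (F (p y))) + (0 : int)%:~R * ell.
  by rewrite mul0r addr0 ez hz.
have ny := height_near period0 cV Vy hy.
have nx : nbhs x [set x' | cimg d x' /\ (V (p (param d x')) /\
    height (param d x') = lognorm (Defs.coord e (F (p (param d x')))) + (0 : int)%:~R * ell)].
  apply: filterI; first exact: cimg_nbhs.
  exact: (param_continuous dx ny).
move: nx; rewrite nbhsE => -[W [oW Wx] HW].
exists e, W; split=> // x' /HW[dx' [Vx' hx']]; have [cx' dpx' pE'] := lifts_cimg dc dx'.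
  by apply/local_dom_param; rewrite pE'; split => //; exact: VF.
rewrite /potential hx' mul0r addr0 /local_map /= pE'.
have [w ew _] := Be _ (VF _ Vx'); rewrite ew /lognorm.
by rewrite mulrC expRM_natr lnK// posrE ell2_norm_gt0 star_neq0.
Qed.

Section potential_in_chart.
Context (d : chart N E) (c : chart M E) (dc : lifts d c).
Let psi x := potential (param d x).

Lemma potential_derivative x u : cimg d x ->
  rderivable psi x u /\ rderive psi x u = - psi x * theta c x u.
Proof.
move=> dx; have [e [W [oW Wx Be WF E]]] := potential_local dc dx.
have [Ac _ _] := dc; have [d1 d2] := @rderive_local c e Ac Be x u (WF _ Wx).
have [d3 d4] := rderive_near (near_open oW Wx E) d1.
by split=> //; rewrite d4 d2 E.
Qed.

Lemma potential_ddc x u v : cimg d x -> ddc psi x u v = psi x * omega c x u v.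
Proof.
move=> dx; have [e [W [oW Wx Be WF E]]] := potential_local dc dx.
have [Ac _ _] := dc; have Wfx := WF _ Wx.
have H1 y w : W y -> rderivable (fun y => ell2_norm (local_map F c e y) ^+ 2) y w.
  by move=> Wy; have [] := @rderive_local c e Ac Be y w (WF _ Wy).
have H2 w w' := @rderivable_dc_local c e Ac Be x w' w Wfx.
have E1 := ddc_near u v oW Wx E H1 H2.
have E2 := @ddc_local c e Ac Be x u v Wfx.
exact: (etrans E1 (etrans E2 (congr1 (fun r => r * omega c x u v) (E _ Wx)))).
Qed.

Lemma potential_chart_continuous x : cimg d x -> {for x, continuous psi}.
Proof.
move=> dx; apply: continuous_comp; first exact: param_continuous.
exact: potential_continuous.
Qed.

(** Smoothness is restricted from the image of [c] to the possibly smaller image of [d]; the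
    function is generalised in the induction because [Ck] passes to directional derivatives. *)
Lemma lifts_smooth_theta v : smooth_on (cimg d) (fun x => theta c x v).
Proof.
move=> k; have [Ac _ _] := dc; have [_ sm _] := form_theta.
elim: k (fun x => theta c x v) (sm c v Ac k) => [|k IH] g [cg dg].
  by split=> // x /(lifts_cimg dc)[cx _ _]; exact: cg.
split; first by move=> x /(lifts_cimg dc)[cx _ _]; exact: cg.
move=> w; have [dgw Cg] := dg w; split; last exact: IH.
by move=> x /(lifts_cimg dc)[cx _ _]; exact: dgw.
Qed.

Lemma potential_smooth : smooth_on (cimg d) psi.
Proof.
apply: (smooth_exponential (cimg_open d) potential_chart_continuous).
  by move=> x v dx; exact: potential_derivative.
exact: lifts_smooth_theta.
Qed.

Lemma height_derivative x u : cimg d x ->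
  let h x := - (2 * height (param d x)) in
  rderivable h x u /\ rderive h x u = theta c x u.
Proof.
move=> dx h; have hE : h = (fun x => - ln (psi x)).
  by apply/funext => y; rewrite /h /psi /potential expRK.
have [d1 d2] := potential_derivative u dx; have := derivable1_is_derive d1.
rewrite -/(rderive psi x u) d2 => dpsi.
have psi0 : 0 < psi (x + (0 : R)%:C *: u) by exact: potential_gt0.
have dln := is_derive1_ln psi0.
have := is_deriveN (@is_derive1_comp _ (@ln R) (fun t : R => psi (x + t%:C *: u)) 0 _ _ dln dpsi).
rewrite scale0r addr0 mulNr mulrN opprK mulKf; last by rewrite gt_eqF// potential_gt0.
move=> dh; rewrite hE; split; first by case: dh.
exact: (derive1_val dh).
Qed.

Lemma height_smooth : smooth_on (cimg d) (fun x => - (2 * height (param d x))).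
Proof.
apply: (smooth_primitive (cimg_open d) _ _ lifts_smooth_theta) => [x dx|x v dx]; last exact: height_derivative.
apply: (@continuous_comp _ _ _ (param d) (fun y : N => - (2 * height y))).
  exact: param_continuous.
have c1 : 2 * height z @[z --> param d x] --> 2 * height (param d x).
  exact: height2_continuous.
exact: (cvgN c1).
Qed.

End potential_in_chart.

Lemma lifts_pullback (d : chart N E) c c' x (f : E -> E) : lifts d c -> A c' ->
  cimg d x -> cdom c' (p (param d x)) ->
  {near x, f =1 (fun x' => Defs.coord c' (p (param d x')))} ->
  (forall u, theta c x u = theta c' (f x) ('d f x u)) /\
  (forall u v, omega c x u v = omega c' (f x) ('d f x u) ('d f x v)).
Proof.
move=> dc Ac' dx c'x nf; have [Ac _ _] := dc; have [cx dpx pE] := lifts_cimg dc dx.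
apply: (pullback_germ atlasA form_omega form_theta Ac Ac').
  by apply/local_dom_param; rewrite pE.
apply: filterS2 nf (cimg_nbhs dx) => x' -> dx'.
by have [_ _ pE'] := lifts_cimg dc dx'; rewrite /local_map /= pE'.
Qed.

Lemma proper_potential : has_proper_potential A omega theta.
Proof.
have [c0 Ac0 _] := atlasA.1 pt.1.
(* A form on [N] needs one expression per chart, so each lifted chart gets a chosen chart of [M]
   with the same coordinates, and the lift of [omega] has the same expression there.
   [lifts_pullback] compares different choices; [c0] fills in outside the atlas. *)
have [phi phiP] : exists phi : chart N E -> chart M E, forall d, AN d -> lifts d (phi d).
  have /choice[phi phiP] : forall d : chart N E, exists c, AN d -> lifts d c.
    move=> d; have [/lifted_atlasP[c dc]|nd] := pselect (AN d); first by exists c.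
    by exists c0.
  by exists phi.
pose h (y : N) : R := - (2 * height y).
pose omega' : form2 E N := fun d => omega (phi d).
have expN y : expR (- h y) = potential y by rewrite /h opprK.
exists N, p, h, (scale2 (fun y => expR (- h y)) omega'), potential.
split; last 1 first.
- move=> K cK K0.
  (* The potential lies in [K] exactly when the height lies in [K'], which is compact because [ln]
     is continuous on the positive set [K]. *)
  pose K' := (fun r => ln r / 2) @` K.
  have cK' : compact K'.
    apply: continuous_compact => //; apply: continuous_in_subspaceT => r /set_mem Kr.
    apply: cvgM; last exact: cvg_cst.
    by apply: continuous_ln; exact: K0.
  have := height_proper (pt := pt) period0 fibre_charts cptM cK'.
  congr compact; apply/seteqP; split=> y /=.
    move=> [r Kr hr]; rewrite /potential -hr mulrC divfK// lnK// posrE.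
    exact: K0.
  move=> Ky; exists (potential y) => //.
  by rewrite /potential expRK mulrC mulKf.
- split.
  + have G := total_galois period0 connM Lpt fibre_charts; exact: G.
  + by move=> d ANd; exact: height_smooth (phiP d ANd).
  + move=> d c ANd Ac x /local_dom_param[dx cx] u f.
    have dc := phiP d ANd.
    have nf : {near x, f =1 (fun x' => Defs.coord c (p (param d x')))}.
      exact: (near_open openT I (fun _ _ => erefl)).
    have [e _] := lifts_pullback dc Ac dx cx nf.
    by rewrite -e; exact: (height_derivative dc u dx).2.
  + exists omega' => //.
    move=> d c ANd Ac x /local_dom_param[dx cx] u v f.
    have nf : {near x, f =1 (fun x' => Defs.coord c (p (param d x')))}.
      exact: (near_open openT I (fun _ _ => erefl)).
    have [_ e] := lifts_pullback (phiP d ANd) Ac dx cx nf.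
    exact: e.
- split.
  + by move=> d ANd; exact: potential_smooth (phiP d ANd).
  + exact: potential_gt0.
  + move=> d x ANd dx u v; rewrite /scale2 expN.
    by rewrite /ddcfun (potential_ddc (phiP d ANd)).
  + have [t0 Ct0] := total_proj_surj connM Lpt fibre_charts pt.1.
    pose y0 := total_mk Ct0.
    (* The character has to be a function of every [g], so it is defined by evaluation at one point;
       a deck transformation shifts heights by a constant [a], and the quotient is then [e^(2 a)] at
       every point. *)
    exists (fun g => potential (g y0) / potential y0) => g dg.
    have [a ga] := deck_height period0 connM Lpt fibre_charts dg.
    have psig y : potential (g y) = expR (2 * a) * potential y.
      by rewrite /potential ga mulrDr expRD mulrC.
    have chiE : potential (g y0) / potential y0 = expR (2 * a).
      by rewrite psig mulfK// gt_eqF// potential_gt0.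
    rewrite chiE; split; [exact: expR_gt0| |exact: psig].
    (* The lift of [omega] is unchanged by [g] because [p \o g = p]; the whole factor comes from the
       potential multiplying it. *)
    move=> d d' ANd ANd' x /local_dom_param[dx d'x] u v f.
    have dc := phiP d ANd; have dc' := phiP d' ANd'; have [Ac' d'c' cE'] := dc'.
    have [cg pg _] := dg; have pgE y : p (g y) = p y by rewrite -[in RHS]pg.
    have c'x : cdom (phi d') (p (param d x)) by rewrite -pgE; exact: d'c'.
    have nf : {near x, f =1 (fun x' => Defs.coord (phi d') (p (param d x')))}.
      have nd' : nbhs (g (param d x)) (cdom d').
        by apply: open_nbhs_nbhs; split => //; exact: cdom_open.
      have cgp : {for x, continuous (g \o param d)}.
        by apply: continuous_comp; [exact: param_continuous|exact: cg].
      have nd2 : nbhs x ((g \o param d) @^-1` cdom d') by exact: (cgp _ nd').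
      apply: filterS nd2 => x' d'x'.
      by rewrite /f /local_map /= cE'// pgE.
    have [_ e] := lifts_pullback dc Ac' dx c'x nf.
    rewrite /scale2 !expN /omega' -e mulrA; congr (_ * _).
    by rewrite -psig /f /local_map /= coordK.
Qed.

End lifted_potential.

Theorem proposition3p6 (R : realType) (n : nat) (M : topologicalType)
    (A : set (chart M 'rV[R[i]]_n))
    (omega : form2 'rV[R[i]]_n M) (theta : form1 'rV[R[i]]_n M)
    (lambda : R[i]) (F : M -> hopf lambda) :
  (2 <= n)%N ->
  complex_manifold A -> compact [set: M] ->
  lck_structure A omega theta ->
  lambda != 0 -> `|lambda| != 1 ->
  holomorphic A (hopf_atlas lambda) F ->
  is_pullback2 A (hopf_atlas lambda) F (hopf_form lambda) omega ->
  has_proper_potential A omega theta.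
Proof.
move=> n_ge2 mfM cptM lck l0 l1 holF pbF.
(* Any point of [M] and any representative of its image give a base point of [log_fibre], which
   selects the component. *)
have [_ _ [m _] _ _] := mfM; have [z zm] := hopf_proj_surj (F m).
apply: (@proper_potential R n M A omega theta lambda F n_ge2 mfM cptM lck l0 l1
  holF pbF (m, lognorm (set_val z))).
by exists z.
Qed.
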